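(* Let $n_1\ge1$, $n_2\ge 2$, $n=n_1+n_2$. Let $D_1$ be a domain in $\mathbb{C}^{n_1}$ and let $D_2=\{z\in\mathbb{C}^{n_2}:\ \mathrm{Re}(z_j)=0,\ 1\le j\le n_2\}\cap B^{n_2}(0,\tfrac12)$. Put $K=\overline{D_1\times D_2}$. If $K$ is a compact subset of the unit ball $B^n$ and $D:=B^n\setminus K$ is connected, then for every $z\in D$, $$s_D(z)=\tilde e_D(z)=d_{c_{B^n}}^{K}(z).$$
   Context: $B^n$ is the open Euclidean unit ball in $\mathbb{C}^n$, $B^n(p,\delta)$ the open Euclidean ball with centre $p$ and radius $\delta$, $\mathbb{D}$ the unit disk in $\mathbb{C}$, and $O(X,Y)$ the set of holomorphic maps from $X$ into $Y$. Carathéodory pseudodistance on a domain $X$: $c_X(z,w)=\sup\{\tanh^{-1}|\lambda| : f\in O(X,\mathbb{D}),\ f(z)=0,\ f(w)=\lambda\}$, with balls $B^c_X(z,r)=\{w\in X: c_X(z,w)<r\}$. For a nonempty compact $S\subset B^n$ and $z\in B^n\setminus S$, $d_{c_{B^n}}^{S}(z)=\min_{w\in S}\tanh[c_{B^n}(z,w)]$. For a bounded domain $X\subset\mathbb{C}^n$ and $z\in X$: squeezing function $s_X(z)=\sup\{r>0:\ rB^n\subset f(X)$ for some injective $f\in O(X,B^n)$ with $f(z)=0\}$; Fridman invariant $\tilde e_X(z)=\sup\{\tanh(r):\ B^c_X(z,r)\subset f(B^n)$ for some injective $f\in O(B^n,X)\}$. *)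

(* Defs.v *)
From HB Require Import structures.
From mathcomp Require Import all_boot all_order all_algebra.
From mathcomp Require Import all_classical all_reals all_analysis.
From mathcomp Require Import complex.
Set Implicit Arguments.
Unset Strict Implicit.
Unset Printing Implicit Defensive.
Import Order.TTheory GRing.Theory Num.Theory.
Import numFieldNormedType.Exports.
Local Open Scope classical_set_scope.
Local Open Scope complex_scope.
Local Open Scope ring_scope.

(* R[i] gets over itself the structures that the library gives to an abstract
   numFieldType; in particular 'rV[R[i]]_n is then a normed R[i]-module, for the
   sup norm, with the usual topology of C^n. *)
HB.instance Definition _ (R : realType) := GRing.ComAlgebra.copy R[i] R[i]^o.
HB.instance Definition _ (R : realType) := Vector.copy R[i] R[i]^o.
HB.instance Definition _ (R : realType) := NormedModule.copy R[i] R[i]^o.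

Section Hyperbolic.
Context {R : realType}.

Definition tanh (x : R) : R :=
  (expR x - expR (- x)) / (expR x + expR (- x)).

Definition artanh (x : R) : R := ln ((1 + x) / (1 - x)) / 2.

Definition etanh (x : \bar R) : R :=
  match x with
  | r%:E => tanh r
  | +oo%E => 1
  | -oo%E => -1
  end.

End Hyperbolic.

(* Junk value 0 when A has no least element. *)
Definition min_of {R : realType} (A : set R) : R := xget 0 (A `&` lbound A).

Section Balls.
Context {R : realType}.
Local Notation C := R[i].

Definition enorm {n : nat} (z : 'rV[C]_n) : R :=
  Num.sqrt (\sum_(j < n) Normc.normc (z 0 j) ^+ 2).

Definition eball {n : nat} (p : 'rV[C]_n) (r : R) : set 'rV[C]_n :=
  [set z | enorm (z - p) < r].

Definition unit_ball (n : nat) : set 'rV[C]_n := eball 0 1.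

End Balls.

Arguments unit_ball {R} n _.

Section ComplexSpace.
Context {R : realType}.
Local Notation C := R[i].

Definition unit_disk : set C := [set z | Normc.normc z < 1].

Definition is_domain {n : nat} (X : set 'rV[C]_n) : Prop :=
  [/\ X !=set0, open X & connected X].

(* O(X, Y), for X open.  Differentiability is over the field C, i.e. the
   differential is C-linear.  A map on X is represented by a total function
   whose values outside X are irrelevant. *)
Definition holo {U V : normedModType C} (X : set U) (Y : set V) : set (U -> V) :=
  [set f | forall x, X x -> differentiable f x /\ Y (f x)].

Definition caratheodory {n : nat} (X : set 'rV[C]_n) (z w : 'rV[C]_n) : \bar R :=
  ereal_sup [set (artanh (Normc.normc (f w)))%:E |
             f in holo X unit_disk `&` [set f | f z = 0]].

Definition caratheodory_ball {n : nat} (X : set 'rV[C]_n) (z : 'rV[C]_n) (r : R) :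
    set 'rV[C]_n :=
  [set w | X w /\ (caratheodory X z w < r%:E)%E].

Definition caratheodory_dist {n : nat} (S : set 'rV[C]_n) (z : 'rV[C]_n) : R :=
  min_of [set etanh (caratheodory (unit_ball n) z w) | w in S].

Definition squeezing {n : nat} (X : set 'rV[C]_n) (z : 'rV[C]_n) : \bar R :=
  ereal_sup [set r%:E | r in [set r : R | 0 < r /\
    exists f : 'rV[C]_n -> 'rV[C]_n,
      [/\ holo X (unit_ball n) f, set_inj X f, f z = 0 &
          eball 0 r `<=` f @` X]]].

Definition fridman {n : nat} (X : set 'rV[C]_n) (z : 'rV[C]_n) : \bar R :=
  ereal_sup [set (tanh r)%:E | r in [set r : R | 0 < r /\
    exists f : 'rV[C]_n -> 'rV[C]_n,
      [/\ holo (unit_ball n) X f, set_inj (unit_ball n) f &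
          caratheodory_ball X z r `<=` f @` unit_ball n]]].

(* The product of subsets of C^n1 and C^n2, inside C^(n1 + n2). *)
Definition cprod {n1 n2 : nat} (A : set 'rV[C]_n1) (B : set 'rV[C]_n2) :
    set 'rV[C]_(n1 + n2) :=
  [set z | A (lsubmx z) /\ B (rsubmx z)].

Definition imag_half_ball (m : nat) : set 'rV[C]_m :=
  [set z : 'rV[C]_m | forall j, complex.Re (z 0 j) = 0] `&` eball 0 2^-1.

End ComplexSpace.

Arguments imag_half_ball {R} m _.

(* Main.v *)
(* K matters only as a compact subset of E = {Re z_i = Re z_j = 0} for two distinct
   coordinates i, j.  A bounded holomorphic function off E extends across E: near
   w in E, its means over the circles |z| = rho in the disks y + z e_i +- z^2 e_j and
   y + z e_j +- z^2 e_i, whose boundaries avoid E, are holomorphic in y and agree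
   with one another; and every y off E has such a disk avoiding E, on which the
   mean is the value at y.

   Let p be the ball automorphism exchanging z and 0; by the Schwarz lemma
   c(z, w) = artanh |p w| on the ball, and the common value is d = min |p w| over
   w in K, attained at some w0.  For f = p one gets s_D(z) >= d, and for
   f w = p (d w) one gets e_D(z) >= d.  Conversely, if f (D) contains the ball of
   radius r > d about 0, then f extends to B, f o p has norm at most 1 and vanishes
   at 0, hence f w0 is in f (D), and the inverse of the univalent map f carries f w0
   to w0, which is not in D.  If f (B) contains a Caratheodory ball of D of
   tanh-radius r > d, which is {|p w| < r} off K since bounded functions extend, then
   the inverse of f extends to a neighbourhood of w0 with values in B, so w0 = f u
   lies in f (B), a subset of D.

   The inverse of a univalent map is holomorphic (Osgood): by induction on the
   dimension, F' is injective at a point where F' <> 0, since F restricts to a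
   univalent map on the level sets of one of its components; and where F' = 0 on
   the zero set of det F', that set is near some point a graph along which F is
   constant.

   One-variable theory: means over [0, 1] are limits of dyadic midpoint means, and
   Cauchy's theorem on rectangles is proved by bisection. *)
Require Import Defs.
From HB Require Import structures.
From mathcomp Require Import all_boot all_order all_algebra.
From mathcomp Require Import all_classical all_reals all_analysis.
From mathcomp Require Import complex ring lra.
Set Implicit Arguments.
Unset Strict Implicit.
Unset Printing Implicit Defensive.
Import Order.TTheory GRing.Theory Num.Theory.
Import numFieldNormedType.Exports.
Local Open Scope classical_set_scope.
Local Open Scope complex_scope.
Local Open Scope ring_scope.

(** The maps in [squeezing] and [fridman] are only complex differentiable at each point and
    injective: nothing is given about continuity of the derivative or about the inverse. Both upper
    bounds use the inverse near [K], hence Osgood's theorem and the Cauchy theory under it.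

    Every integral is an average over [0, 1]. Pulling f back by [c + exp w] turns Cauchy's theorem
    on a rectangle into independence of circle means from the radius; the maximum principle,
    derivative estimates and existence of zeros follow, and stand in for power series and Rouché's
    theorem.

    Two coordinates are needed because one equation [Re z_i = 0] separates space, and a locally
    constant function off it need not extend. A straight disk along [e_i] meets E in a whole chord
    when [Re y_j = 0]; the term [z^2 e_j] bends its boundary off E.

    Extension to [K] keeps only the weak bound 1. In the first upper bound the Schwarz lemma still
    puts the image of w0 strictly inside the covered ball; in the second, a disk meeting E only at
    its center restores strictness. *)

Section RealNorm.
Context {R : realType}.
Local Notation C := R[i].

(** The norm of a normed [R[i]]-module takes values in [R[i]]; its real part makes [lra] and [nra]
    available. On [R[i]] it is the modulus, on row vectors the sup norm. *)
Definition rn {U : normedModType C} (x : U) : R := complex.Re `|x|.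

Lemma rnE (U : normedModType C) (x : U) : `|x| = (rn x)%:C.
Proof. by rewrite /rn RRe_real // normr_real. Qed.

Lemma rn_ge0 (U : normedModType C) (x : U) : 0 <= rn x.
Proof. by rewrite -ler0c -rnE. Qed.

Lemma rn0 (U : normedModType C) : rn (0 : U) = 0.
Proof. by rewrite /rn normr0. Qed.

Lemma rn_eq0 (U : normedModType C) (x : U) : (rn x == 0) = (x == 0).
Proof.
rewrite -(normr_eq0 x) rnE.
by apply/eqP/eqP => [->//|/(congr1 (@complex.Re R))].
Qed.

Lemma rn_gt0 (U : normedModType C) (x : U) : (0 < rn x) = (x != 0).
Proof. by rewrite lt_def rn_ge0 andbT rn_eq0. Qed.

Lemma rnN (U : normedModType C) (x : U) : rn (- x) = rn x.
Proof. by rewrite /rn normrN. Qed.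

Lemma rnBC (U : normedModType C) (x y : U) : rn (x - y) = rn (y - x).
Proof. by rewrite /rn distrC. Qed.

Lemma rnD (U : normedModType C) (x y : U) : rn (x + y) <= rn x + rn y.
Proof. by rewrite -lecR rmorphD /= -!rnE ler_normD. Qed.

Lemma rnB (U : normedModType C) (x y : U) : rn (x - y) <= rn x + rn y.
Proof. by rewrite -(rnN y) rnD. Qed.

Lemma rnDB (U : normedModType C) (x y z : U) : rn (x - z) <= rn (x - y) + rn (y - z).
Proof. by rewrite -[x - z](subrKA y) rnD. Qed.

Lemma rn_lbB (U : normedModType C) (x y : U) : rn x - rn y <= rn (x - y).
Proof. by rewrite lerBlDr -{1}[x](subrK y) rnD. Qed.

Lemma rnZ (U : normedModType C) (a : C) (x : U) : rn (a *: x) = rn a * rn x.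
Proof. by apply: complexI; rewrite rmorphM /= -!rnE normrZ. Qed.

Lemma rn1 : rn (1 : C) = 1.
Proof. by rewrite /rn normr1. Qed.

Lemma rnM (x y : C) : rn (x * y) = rn x * rn y.
Proof. exact: rnZ. Qed.

Lemma rnV (x : C) : rn x^-1 = (rn x)^-1.
Proof. by rewrite /rn normfV -fmorphV. Qed.

Lemma rnf (x y : C) : rn (x / y) = rn x / rn y.
Proof. by rewrite rnM rnV. Qed.

Lemma rnX (x : C) n : rn (x ^+ n) = rn x ^+ n.
Proof. by elim: n => [|n IH]; rewrite ?expr0 ?rn1 // !exprS rnM IH. Qed.

Lemma rn_real (x : R) : rn (x%:C : C) = `|x|.
Proof. by rewrite /rn normc_def /= expr0n addr0 sqrtr_sqr. Qed.

Lemma rn_nat n : rn (n%:R : C) = n%:R.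
Proof. by rewrite /rn normr_nat -(rmorph_nat (real_complex R)). Qed.

Lemma rnc (x : C) : Normc.normc x = rn x. Proof. by []. Qed.

Lemma cReD (x y : C) : complex.Re (x + y) = complex.Re x + complex.Re y.
Proof. by case: x y => [a b] [c d]. Qed.
Lemma cImD (x y : C) : complex.Im (x + y) = complex.Im x + complex.Im y.
Proof. by case: x y => [a b] [c d]. Qed.
Lemma cReN (x : C) : complex.Re (- x) = - complex.Re x.
Proof. by case: x. Qed.
Lemma cImN (x : C) : complex.Im (- x) = - complex.Im x.
Proof. by case: x. Qed.
Lemma cReB (x y : C) : complex.Re (x - y) = complex.Re x - complex.Re y.
Proof. by rewrite cReD cReN. Qed.
Lemma cImB (x y : C) : complex.Im (x - y) = complex.Im x - complex.Im y.
Proof. by rewrite cImD cImN. Qed.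
Lemma cReM (x y : C) : complex.Re (x * y) =
  complex.Re x * complex.Re y - complex.Im x * complex.Im y.
Proof. by case: x y => [a b] [c d]. Qed.
Lemma cImM (x y : C) : complex.Im (x * y) =
  complex.Re x * complex.Im y + complex.Im x * complex.Re y.
Proof. by case: x y => [a b] [c d]. Qed.
Lemma cReZ (a : R) (x : C) : complex.Re (a%:C * x) = a * complex.Re x.
Proof. by rewrite cReM /= mul0r subr0. Qed.

Lemma rn_sqr (x : C) : rn x ^+ 2 = complex.Re x ^+ 2 + complex.Im x ^+ 2.
Proof.
by rewrite /rn normc_def /= sqr_sqrtr // addr_ge0 ?sqr_ge0.
Qed.

Lemma Re_le_rn (x : C) : `|complex.Re x| <= rn x.
Proof. by rewrite -lecR -rnE normc_ge_Re. Qed.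

Lemma Im_le_rn (x : C) : `|complex.Im x| <= rn x.
Proof.
rewrite -(ler_pXn2r (n:=2)) ?nnegrE ?rn_ge0 // rn_sqr real_normK ?num_real //.
by rewrite lerDr sqr_ge0.
Qed.

Lemma rn_le_ReIm (x : C) : rn x <= `|complex.Re x| + `|complex.Im x|.
Proof.
rewrite -(ler_pXn2r (n:=2)) ?nnegrE ?rn_ge0 ?addr_ge0 // rn_sqr sqrrD.
rewrite !real_normK ?num_real // -addrA lerD2l lerDr.
by rewrite mulrn_wge0 // mulr_ge0.
Qed.

Lemma mulJ (x : C) : x * x^* = (rn x ^+ 2)%:C.
Proof. by rewrite -sqr_normc rnE rmorphXn. Qed.

Lemma nbhs_rnP (U : normedModType C) (x : U) (A : set U) :
  nbhs x A <-> exists2 e : R, 0 < e & forall y, rn (y - x) < e -> A y.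
Proof.
rewrite -[nbhs x A]/(\near x, A x) nbhs_normP; split.
- case=> -[a b] /=; rewrite ltcE /= => /andP[/eqP -> a0] h; exists a => // y ya.
  by apply: h; rewrite /= distrC rnE ltcR.
- case=> e e0 h; exists e%:C; first by rewrite /= ltcR.
  by move=> y; rewrite /= distrC rnE ltcR; apply: h.
Qed.

Lemma open_rnP (U : normedModType C) (A : set U) :
  open A <-> forall x, A x -> exists2 e : R, 0 < e & forall y, rn (y - x) < e -> A y.
Proof.
rewrite openE; split => h x /h.
- by move=> /nbhs_rnP.
- by move=> ?; apply/nbhs_rnP.
Qed.

Lemma cont_rnP (U V : normedModType C) (f : U -> V) (x : U) :
  {for x, continuous f} <->
  forall e : R, 0 < e -> exists2 d : R, 0 < d &
    forall y, rn (y - x) < d -> rn (f y - f x) < e.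
Proof.
split => [h e e0|h A /nbhs_rnP[e e0 eA]].
- have /nbhs_rnP[d d0 hd] : nbhs x (f @^-1` [set y | rn (y - f x) < e]).
    by apply: h; apply/nbhs_rnP; exists e.
  by exists d.
- have [d d0 hd] := h _ e0.
  by apply/nbhs_rnP; exists d => // y /hd; apply: eA.
Qed.

Lemma nbhsR_P (x : R) (A : set R) :
  nbhs x A <-> exists2 e : R, 0 < e & forall y, `|y - x| < e -> A y.
Proof.
rewrite -[nbhs x A]/(\near x, A x) nbhs_normP; split.
- by case=> e /= e0 h; exists e => // y; rewrite distrC; apply: h.
- by case=> e e0 h; exists e => // y /=; rewrite distrC; apply: h.
Qed.

Lemma contR_rnP (V : normedModType C) (f : R -> V) (x : R) :
  {for x, continuous f} <->
  forall e : R, 0 < e -> exists2 d : R, 0 < d &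
    forall y, `|y - x| < d -> rn (f y - f x) < e.
Proof.
split => [h e e0|h A /nbhs_rnP[e e0 eA]].
- have : nbhs x (f @^-1` [set y | rn (y - f x) < e]).
    by apply: h; apply/nbhs_rnP; exists e.
  by move=> /nbhsR_P[d d0 hd]; exists d.
- have [d d0 hd] := h _ e0.
  by apply/nbhsR_P; exists d => // y /hd; apply: eA.
Qed.

Lemma contCR_rnP (U : normedModType C) (f : U -> R) (x : U) :
  {for x, continuous f} <->
  forall e : R, 0 < e -> exists2 d : R, 0 < d &
    forall y, rn (y - x) < d -> `|f y - f x| < e.
Proof.
split => [h e e0|h A].
- have /nbhs_rnP[d d0 hd] : nbhs x (f @^-1` [set y | `|y - f x| < e]).
    by apply: h; apply/nbhsR_P; exists e.
  by exists d.
- move=> /nbhsR_P[e e0 eA]; have [d d0 hd] := h _ e0.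
  by apply/nbhs_rnP; exists d => // y /hd; apply: eA.
Qed.

Lemma linear_continuous_rn (U V : normedModType C) (L : {linear U -> V}) (M : R) :
  (forall h, rn (L h) <= M * rn h) -> continuous L.
Proof.
move=> hL x; apply/cont_rnP => e e0; exists (e / (`|M| + 1)).
  by rewrite divr_gt0 // ltr_wpDl.
move=> y hy; rewrite -raddfB; apply: le_lt_trans (hL _) _.
move: hy; rewrite ltr_pdivlMr ?ltr_wpDl // mulrC; apply: le_lt_trans.
by rewrite ler_wpM2r ?rn_ge0 // (le_trans (ler_norm _)) // lerDl.
Qed.

Lemma diff_rnP (U V : normedModType C) (f : U -> V) (x : U) :
  differentiable f x -> forall e : R, 0 < e -> exists2 d : R, 0 < d &
    forall h, rn h < d -> rn (f (x + h) - f x - 'd f x h) <= e * rn h.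
Proof.
move=> /diff_locallyP [_ /eqaddoP h] e e0.
have e0' : (0 : C) < e%:C by rewrite ltcR.
have [d d0 hd] := (nbhs_rnP _ _).1 (h _ e0').
exists d => // y yd; have := hd y; rewrite subr0 => /(_ yd).
rewrite !rnE -rmorphM lecR /= !fctE /= opprD addrA addrC (addrC y x).
by rewrite [- _ + _]addrC.
Qed.

(** The bound [M] supplies the continuity of [L] that uniqueness of the differential asks for. *)
Lemma diff_of_rn (U V : normedModType C) (f : U -> V) (x : U)
    (L : {linear U -> V}) (M : R) :
  (forall h, rn (L h) <= M * rn h) ->
  (forall e : R, 0 < e -> exists2 d : R, 0 < d &
    forall h, rn h < d -> rn (f (x + h) - f x - L h) <= e * rn h) ->
  differentiable f x /\ 'd f x = L :> (U -> V).
Proof.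
move=> hM hL; have cL := linear_continuous_rn hM.
have h : f \o shift x = cst (f x) + L +o_ (0:U) id.
  apply/eqaddoP => -[a b]; rewrite ltcE /= => /andP[/eqP -> a0].
  have [d d0 hd] := hL _ a0.
  apply/nbhs_rnP; exists d => // y; rewrite subr0 => /hd.
  rewrite complexr0 !rnE -rmorphM lecR /= !fctE /= opprD addrA addrC (addrC y x).
  by rewrite [- _ + _]addrC.
have dL := diff_unique cL h.
split => //; apply/diff_locallyP; rewrite dL; split => //.
Qed.

Lemma cont_cst (T : topologicalType) (U : normedModType C) (c : U) (x : T) :
  {for x, continuous (fun _ : T => c)}.
Proof. exact: cst_continuous. Qed.

Lemma contD (T : topologicalType) (U : normedModType C) (f g : T -> U) (x : T) :
  {for x, continuous f} -> {for x, continuous g} ->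
  {for x, continuous (fun t => f t + g t)}.
Proof. by move=> hf hg; apply: continuousD. Qed.

Lemma contB (T : topologicalType) (U : normedModType C) (f g : T -> U) (x : T) :
  {for x, continuous f} -> {for x, continuous g} ->
  {for x, continuous (fun t => f t - g t)}.
Proof. by move=> hf hg; apply: continuousB. Qed.

Lemma contM (T : topologicalType) (f g : T -> C) (x : T) :
  {for x, continuous f} -> {for x, continuous g} ->
  {for x, continuous (fun t => f t * g t)}.
Proof. exact: (@continuousM C T f g x). Qed.

Lemma contMl (T : topologicalType) (c : C) (g : T -> C) (x : T) :
  {for x, continuous g} -> {for x, continuous (fun t => c * g t)}.
Proof. by move=> hg; apply: contM hg; apply: cont_cst. Qed.

Lemma contV (T : topologicalType) (f : T -> C) (x : T) :
  f x != 0 -> {for x, continuous f} -> {for x, continuous (fun t => (f t)^-1)}.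
Proof. exact: (@continuousV C T f x). Qed.

Lemma contZ (T : topologicalType) (U : normedModType C) (f : T -> C) (g : T -> U) (x : T) :
  {for x, continuous f} -> {for x, continuous g} ->
  {for x, continuous (fun t => f t *: g t)}.
Proof. by move=> hf hg; apply: continuousZ. Qed.

End RealNorm.

Arguments cont_cst {R T U} c x.
Arguments contD {R T U f g x}.
Arguments contB {R T U f g x}.
Arguments contM {R T f g x}.
Arguments contMl {R T} c {g x}.
Arguments contV {R T f x}.
Arguments contZ {R T U f g x}.

(** * Means over an interval *)

Section Bisection.
Context {R : realType}.
Local Notation C := R[i].

Lemma nested_intervals (a b : nat -> R) :
  (forall k, a k <= a k.+1) -> (forall k, b k.+1 <= b k) -> (forall k, a k <= b k) ->
  exists x, forall k, a k <= x <= b k.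
Proof.
move=> ha hb hab.
have hA : {homo a : i j / (i <= j)%N >-> i <= j} by apply: homo_leq => // ? ? ?; apply: le_trans.
have hB i j : (i <= j)%N -> b j <= b i.
  by apply: (homo_leq (r := fun x y => y <= x)) => // x y z h1 h2; apply: le_trans h1.
have hAB i j : a i <= b j.
  apply: (le_trans (hA i (maxn i j) (leq_maxl _ _))).
  exact: le_trans (hab _) (hB _ _ (leq_maxr _ _)).
exists (sup (range a)) => k; apply/andP; split.
- by apply: ub_le_sup; [exists (b k) => _ [i _ <-] | exists k].
- by apply: ge_sup; [exists (a 0%N); exists 0%N | move=> _ [i _ <-]].
Qed.

Variables (w h : R).
Hypotheses (w0 : 0 <= w) (h0 : 0 <= h).

(** A rectangle of the k-th bisection, with lower left corner [P]. For [h = 0] it is a segment, so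
    that the same bisection serves intervals. *)
Definition in_rect (P : C) (k : nat) (z : C) :=
  [/\ complex.Re P <= complex.Re z, complex.Re z <= complex.Re P + w / 2 ^+ k,
      complex.Im P <= complex.Im z & complex.Im z <= complex.Im P + h / 2 ^+ k].

Definition sub_corner (P : C) (k : nat) (a b : bool) : C :=
  P + Complex (a%:R * (w / 2 ^+ k.+1)) (b%:R * (h / 2 ^+ k.+1)).

Lemma half_exp (x : R) k : x / 2 ^+ k = x / 2 ^+ k.+1 + x / 2 ^+ k.+1.
Proof. by rewrite exprS; field; rewrite expf_neq0. Qed.

Lemma sub_corner_range P k a b : let P' := sub_corner P k a b in
  [/\ complex.Re P <= complex.Re P',
      complex.Re P' + w / 2 ^+ k.+1 <= complex.Re P + w / 2 ^+ k,
      complex.Im P <= complex.Im P' &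
      complex.Im P' + h / 2 ^+ k.+1 <= complex.Im P + h / 2 ^+ k].
Proof.
rewrite /sub_corner cReD cImD /= (half_exp w k) (half_exp h k).
have w1 : 0 <= w / 2 ^+ k.+1 by rewrite divr_ge0 // exprn_ge0.
have h1 : 0 <= h / 2 ^+ k.+1 by rewrite divr_ge0 // exprn_ge0.
by case: a b => [] []; split; rewrite /= ?mul0r ?mul1r; lra.
Qed.

Lemma sub_rect P k a b z : in_rect (sub_corner P k a b) k.+1 z -> in_rect P k z.
Proof.
have [i1 i2 i3 i4] := sub_corner_range P k a b.
move=> [j1 j2 j3 j4]; split.
- exact: le_trans i1 j1.
- exact: le_trans j2 i2.
- exact: le_trans i3 j3.
- exact: le_trans j4 i4.
Qed.

Lemma exp_small (x d : R) : 0 < d -> exists k, x / 2 ^+ k < d.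
Proof.
move=> d0; have [n hn] : exists n : nat, `|x| / d < n%:R.
  by exists (Num.truncn (`|x| / d)).+1; apply: truncnS_gt.
exists n; rewrite ltr_pdivrMr ?exprn_gt0 // mulrC -ltr_pdivrMr //.
apply: le_lt_trans (lt_trans hn _).
  by rewrite ler_pM2r ?invr_gt0 // ler_norm.
by rewrite -natrX ltr_nat ltn_expl.
Qed.

(** Bisection as an induction principle. If [Q P0 0] failed, some quarter would fail at every stage;
    the failing rectangles shrink to a point z, and the local hypothesis at z contradicts failure at
    a late stage. *)
Lemma rect_ind (Q : C -> nat -> Prop) (P0 : C) :
  (forall P k, (forall a b, Q (sub_corner P k a b) k.+1) -> Q P k) ->
  (forall z, in_rect P0 0 z -> exists2 d : R, 0 < d &
    forall P k, (forall y, in_rect P k y -> in_rect P0 0 y) -> in_rect P k z ->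
      w / 2 ^+ k + h / 2 ^+ k < d -> Q P k) ->
  Q P0 0.
Proof.
move=> hsub hloc; apply: contrapT => nQ0.
have step (x : C * nat) : exists P', ~ Q x.1 x.2 ->
    (exists a b, P' = sub_corner x.1 x.2 a b) /\ ~ Q P' x.2.+1.
  have [q|nq] := pselect (Q x.1 x.2); first by exists 0.
  apply: contrapT => hn; apply: nq; apply: hsub => a b; apply: contrapT => nq.
  by apply: hn; exists (sub_corner x.1 x.2 a b) => _; split=> //; exists a, b.
have [s hs] := choice step.
pose p := fix p k := if k is k'.+1 then s (p k', k') else P0.
have np k : ~ Q (p k) k by elim: k => [//|k /(hs (p k, k))[]].
have ps k : exists a b, p k.+1 = sub_corner (p k) k a b by have [] := hs (p k, k) (np k).
have pr k : [/\ complex.Re (p k) <= complex.Re (p k.+1),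
      complex.Re (p k.+1) + w / 2 ^+ k.+1 <= complex.Re (p k) + w / 2 ^+ k,
      complex.Im (p k) <= complex.Im (p k.+1) &
      complex.Im (p k.+1) + h / 2 ^+ k.+1 <= complex.Im (p k) + h / 2 ^+ k].
  by have [a [b ->]] := ps k; apply: sub_corner_range.
have psub k y : in_rect (p k) k y -> in_rect P0 0 y.
  elim: k y => [//|k IH] y; have [a [b ->]] := ps k.
  by move=> /sub_rect; apply: IH.
have [|||x hx] := @nested_intervals (fun k => complex.Re (p k))
   (fun k => complex.Re (p k) + w / 2 ^+ k).
- by move=> k; have [] := pr k.
- by move=> k; have [] := pr k.
- by move=> k; rewrite lerDl divr_ge0 // exprn_ge0.
have [|||y hy] := @nested_intervals (fun k => complex.Im (p k))
   (fun k => complex.Im (p k) + h / 2 ^+ k).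
- by move=> k; have [] := pr k.
- by move=> k; have [] := pr k.
- by move=> k; rewrite lerDl divr_ge0 // exprn_ge0.
have pz k : in_rect (p k) k (Complex x y).
  by have /andP[? ?] := hx k; have /andP[? ?] := hy k.
have [d d0 hd] := hloc _ (pz 0%N).
have [k hk] := exp_small (w + h) d0.
by apply: (np k); apply: hd => //; [apply: psub | rewrite -mulrDl].
Qed.

End Bisection.

Section Mean.
Context {R : realType}.
Local Notation C := R[i].
Implicit Types (phi psi : R -> C).

(** The midpoint Riemann sum over the [2 ^ k] dyadic subintervals of [0, 1]. Recursion on the two
    halves makes it compatible with bisection by definition. *)
Fixpoint dyadic_mean (k : nat) (phi : R -> C) : C :=
  if k is k'.+1 then
    (dyadic_mean k' (fun t => phi (t / 2)) + dyadic_mean k' (fun t => phi ((t + 1) / 2))) / 2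
  else phi (2^-1).

Definition cont01 phi := forall t, 0 <= t <= 1 -> {for t, continuous phi}.

Definition is_mean phi (A : C) := forall e : R, 0 < e ->
  exists N, forall m, (N <= m)%N -> rn (dyadic_mean m phi - A) <= e.

(** The Riemann integral over [0, 1] of a complex function, with junk value 0 when the midpoint sums
    diverge; the lock keeps [xget] from being unfolded. *)
Definition mean : (R -> C) -> C := locked (fun phi => xget 0 (is_mean phi)).

Lemma half01 (t : R) : 0 <= t <= 1 -> 0 <= t / 2 <= 1 /\ 0 <= (t + 1) / 2 <= 1.
Proof. by move=> /andP[? ?]; split; apply/andP; split; lra. Qed.

Lemma dyadic_mean_conv (P : C -> Prop) k phi :
  (forall x y, P x -> P y -> P ((x + y) / 2)) ->
  (forall t, 0 <= t <= 1 -> P (phi t)) -> P (dyadic_mean k phi).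
Proof.
move=> hP; elim: k phi => [|k IH] phi hphi /=.
  by apply: hphi; apply/andP; split; lra.
by apply: hP; apply: IH => t /half01[? ?]; apply: hphi.
Qed.

Lemma dyadic_meanD k phi psi :
  dyadic_mean k (fun t => phi t + psi t) = dyadic_mean k phi + dyadic_mean k psi.
Proof. by elim: k phi psi => [//|k IH] phi psi /=; rewrite !IH; ring. Qed.

Lemma dyadic_meanZ k (a : C) phi :
  dyadic_mean k (fun t => a * phi t) = a * dyadic_mean k phi.
Proof. by elim: k phi => [//|k IH] phi /=; rewrite !IH; ring. Qed.

Lemma dyadic_mean_cst k (a : C) : dyadic_mean k (fun=> a) = a.
Proof. by elim: k => [//|k IH] /=; rewrite IH; field. Qed.

Lemma dyadic_mean_eq k phi psi : (forall t, 0 <= t <= 1 -> phi t = psi t) ->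
  dyadic_mean k phi = dyadic_mean k psi.
Proof.
move=> h; elim: k phi psi h => [|k IH] phi psi h /=; first by apply: h; apply/andP; split; lra.
by congr ((_ + _) / 2); apply: IH => t /half01[? ?]; apply: h.
Qed.

Lemma dyadic_mean_id k : dyadic_mean k (fun t => t%:C) = 2^-1 :> C.
Proof.
elim: k => [|k IH] /=; first by rewrite fmorphV rmorph_nat.
rewrite [X in (X + _) / 2](_ : _ = 2^-1 * 2^-1); last first.
  rewrite -{2}IH -dyadic_meanZ; apply: dyadic_mean_eq => t _.
  by rewrite rmorphM fmorphV rmorph_nat mulrC.
rewrite [X in (_ + X) / 2](_ : _ = 2^-1 * (2^-1 + 1)); last first.
  rewrite -{2}IH -{2}(dyadic_mean_cst k 1) -dyadic_meanD -dyadic_meanZ.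
  apply: dyadic_mean_eq => t _.
  by rewrite rmorphM fmorphV rmorph_nat rmorphD rmorph1 mulrC.
by field.
Qed.

Lemma is_mean_unique phi A B : is_mean phi A -> is_mean phi B -> A = B.
Proof.
move=> hA hB; apply/eqP; rewrite -subr_eq0 -rn_eq0 eq_le rn_ge0 andbT.
rewrite leNgt; apply/negP => AB0.
have e0 : 0 < rn (A - B) / 3 by rewrite divr_gt0.
have [N1 h1] := hA _ e0; have [N2 h2] := hB _ e0.
have {}h1 := h1 _ (leq_maxl N1 N2); have {}h2 := h2 _ (leq_maxr N1 N2).
have := rnDB A (dyadic_mean (maxn N1 N2) phi) B; rewrite (rnBC A (dyadic_mean _ _)).
by move: h1 h2 AB0; lra.
Qed.

Lemma meanE phi A : is_mean phi A -> mean phi = A.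
Proof.
by move=> hA; apply: (is_mean_unique _ hA); rewrite /mean -lock; apply: xgetPex; exists A.
Qed.

(** Bisection replaces uniform continuity: approximate limits on two halves average to one on the
    whole, and near each point continuity makes [phi] constant up to e. *)
Lemma cont01_is_mean_ex phi : cont01 phi -> exists A, is_mean phi A.
Proof.
move=> cphi.
have hA e : 0 < e -> exists A N, forall m, (N <= m)%N -> rn (dyadic_mean m phi - A) <= e.
  move=> e0.
  pose Q (P : C) (k : nat) := exists A N, forall m, (N <= m)%N ->
    rn (dyadic_mean m (fun t => phi (complex.Re P + t / 2 ^+ k)) - A) <= e.
  suff [A [N h]] : Q 0 0%N.
    exists A, N => m /h; rewrite (@dyadic_mean_eq _ _ phi) // => t _ /=.
    by rewrite add0r divr1.
  apply: (@rect_ind R 1 0 _ _ Q) => //.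
  - move=> P k hs; have [A [N hN]] := hs false false; have [B [M hM]] := hs true false.
    exists ((A + B) / 2), (maxn N M).+1 => -[//|m] hm /=.
    have {}hN := hN m (leq_trans (leq_maxl _ _) hm).
    have {}hM := hM m (leq_trans (leq_maxr _ _) hm).
    move: hN hM; rewrite /sub_corner !cReD /= mul0r addr0 !mul1r.
    rewrite (@dyadic_mean_eq _ _ (fun t => phi (complex.Re P + t / 2 / 2 ^+ k))); last first.
      by move=> t _; congr phi; rewrite exprS; field; rewrite expf_neq0.
    set a := dyadic_mean _ _ => hN.
    rewrite (@dyadic_mean_eq _ _ (fun t => phi (complex.Re P + (t + 1) / 2 / 2 ^+ k))); last first.
      by move=> t _; congr phi; rewrite exprS; field; rewrite expf_neq0.
    set b := dyadic_mean _ _ => hM.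
    have -> : (a + b) / 2 - (A + B) / 2 = ((a - A) + (b - B)) / 2 by ring.
    rewrite rnf rn_nat; have := rnD (a - A) (b - B).
    move: hN hM; set x := rn _; set y := rn _; set z := rn _; lra.
  - move=> z [z1 z2 _ _]; rewrite add0r divr1 in z2.
    have /contR_rnP /(_ _ e0) [d d0 hd] := cphi (complex.Re z) (introT andP (conj z1 z2)).
    exists d => // P k _ [i1 i2 _ _]; rewrite mul0r addr0 => kd.
    exists (phi (complex.Re z)), 0%N => m _.
    apply: (@dyadic_mean_conv (fun x => rn (x - phi (complex.Re z)) <= e)) => [x y hx hy|t].
      have -> : (x + y) / 2 - phi (complex.Re z) =
        ((x - phi (complex.Re z)) + (y - phi (complex.Re z))) / 2 by field.
      rewrite rnf rn_nat; have := rnD (x - phi (complex.Re z)) (y - phi (complex.Re z)).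
      move: hx hy; set a := rn _; set b := rn _; set c := rn _; lra.
    move=> /andP[t0 t1]; apply/ltW/hd.
    have : 0 <= t / 2 ^+ k <= 1 / 2 ^+ k.
      by rewrite divr_ge0 ?exprn_ge0 // ler_pM2r ?invr_gt0 ?exprn_gt0.
    move=> /andP[j1 j2]; rewrite ltr_norml; apply/andP; split; lra.
(* Completeness is used in [R], for the real and imaginary parts, which are both 1-Lipschitz. *)
have cv (f : C -> R) : (forall x y, `|f x - f y| <= rn (x - y)) ->
    exists a : R, forall e, 0 < e -> exists N, forall m, (N <= m)%N ->
      `|f (dyadic_mean m phi) - a| <= e.
  move=> hf; have : cvg ((fun m => f (dyadic_mean m phi)) @ \oo).
    apply/cauchy_cvgP; apply: cauchy_exP => e e0.
    have [A [N hN]] := hA _ (divr_gt0 e0 (ltr0Sn _ 1)).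
    exists (f A); exists N => // m /= /hN hm.
    rewrite /ball /= distrC; apply: le_lt_trans (hf _ _) _.
    by apply: le_lt_trans hm _; lra.
  move=> /cvgrPdist_le h; exists (lim ((fun m => f (dyadic_mean m phi)) @ \oo)) => e e0.
  by have [N _ hN] := h _ e0; exists N => m /hN /=; rewrite distrC.
have [a ha] : exists a : R, _ := cv (@complex.Re R) (fun x y => ltac:(by rewrite -cReB Re_le_rn)).
have [b hb] : exists a : R, _ := cv (@complex.Im R) (fun x y => ltac:(by rewrite -cImB Im_le_rn)).
exists (Complex a b) => e e0; have e2 : 0 < e / 2 by lra.
have [N hN] := ha _ e2; have [M hM] := hb _ e2.
exists (maxn N M) => m hm; apply: le_trans (rn_le_ReIm _) _; rewrite cReB cImB.
have := hN m (leq_trans (leq_maxl _ _) hm); have := hM m (leq_trans (leq_maxr _ _) hm).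
by rewrite /=; set x := `|_|; set y := `|_|; lra.
Qed.

Lemma meanP phi : cont01 phi -> is_mean phi (mean phi).
Proof. by move=> /cont01_is_mean_ex [A hA]; rewrite (meanE hA). Qed.

Lemma mean_eq phi psi : (forall t, 0 <= t <= 1 -> phi t = psi t) -> mean phi = mean psi.
Proof.
move=> h; rewrite /mean -lock; congr xget; apply/seteqP.
have E m : dyadic_mean m phi = dyadic_mean m psi by apply: dyadic_mean_eq.
by split => A hA e /hA [N hN]; exists N => m /hN; rewrite E.
Qed.

Lemma meanD phi psi : cont01 phi -> cont01 psi ->
  mean (fun t => phi t + psi t) = mean phi + mean psi.
Proof.
move=> /meanP h1 /meanP h2; apply: meanE => e e0; have e2 : 0 < e / 2 by lra.
have [N hN] := h1 _ e2; have [M hM] := h2 _ e2; exists (maxn N M) => m hm.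
rewrite dyadic_meanD opprD addrACA; apply: le_trans (rnD _ _) _.
have := hN m (leq_trans (leq_maxl _ _) hm); have := hM m (leq_trans (leq_maxr _ _) hm).
by set x := rn _; set y := rn _; lra.
Qed.

Lemma meanZ (a : C) phi : cont01 phi -> mean (fun t => a * phi t) = a * mean phi.
Proof.
move=> /meanP h1; apply: meanE => e e0.
have a1 : 0 < rn a + 1 by rewrite ltr_wpDl ?rn_ge0.
have [N hN] := h1 _ (divr_gt0 e0 a1); exists N => m /hN hm.
rewrite dyadic_meanZ -mulrBr rnM.
move: hm; rewrite ler_pdivlMr // mulrC => hm; apply: le_trans hm.
by rewrite ler_wpM2r ?rn_ge0 // lerDl.
Qed.

Lemma mean_cst (a : C) : mean (fun=> a) = a.
Proof. by apply: meanE => e e0; exists 0%N => m _; rewrite dyadic_mean_cst subrr rn0 ltW. Qed.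

Lemma cont01_cst (a : C) : cont01 (fun=> a).
Proof. by move=> t _; exact: cont_cst. Qed.

Lemma mean_subc phi (a : C) : cont01 phi -> mean (fun t => phi t - a) = mean phi - a.
Proof.
move=> h; transitivity (mean phi + mean (fun=> - a)); first exact: (meanD h (@cont01_cst (- a))).
by congr (_ + _); exact: mean_cst.
Qed.

Lemma cont01_subc phi (a : C) : cont01 phi -> cont01 (fun t => phi t - a).
Proof. by move=> h t ht; refine (contB (h t ht) (cont_cst _ _)). Qed.

Lemma mean_id : mean (fun t => t%:C) = 2^-1 :> C.
Proof. by apply: meanE => e e0; exists 0%N => m _; rewrite dyadic_mean_id subrr rn0 ltW. Qed.

Lemma mean_halves phi : cont01 phi ->
  mean phi = (mean (fun t => phi (t / 2)) + mean (fun t => phi ((t + 1) / 2))) / 2.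
Proof.
move=> cphi.
have c1 : cont01 (fun t => phi (t / 2)).
  move=> t /half01[ht _]; apply: (continuous_comp (f := fun t : R => t / 2)); last exact: cphi.
  by apply: continuousM; [exact: cvg_id | exact: cvg_cst].
have c2 : cont01 (fun t => phi ((t + 1) / 2)).
  move=> t /half01[_ ht]; apply: (continuous_comp (f := fun t : R => (t + 1) / 2)); last exact: cphi.
  apply: continuousM; last exact: cvg_cst.
  by apply: continuousD; [exact: cvg_id | exact: cvg_cst].
apply: meanE => e e0.
have [N hN] := meanP c1 e0; have [M hM] := meanP c2 e0.
exists (maxn N M).+1 => -[//|m] hm /=.
have := hN m (leq_trans (leq_maxl _ _) hm); have := hM m (leq_trans (leq_maxr _ _) hm).
set a := dyadic_mean m (fun t => phi (t / 2)).
set b := dyadic_mean m (fun t => phi ((t + 1) / 2)).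
set A := mean (fun t => phi (t / 2)); set B := mean _.
have -> : (a + b) / 2 - (A + B) / 2 = ((a - A) + (b - B)) / 2 by ring.
rewrite rnf rn_nat; have := rnD (a - A) (b - B).
set x := rn _; set y := rn _; set z := rn _; lra.
Qed.

Lemma mean_Re_le phi (B : R) : cont01 phi ->
  (forall t, 0 <= t <= 1 -> complex.Re (phi t) <= B) -> complex.Re (mean phi) <= B.
Proof.
move=> /meanP h hB; rewrite leNgt; apply/negP => lt.
have e0 : 0 < (complex.Re (mean phi) - B) / 2 by lra.
have [N /(_ N (leqnn _)) hN] := h _ e0.
have : complex.Re (dyadic_mean N phi) <= B.
  apply: (@dyadic_mean_conv (fun x => complex.Re x <= B)) => // x y hx hy.
  have -> : (x + y) / 2 = (2^-1)%:C * (x + y) by rewrite fmorphV rmorph_nat mulrC.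
  by rewrite cReZ cReD; lra.
have := le_trans (Re_le_rn _) hN; rewrite cReB ler_norml => /andP[].
set x := complex.Re _; set y := complex.Re _; lra.
Qed.

(** A factor of modulus 1 rotates the mean onto the positive real axis, where its modulus is its
    real part and [mean_Re_le] applies. *)
Lemma mean_rn_le phi (B : R) : cont01 phi ->
  (forall t, 0 <= t <= 1 -> rn (phi t) <= B) -> rn (mean phi) <= B.
Proof.
move=> cphi hB; have [->|nz] := eqVneq (mean phi) 0.
  rewrite rn0; apply: le_trans (rn_ge0 _) (hB 0 _).
  by rewrite lexx ler01.
pose a := (mean phi)^* / (rn (mean phi))%:C.
have r0 : 0 < rn (mean phi) by rewrite rn_gt0.
have rC : (rn (mean phi))%:C != 0 :> C.
  by rewrite -rnE normr_eq0.
have ra : rn a = 1.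
  rewrite /a rnf rn_real ger0_norm ?rn_ge0 //.
  have -> : rn (mean phi)^* = rn (mean phi) by rewrite /rn normcJ.
  by rewrite divff // gt_eqF.
have ha : a * mean phi = (rn (mean phi))%:C.
  rewrite /a mulrAC [_^* * _]mulrC mulJ rmorphXn /= expr2 mulfK //.
have : complex.Re (mean (fun t => a * phi t)) <= B.
  apply: mean_Re_le => [t ht|t ht].
    by apply: continuousM; [exact: cvg_cst | exact: cphi].
  apply: le_trans (ler_norm _) (le_trans (Re_le_rn _) _).
  by rewrite rnM ra mul1r hB.
by rewrite meanZ // ha.
Qed.

End Mean.

(** * Cauchy's theorem and the mean value property *)

Section Goursat.
Context {R : realType}.
Local Notation C := R[i].
Implicit Types (g : C -> C) (P a b z : C).

Definition edge_mean g P a : C := mean (fun t => g (P + t%:C * a)).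

(** The integral of [g] around the parallelogram at [P] with sides [a] and [b]; the integral over an
    edge is the edge vector times the mean over it. *)
Definition contour g P a b : C :=
  a * (edge_mean g P a - edge_mean g (P + b) a)
  + b * (edge_mean g (P + a) b - edge_mean g P b).

Lemma real_complex_continuous (t : R) : {for t, continuous (fun t : R => t%:C : C)}.
Proof.
by apply/contR_rnP => e e0; exists e => // y; rewrite -rmorphB rn_real.
Qed.

Lemma edge_continuous (U : normedModType C) (f : U -> C) (P a : U) t :
  {for (P + t%:C *: a), continuous f} ->
  {for t, continuous (fun t : R => f (P + t%:C *: a))}.
Proof.
move=> hf; apply: (continuous_comp (f := fun t : R => P + t%:C *: a)) => //.
apply: contD; first exact: cont_cst.
by apply: contZ; [exact: real_complex_continuous | exact: cont_cst].
Qed.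

Lemma edge_mean_halves g P a :
  (forall t : R, 0 <= t <= 1 -> {for P + t%:C * (a + a), continuous g}) ->
  edge_mean g P (a + a) = (edge_mean g P a + edge_mean g (P + a) a) / 2.
Proof.
move=> cg; rewrite /edge_mean mean_halves; last first.
  by move=> t /cg ht; apply: (edge_continuous (U := C)).
congr ((_ + _) / 2); apply: mean_eq => t _; congr g.
- by rewrite rmorphM fmorphV rmorph_nat; field.
- by rewrite rmorphM fmorphV rmorph_nat rmorphD rmorph1; field.
Qed.

(** Outer edges split into halves, and each inner edge is run through twice in opposite
    directions. *)
Lemma contour_quarters g P a b :
  (forall x y : R, 0 <= x <= 1 -> 0 <= y <= 1 ->
    {for P + x%:C * (a + a) + y%:C * (b + b), continuous g}) ->
  contour g P (a + a) (b + b) =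
    contour g P a b + contour g (P + a) a b + contour g (P + b) a b
    + contour g (P + a + b) a b.
Proof.
have I0 : 0 <= (0 : R) <= 1 by rewrite lexx ler01.
have I1 : 0 <= (1 : R) <= 1 by rewrite lexx ler01.
move=> cg; rewrite /contour !edge_mean_halves.
- have -> : P + (b + b) + a = P + a + b + b by ring.
  have -> : P + (a + a) + b = P + a + b + a by ring.
  have -> : P + (a + a) = P + a + a by ring.
  have -> : P + (b + b) = P + b + b by ring.
  have -> : P + b + a = P + a + b by ring.
  by field.
- by move=> t t01; have := cg 0 t I0 t01; rewrite mul0r addr0.
- by move=> t t01; have := cg 1 t I1 t01; rewrite mul1r.
- by move=> t t01; have := cg t 1 t01 I1; rewrite mul1r addrAC.
- by move=> t t01; have := cg t 0 t01 I0; rewrite mul0r addr0.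
Qed.

Lemma contourD g1 g2 P a b :
  (forall x y : R, 0 <= x <= 1 -> 0 <= y <= 1 ->
    {for P + x%:C * a + y%:C * b, continuous g1}) ->
  (forall x y : R, 0 <= x <= 1 -> 0 <= y <= 1 ->
    {for P + x%:C * a + y%:C * b, continuous g2}) ->
  contour (fun z => g1 z + g2 z) P a b = contour g1 P a b + contour g2 P a b.
Proof.
have I0 : 0 <= (0 : R) <= 1 by rewrite lexx ler01.
have I1 : 0 <= (1 : R) <= 1 by rewrite lexx ler01.
move=> c1 c2; rewrite /contour /edge_mean.
rewrite !meanD; first by ring.
all: move=> t t01; apply: (edge_continuous (U := C)); rewrite ?[_ *: _]/(_ * _).
- by have := c1 0 t I0 t01; rewrite mul0r addr0.
- by have := c2 0 t I0 t01; rewrite mul0r addr0.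
- by have := c1 1 t I1 t01; rewrite mul1r.
- by have := c2 1 t I1 t01; rewrite mul1r.
- by have := c1 t 1 t01 I1; rewrite mul1r addrAC.
- by have := c2 t 1 t01 I1; rewrite mul1r addrAC.
- by have := c1 t 0 t01 I0; rewrite mul0r addr0.
- by have := c2 t 0 t01 I0; rewrite mul0r addr0.
Qed.

Lemma affine_continuous (x y z : C) : {for z, continuous (fun z : C => x + y * z)}.
Proof.
by apply: contD; [apply: cont_cst | apply: contMl; apply: cvg_id].
Qed.

Lemma edge_mean_affine (x y P a : C) :
  edge_mean (fun z => x + y * z) P a = x + y * (P + a / 2).
Proof.
rewrite /edge_mean (@mean_eq _ _ (fun t => (x + y * P) + (y * a) * t%:C)); last first.
  by move=> t _; ring.
have cid : cont01 (fun t : R => t%:C : C) by move=> t _; exact: real_complex_continuous.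
have ccst (c : C) : cont01 (fun _ : R => c) by move=> t _; apply: cont_cst.
have cmul (c : C) : cont01 (fun t : R => c * t%:C) by move=> t h; apply: contMl; apply: cid.
by rewrite (meanD (ccst _) (cmul _)) (meanZ _ cid) mean_cst mean_id; field.
Qed.

Lemma contour_affine (x y P a b : C) : contour (fun z => x + y * z) P a b = 0.
Proof. by rewrite /contour !edge_mean_affine; ring. Qed.

Lemma contour_bound g P a b (B : R) :
  (forall x y : R, 0 <= x <= 1 -> 0 <= y <= 1 ->
    {for P + x%:C * a + y%:C * b, continuous g}) ->
  (forall x y : R, 0 <= x <= 1 -> 0 <= y <= 1 -> rn (g (P + x%:C * a + y%:C * b)) <= B) ->
  rn (contour g P a b) <= 2 * (rn a + rn b) * B.
Proof.
have I0 : 0 <= (0 : R) <= 1 by rewrite lexx ler01.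
have I1 : 0 <= (1 : R) <= 1 by rewrite lexx ler01.
move=> cg hB.
have h P' a' : (forall t : R, 0 <= t <= 1 -> {for P' + t%:C * a', continuous g} /\ rn (g (P' + t%:C * a')) <= B) ->
    rn (edge_mean g P' a') <= B.
  move=> ht; apply: mean_rn_le => [t /ht[c _]|t /ht[]//].
  exact: (edge_continuous (U := C)).
have e1 : rn (edge_mean g P a) <= B.
  apply: h => t t01; have := cg t 0 t01 I0; have := hB t 0 t01 I0.
  by rewrite mul0r addr0.
have e2 : rn (edge_mean g (P + b) a) <= B.
  apply: h => t t01; have := cg t 1 t01 I1; have := hB t 1 t01 I1.
  by rewrite mul1r addrAC.
have e3 : rn (edge_mean g (P + a) b) <= B.
  apply: h => t t01; have := cg 1 t I1 t01; have := hB 1 t I1 t01.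
  by rewrite mul1r.
have e4 : rn (edge_mean g P b) <= B.
  apply: h => t t01; have := cg 0 t I0 t01; have := hB 0 t I0 t01.
  by rewrite mul0r addr0.
apply: le_trans (rnD _ _) _; rewrite !rnM.
have h1 : rn (edge_mean g P a - edge_mean g (P + b) a) <= 2 * B.
  by apply: le_trans (rnB _ _) _; lra.
have h2 : rn (edge_mean g (P + a) b - edge_mean g P b) <= 2 * B.
  by apply: le_trans (rnB _ _) _; lra.
have := ler_wpM2l (rn_ge0 a) h1; have := ler_wpM2l (rn_ge0 b) h2.
set u := rn _ * rn _; set v := rn _ * rn _; lra.
Qed.

(** The estimate carried through the bisection is that the contour at stage k is at most
    [e / 4 ^ k]. It adds up over quarters; near a point, [g] is affine up to a small multiple of the
    distance, and affine functions have contour 0. *)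
Lemma goursat g P a b :
  (forall x y : R, 0 <= x <= 1 -> 0 <= y <= 1 ->
    differentiable g (P + x%:C * a + y%:C * b)) ->
  contour g P a b = 0.
Proof.
move=> dg.
(* What is bisected is the unit square of parameters; [pt] carries it to the parallelogram. *)
pose pt (p : C) : C := P + (complex.Re p)%:C * a + (complex.Im p)%:C * b.
have cg x y : 0 <= x <= 1 -> 0 <= y <= 1 -> {for P + x%:C * a + y%:C * b, continuous g}.
  by move=> hx hy; apply: differentiable_continuous; apply: dg.
suff small e : 0 < e -> rn (contour g P a b) <= e.
  apply/eqP; rewrite -rn_eq0 eq_le rn_ge0 andbT leNgt; apply/negP => h.
  by have := small (rn (contour g P a b) / 2); lra.
move=> e0.
pose sc (k : nat) : C := (2 ^+ k)%:C^-1.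
have scS k : sc k = sc k.+1 + sc k.+1.
  rewrite /sc exprS rmorphM rmorph_nat; field.
  by rewrite -(rmorph0 (real_complex R)) (inj_eq (@complexI R)) expf_neq0.
pose Q (p : C) (k : nat) := in_rect 1 1 p k p ->
  (forall y, in_rect 1 1 p k y -> in_rect 1 1 0 0 y) ->
  rn (contour g (pt p) (sc k * a) (sc k * b)) <= e / 4 ^+ k.
have sc_pt p k x y : pt p + x%:C * (sc k * a) + y%:C * (sc k * b) =
    pt (p + Complex (x / 2 ^+ k) (y / 2 ^+ k)).
  rewrite /pt /sc !cReD !cImD /= !rmorphD !rmorphM !fmorphV; ring.
have in_sub (p : C) k (x y : R) : 0 <= x <= 1 -> 0 <= y <= 1 ->
    in_rect 1 1 p k (p + Complex (x / 2 ^+ k) (y / 2 ^+ k)).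
  move=> /andP[x0 x1] /andP[y0 y1]; have k0 : (0 : R) < 2 ^+ k by rewrite exprn_gt0.
  split; rewrite ?cReD ?cImD /= ?lerDl ?lerD2l ?divr_ge0 ?(ltW k0) //;
    by rewrite ler_pM2r ?invr_gt0.
have csub p k : (forall y, in_rect 1 1 p k y -> in_rect 1 1 0 0 y) ->
    forall x y, 0 <= x <= 1 -> 0 <= y <= 1 ->
    {for pt p + x%:C * (sc k * a) + y%:C * (sc k * b), continuous g}.
  move=> hsub x y hx hy; rewrite sc_pt.
  have [] := hsub _ (in_sub p k x y hx hy).
  rewrite expr0 divr1 /= !add0r => i1 i2 i3 i4.
  by apply: cg; apply/andP.
suff : Q 0 0%N.
  rewrite /Q /pt /sc /= expr0 !mul0r !addr0 invr1 !mul1r divr1; apply=> //.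
  by split; rewrite ?divr1 /= ?add0r.
have k0 k : (0 : R) <= 1 / 2 ^+ k by rewrite mul1r invr_ge0 exprn_ge0.
apply: (@rect_ind R 1 1 _ _ Q) => //.
- move=> p k hq inp hsub.
  have qq u v : rn (contour g (pt (sub_corner 1 1 p k u v)) (sc k.+1 * a) (sc k.+1 * b))
      <= e / 4 ^+ k.+1.
    apply: hq.
      split=> //; rewrite lerDl; exact: k0.
    move=> y hy; apply: hsub; exact: (sub_rect _ _ hy).
  have pc u v : pt (sub_corner 1 1 p k u v) =
      pt p + u%:R * (sc k.+1 * a) + v%:R * (sc k.+1 * b).
    rewrite -(rmorph_nat (real_complex R) u) -(rmorph_nat (real_complex R) v) sc_pt.
    by rewrite /sub_corner !mul1r.
  have q00 := qq false false; have q10 := qq true false.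
  have q01 := qq false true; have q11 := qq true true.
  move: q00 q10 q01 q11; rewrite !pc !mul0r !mul1r !addr0 => q00 q10 q01 q11.
  rewrite (scS k) !mulrDl contour_quarters; last first.
    by move=> x y hx hy; rewrite -!mulrDl -scS; apply: csub.
  do 3 (apply: le_trans (rnD _ _) _; rewrite -?lerBrDr).
  have -> : e / 4 ^+ k = 4 * (e / 4 ^+ k.+1).
    by rewrite exprS; field; rewrite expf_neq0.
  move: q00 q10 q01 q11; set u := e / _; set A := rn _; set A1 := rn _; set A2 := rn _.
  set A3 := rn _; lra.
- move=> z [z1 z2 z3 z4]; rewrite /= !divr1 !add0r in z1 z2 z3 z4.
  have dz : differentiable g (pt z) by apply: dg; apply/andP.
  pose s := rn a + rn b.
  have s0 : 0 <= s by rewrite addr_ge0 ?rn_ge0.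
  (* With diameter and side sum at most [s / 2 ^ k], [contour_bound] gives [2 * s ^ 2 * e' / 4 ^ k];
     the added 1 keeps the denominator positive when [s = 0]. *)
  pose e' := e / (2 * s ^+ 2 + 1).
  have s2 : 0 < 2 * s ^+ 2 + 1 by rewrite ltr_wpDl // mulr_ge0 // sqr_ge0.
  have e'0 : 0 < e' by rewrite divr_gt0.
  have [d d0 hd] := diff_rnP dz e'0.
  exists (d / (s + 1)); first by rewrite divr_gt0 // ltr_wpDl.
  move=> p k hsub zin kd inp _.
  pose D := 'd g (pt z) 1.
  have dE h : 'd g (pt z) h = D * h.
    by rewrite /D mulrC -[h * _]/(h *: _) -linearZ /= [h *: 1]mulr1.
  pose aff y := g (pt z) - D * pt z + D * y.
  pose rem y := g y - aff y.
  have gE : g = (fun y => aff y + rem y).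
    by apply/funext => y; rewrite /rem; ring.
  have crem x y : 0 <= x <= 1 -> 0 <= y <= 1 ->
      {for pt p + x%:C * (sc k * a) + y%:C * (sc k * b), continuous rem}.
    move=> hx hy; apply: contB; first exact: csub.
    exact: affine_continuous.
  have -> : contour g (pt p) (sc k * a) (sc k * b) =
      contour rem (pt p) (sc k * a) (sc k * b).
    have caff x y : 0 <= x <= 1 -> 0 <= y <= 1 ->
        {for pt p + x%:C * (sc k * a) + y%:C * (sc k * b), continuous aff}.
      by move=> _ _; exact: affine_continuous.
    have := contourD caff crem; rewrite -gE => ->.
    by rewrite /aff contour_affine add0r.
  have ptd (q : C) : in_rect 1 1 p k q -> rn (pt q - pt z) <= s / 2 ^+ k.
    move=> [q1 q2 q3 q4].
    have -> : pt q - pt z = (complex.Re q - complex.Re z)%:C * a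
        + (complex.Im q - complex.Im z)%:C * b.
      by rewrite /pt !rmorphB /=; ring.
    apply: le_trans (rnD _ _) _; rewrite !rnM !rn_real.
    case: zin => y1 y2 y3 y4.
    have A1 : `|complex.Re q - complex.Re z| <= (2 ^+ k)^-1.
      by rewrite -[_^-1]mul1r ler_norml; apply/andP; split; lra.
    have A2 : `|complex.Im q - complex.Im z| <= (2 ^+ k)^-1.
      by rewrite -[_^-1]mul1r ler_norml; apply/andP; split; lra.
    by rewrite /s mulrDl ![_ * (2 ^+ k)^-1]mulrC lerD // ler_wpM2r ?rn_ge0.
  have sk : s / 2 ^+ k < d.
    move: kd; rewrite ltr_pdivlMr ?ltr_wpDl // => kd.
    apply: le_lt_trans kd; rewrite -mulrDl mulrAC ler_wpM2r ?invr_ge0 ?exprn_ge0 //.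
    by lra.
  apply: le_trans (contour_bound (B := e' * (s / 2 ^+ k)) crem _) _.
    move=> x y hx hy; rewrite sc_pt.
    set q := p + _; have hq : in_rect 1 1 p k q by apply: in_sub.
    have := hd (pt q - pt z) (le_lt_trans (ptd _ hq) sk).
    rewrite (addrC (pt z)) subrK dE => h1.
    have -> : rem (pt q) = g (pt q) - g (pt z) - D * (pt q - pt z) by rewrite /rem /aff; ring.
    by apply: le_trans h1 _; rewrite ler_pM2l // ptd.
  have rsc : rn (sc k) = (2 ^+ k)^-1.
    by rewrite /sc -fmorphV rn_real ger0_norm // invr_ge0 exprn_ge0.
  rewrite !rnM rsc -mulrDr -/s.
  have -> : 2 * ((2 ^+ k)^-1 * s) * (e' * (s / 2 ^+ k)) = (2 * s ^+ 2) * e' / 4 ^+ k.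
    have -> : (4 : R) = 2 * 2 by ring.
    by rewrite exprMn; field; rewrite expf_neq0.
  rewrite ler_pM2r ?invr_gt0 ?exprn_gt0 // /e' mulrA ler_pdivrMr //.
  by rewrite mulrC ler_pM2l // lerDl.
Qed.

End Goursat.

(** * The complex exponential and means over circles *)

Section CircleMean.
Context {R : realType}.
Local Notation C := R[i].
Implicit Types (f g q : C -> C) (c z : C) (r : R).

Lemma diff_near (U V : normedModType C) (f g : U -> V) (x : U) (e : R) : 0 < e ->
  (forall y, rn (y - x) < e -> f y = g y) -> differentiable f x ->
  differentiable g x /\ 'd g x = 'd f x :> (U -> V).
Proof.
move=> e0 fg df.
have [k k0 hk] := linear_lipschitz (diff_continuous df).
have kR : k = (complex.Re k)%:C by rewrite RRe_real // gtr0_real.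
apply: (diff_of_rn (M := complex.Re k)) => [h|d d0].
  by have := hk h; rewrite kR !rnE -rmorphM lecR.
have [s s0 hs] := diff_rnP df d0.
exists (Num.min s e); first by rewrite lt_min s0.
move=> h; rewrite lt_min => /andP[h1 h2].
rewrite -!fg; [exact: hs | by rewrite subrr rn0 | by rewrite addrC addKr].
Qed.

Lemma cont_Complex (f g : R -> R) t : {for t, continuous f} -> {for t, continuous g} ->
  {for t, continuous (fun t => Complex (f t) (g t))}.
Proof.
move=> hf hg; apply/contR_rnP => e e0; have e2 : 0 < e / 2 by rewrite divr_gt0.
have lim (u : R -> R) : {for t, continuous u} ->
    exists2 d : R, 0 < d & forall y, `|y - t| < d -> `|u y - u t| < e / 2.
  move=> hu; have /nbhsR_P [d d0 hd] : nbhs t (u @^-1` [set y | `|y - u t| < e / 2]).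
    by apply: hu; apply/nbhsR_P; exists (e / 2).
  by exists d.
have [d1 d10 h1] := lim _ hf; have [d2 d20 h2] := lim _ hg.
exists (Num.min d1 d2); first by rewrite lt_min d10.
move=> y; rewrite lt_min => /andP[/h1 i1 /h2 i2].
by apply: le_lt_trans (rn_le_ReIm _) _; rewrite cReB cImB /=; lra.
Qed.

Lemma deriv_real_rn (f : R -> R) (x d : R) : is_derive x 1 f d ->
  forall e : R, 0 < e -> exists2 s : R, 0 < s &
    forall h, `|h| < s -> `|f (x + h) - f x - h * d| <= e * `|h|.
Proof.
move=> [/derivable1_diffP df <-] e e0.
have /diff_locallyP [_ /eqaddoP/(_ e e0) h] := df.
have /nbhsR_P [s s0 hs] := h; exists s => // y; have := hs y.
rewrite subr0 => hy /hy /=; rewrite !fctE /=.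
rewrite -derive1E deriv1E; last exact/derivable1_diffP.
by rewrite opprD addrA addrC (addrC y x) [- _ + _]addrC.
Qed.

Definition cexp z : C :=
  (expR (complex.Re z))%:C * Complex (cos (complex.Im z)) (sin (complex.Im z)).

Lemma cexpD z w : cexp (z + w) = cexp z * cexp w.
Proof.
rewrite /cexp cReD cImD expRD cosD sinD; apply/eqP.
rewrite eq_complex !(cReM, cImM) /=; apply/andP; split; apply/eqP; ring.
Qed.

(** The derivative of [cexp] at 0, obtained from those of [expR], [sin] and [cos]; the functional
    equation [cexpD] then moves it to every point. *)
Lemma cexp_small (e : R) : 0 < e -> exists2 d : R, 0 < d &
  forall h : C, rn h < d -> rn (cexp h - 1 - h) <= e * rn h.
Proof.
(* The real and imaginary errors will each be at most [5 * e' * rn h], so 16 leaves room; [e' <= 1]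
   serves to bound [expR x] by 3. *)
move=> e0; have [e' [e'0 e'1 e'e]] : exists e', [/\ 0 < e', e' <= 1 & 16 * e' <= e].
  exists (Num.min 1 (e / 16)); split; first by rewrite lt_min ltr01 divr_gt0.
    by rewrite ge_min lexx.
  by rewrite mulrC -ler_pdivlMr // ge_min lexx orbT.
have [d1 d10 h1] := deriv_real_rn (is_derive_expR (0 : R)) e'0.
have [d2 d20 h2] := deriv_real_rn (is_derive_sin (0 : R)) e'0.
have [d3 d30 h3] := deriv_real_rn (is_derive_cos (0 : R)) e'0.
exists (Num.min (Num.min d1 e') (Num.min d2 d3)).
  by rewrite !lt_min d10 d20 d30 e'0.
move=> h; rewrite !lt_min => /andP[/andP[r1 re] /andP[r2 r3]].
set x := complex.Re h; set y := complex.Im h.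
have xh : `|x| <= rn h by exact: Re_le_rn.
have yh : `|y| <= rn h by exact: Im_le_rn.
have := h1 x (le_lt_trans xh r1); have := h2 y (le_lt_trans yh r2).
have := h3 y (le_lt_trans yh r3).
rewrite !add0r expR0 sin0 cos0 subr0 oppr0 mulr0 subr0 !mulr1.
move=> k3 k2 k1; apply: le_trans (rn_le_ReIm _) _.
rewrite !cReB !cImB /cexp cReM cImM /= !mul0r subr0 addr0 subr0 -/x -/y.
have rh := rn_ge0 h.
have x1 : `|x| <= 1 by lra.
have E : expR x <= 3.
  have : e' * `|x| <= 1 by rewrite mulr_ile1 // ltW.
  have := le_trans (ler_norm _) k1; have := ler_norm x; lra.
have E0 : 0 <= expR x := expR_ge0 x.
have a1 : `|expR x * cos y - 1 - x| <= 5 * e' * rn h.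
  have -> : expR x * cos y - 1 - x = expR x * (cos y - 1) + (expR x - 1 - x) by ring.
  apply: le_trans (ler_normD _ _) _; rewrite normrM (ger0_norm E0).
  have : expR x * `|cos y - 1| <= 3 * (e' * rn h).
    apply: ler_pM => //; apply: le_trans k3 _; by rewrite ler_pM2l.
  have : e' * `|x| <= e' * rn h by rewrite ler_pM2l.
  have : 0 <= e' * rn h by rewrite mulr_ge0 // ltW.
  lra.
have a2 : `|expR x * sin y - y| <= 5 * e' * rn h.
  have -> : expR x * sin y - y = expR x * (sin y - y) + (expR x - 1) * y by ring.
  apply: le_trans (ler_normD _ _) _; rewrite !normrM (ger0_norm E0).
  have b1 : expR x * `|sin y - y| <= 3 * (e' * rn h).
    apply: ler_pM => //; apply: le_trans k2 _; by rewrite ler_pM2l.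
  have b2 : `|expR x - 1| <= 2 * e'.
    have := ler_normD (expR x - 1 - x) x; rewrite subrK.
    have : e' * `|x| <= 1 * `|x| by rewrite ler_wpM2r.
    have : e' * `|x| <= e' * e' by rewrite ler_pM2l //; lra.
    have : e' * e' <= e' * 1 by rewrite ler_pM2l.
    lra.
  have : `|expR x - 1| * `|y| <= 2 * e' * rn h by apply: ler_pM.
  lra.
have : 16 * e' * rn h <= e * rn h by rewrite ler_wpM2r.
have : 0 <= e' * rn h by rewrite mulr_ge0 // ltW.
lra.
Qed.

(** A named copy of multiplication, able to carry the linear structure that [diff_of_rn] expects. *)
Definition cmul (a : C) : C -> C := fun h => a * h.

Lemma cmul_linear (a : C) : linear (cmul a).
Proof. by move=> k x y; rewrite /cmul mulrDr; congr (_ + _); exact: mulrCA. Qed.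
HB.instance Definition _ (a : C) := GRing.isLinear.Build C C C *:%R
  (cmul a) (cmul_linear a).

Lemma diff_of_mul f z (d : C) :
  (forall e : R, 0 < e -> exists2 s : R, 0 < s &
    forall h, rn h < s -> rn (f (z + h) - f z - d * h) <= e * rn h) ->
  differentiable f z /\ 'd f z 1 = d.
Proof.
move=> h; have hM x : rn (cmul d x) <= rn d * rn x by rewrite /cmul rnM.
have [h1 h2] := diff_of_rn (L := cmul d) hM h.
by split => //; rewrite h2 /= /cmul mulr1.
Qed.

Lemma diffCE f z h : 'd f z h = 'd f z 1 * h.
Proof. by rewrite mulrC -[h * _]/(h *: _) -linearZ /= [h *: 1]mulr1. Qed.

Lemma diffC_rnP f z : differentiable f z -> forall e : R, 0 < e -> exists2 d : R, 0 < d &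
    forall y, rn (y - z) < d -> rn (f y - f z - 'd f z 1 * (y - z)) <= e * rn (y - z).
Proof.
move=> df e e0; have [d d0 hd] := diff_rnP df e0; exists d => // y /hd.
by rewrite -diffCE (addrC z) subrK.
Qed.

Lemma differentiable_cexp z : differentiable cexp z.
Proof.
suff [] : differentiable cexp z /\ 'd cexp z 1 = cexp z by [].
apply: diff_of_mul => e e0.
have [d d0 hd] := cexp_small (divr_gt0 e0 (ltr_wpDl (rn_ge0 (cexp z)) ltr01)).
exists d => // h /hd hh.
have -> : cexp (z + h) - cexp z - cexp z * h = cexp z * (cexp h - 1 - h).
  by rewrite cexpD; ring.
rewrite rnM; apply: le_trans (ler_wpM2l (rn_ge0 _) hh) _.
rewrite mulrA ler_wpM2r ?rn_ge0 // mulrCA ger_pMr //.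
by rewrite ler_pdivrMr ?mul1r ?lerDl // ltr_wpDl ?rn_ge0.
Qed.

(** This is [exp (2 pi i t)]: the unit circle is parametrized by [0, 1], so that [mean] is the
    normalized angular average. *)
Definition ce (t : R) : C := Complex (cos (t * (2 * pi))) (sin (t * (2 * pi))).

Lemma rn_ce t : rn (ce t) = 1.
Proof.
apply/eqP; rewrite -(@eqrXn2 _ 2) ?rn_ge0 // rn_sqr /= cos2Dsin2 expr1n.
by [].
Qed.

Lemma ce_continuous t : {for t, continuous ce}.
Proof.
apply: cont_Complex.
- apply: (continuous_comp (f := fun t : R => t * (2 * pi))); last exact: continuous_cos.
  by apply: continuousM; [exact: cvg_id | exact: cvg_cst].
- apply: (continuous_comp (f := fun t : R => t * (2 * pi))); last exact: continuous_sin.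
  by apply: continuousM; [exact: cvg_id | exact: cvg_cst].
Qed.

Definition cmean f c r := mean (fun t => f (c + r%:C * ce t)).

Lemma circle_continuous (U : normedModType C) (f : U -> C) (x v : U) (r : R) t :
  {for (x + (r%:C * ce t) *: v), continuous f} ->
  {for t, continuous (fun t => f (x + (r%:C * ce t) *: v))}.
Proof.
move=> hf; apply: (continuous_comp (f := fun t : R => x + (r%:C * ce t) *: v)) => //.
apply: contD; first exact: cont_cst.
by apply: contZ; [apply: contMl; exact: ce_continuous | exact: cont_cst].
Qed.

Lemma circle_continuousC (f : C -> C) (x : C) (r : R) t :
  {for (x + r%:C * ce t), continuous f} ->
  {for t, continuous (fun t => f (x + r%:C * ce t))}.
Proof.
move=> hf; refine (@continuous_comp _ _ _ (fun t : R => x + r%:C * ce t) f t _ hf).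
by apply: contD; [exact: cont_cst | apply: contMl; exact: ce_continuous].
Qed.

Lemma rn_circle (r : R) t : 0 <= r -> rn (r%:C * ce t) = r.
Proof. by move=> r0; rewrite rnM rn_real rn_ce mulr1 ger0_norm. Qed.

(** The function [f (c + cexp w)] is holomorphic on the rectangle with sides [ln r0, ln r1] and
    [0, 2 pi]. By periodicity its two horizontal edges cancel, and the means over the vertical edges
    are the two circle means. *)
Lemma cmean_const f c (r0 r1 : R) : 0 < r0 -> r0 <= r1 ->
  (forall z, r0 <= rn (z - c) <= r1 -> differentiable f z) ->
  cmean f c r0 = cmean f c r1.
Proof.
move=> r00 r01 df; have r10 := lt_le_trans r00 r01.
pose g w := f (c + cexp w).
pose P : C := (ln r0)%:C; pose a : C := (ln r1 - ln r0)%:C; pose b : C := Complex 0 (2 * pi).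
have eP (x y : R) : cexp ((ln r0)%:C + x%:C * a + y%:C * b) =
    (expR (ln r0 + x * (ln r1 - ln r0)))%:C * ce y.
  by rewrite /cexp /ce !(cReD, cImD, cReM, cImM) /=; congr ((expR _)%:C * Complex (cos _) (sin _)); ring.
have E0 : expR (ln r0 + 0 * (ln r1 - ln r0)) = r0.
  by rewrite mul0r addr0 lnK.
have E1 : expR (ln r0 + 1 * (ln r1 - ln r0)) = r1.
  by rewrite mul1r addrC subrK lnK.
have := @goursat R g P a b; rewrite /contour => h.
have {}h : b * (edge_mean g (P + a) b - edge_mean g P b) = 0.
  rewrite -h; last first.
    move=> x y /andP[x0 x1] hy; apply: differentiable_comp.
      exact: (differentiableD (differentiable_cst _ _) (differentiable_cexp _)).
    apply: df; rewrite addrC addKr eP rn_circle ?expR_ge0 //.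
    have l01 : ln r0 <= ln r1 by rewrite ler_ln ?posrE.
    by apply/andP; split; [rewrite -[leLHS](lnK r00) | rewrite -[leRHS](lnK r10)];
      rewrite ler_expR; nra.
  suff -> : edge_mean g P a = edge_mean g (P + b) a by rewrite subrr mulr0 add0r.
  apply: mean_eq => t _; rewrite /g; congr (f (c + _)).
  have := eP t 0; rewrite mul0r addr0 => ->.
  have -> : P + b + t%:C * a = P + t%:C * a + 1%:C * b by rewrite rmorph1; ring.
  by rewrite eP /ce mul0r mul1r mulr_natl cos0 sin0 cos2pi sin2pi.
have b0 : b != 0.
  by rewrite eq_complex /= negb_and mulf_neq0 ?orbT // gt_eqF ?pi_gt0.
move/eqP: h; rewrite mulf_eq0 (negbTE b0) /= subr_eq0 => /eqP h.
have m0 : cmean f c r0 = edge_mean g P b.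
  apply: mean_eq => t _; rewrite /g; have := eP 0 t.
  by rewrite E0 rmorph0 mul0r addr0 => ->.
have m1 : cmean f c r1 = edge_mean g (P + a) b.
  apply: mean_eq => t _; rewrite /g; have := eP 1 t.
  by rewrite E1 rmorph1 mul1r => ->.
by rewrite m0 m1.
Qed.

Lemma cont_circle f c r : 0 <= r -> (forall z, rn (z - c) = r -> {for z, continuous f}) ->
  cont01 (fun t => f (c + r%:C * ce t)).
Proof.
move=> r0 hf t _; apply: circle_continuousC; apply: hf.
by rewrite addrC addKr rn_circle.
Qed.

(** The circle mean does not depend on the radius and tends to [f c] as the radius shrinks. Mere
    continuity at the center lets this apply to difference quotients, in place of a theorem on
    removable singularities. *)
Lemma mean_value f c r : 0 < r -> {for c, continuous f} ->
  (forall z, z != c -> rn (z - c) <= r -> differentiable f z) ->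
  cmean f c r = f c.
Proof.
move=> r0 cf df; apply/eqP; rewrite -subr_eq0 -rn_eq0 eq_le rn_ge0 andbT.
rewrite leNgt; apply/negP => h; set e := rn _ in h.
have [d d0 hd] := (cont_rnP _ _).1 cf _ (divr_gt0 h (ltr0Sn _ 1)).
pose s := Num.min r (d / 2).
have s0 : 0 < s by rewrite lt_min r0 divr_gt0.
have sr : s <= r by rewrite ge_min lexx.
have sd : s < d.
  have : s <= d / 2 by rewrite ge_min lexx orbT.
  lra.
have E : cmean f c s = cmean f c r.
  apply: (cmean_const s0 sr) => z /andP[z1 z2]; refine (df z _ z2).
  by rewrite -subr_eq0 -rn_gt0 (lt_le_trans s0).
have hc : cont01 (fun t => f (c + s%:C * ce t)).
  apply: cont_circle; first exact: ltW.
  move=> z hz; apply: differentiable_continuous; apply: df.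
    by rewrite -subr_eq0 -rn_gt0 hz.
  by rewrite hz.
have : rn (cmean f c s - f c) <= e / 2.
  rewrite /cmean -(mean_subc _ hc); apply: mean_rn_le.
    exact: cont01_subc.
  by move=> t _; apply/ltW/hd; rewrite addrC addKr rn_circle // ltW.
rewrite E -/e; lra.
Qed.

End CircleMean.

(** * Differentiation rules for maps written pointwise *)

Section Differentiability.
Context {R : realType}.
Local Notation C := R[i].

Lemma dfD (U V : normedModType C) (f g : U -> V) x :
  differentiable f x -> differentiable g x -> differentiable (fun y => f y + g y) x.
Proof. exact: (@differentiableD C U V f g x). Qed.

Lemma dfB (U V : normedModType C) (f g : U -> V) x :
  differentiable f x -> differentiable g x -> differentiable (fun y => f y - g y) x.
Proof. exact: (@differentiableB C U V f g x). Qed.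

Lemma dfM (U : normedModType C) (f g : U -> C) x :
  differentiable f x -> differentiable g x -> differentiable (fun y => f y * g y) x.
Proof. exact: (@differentiableM C U f g x). Qed.

Lemma dfV (U : normedModType C) (f : U -> C) x :
  f x != 0 -> differentiable f x -> differentiable (fun y => (f y)^-1) x.
Proof. by move=> h1 h2; exact: (@differentiableV C U f x h2 h1). Qed.

Lemma df_cst (U V : normedModType C) (c : V) (x : U) : differentiable (fun=> c) x.
Proof. exact: differentiable_cst. Qed.

Lemma df_id (U : normedModType C) (x : U) : differentiable (fun y : U => y) x.
Proof. exact: ex_diff. Qed.

Lemma df_comp (U V W : normedModType C) (f : U -> V) (g : V -> W) x :
  differentiable f x -> differentiable g (f x) -> differentiable (fun y => g (f y)) x.
Proof. exact: (@differentiable_comp C U V W f g x). Qed.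

Lemma df_cont (U V : normedModType C) (f : U -> V) x :
  differentiable f x -> {for x, continuous f}.
Proof. exact: differentiable_continuous. Qed.

End Differentiability.
Arguments dfD {R U V f g x}.
Arguments dfB {R U V f g x}.
Arguments dfM {R U f g x}.
Arguments dfV {R U f x}.
Arguments df_cst {R U V} c x.
Arguments df_id {R U} x.
Arguments df_comp {R U V W f g x}.
Arguments df_cont {R U V f x}.

(** * Holomorphic functions of one variable *)

Section OneVariable.
Context {R : realType}.
Local Notation C := R[i].
Implicit Types (f g q : C -> C) (c z : C) (r : R).

Definition cder f z : C := 'd f z 1.

Definition slope f c z : C := if z == c then cder f c else (f z - f c) / (z - c).

Lemma slopeE f c z : z != c -> slope f c z = (f z - f c) / (z - c).
Proof. by rewrite /slope => /negbTE ->. Qed.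

Lemma slopeM f c z : f z - f c = slope f c z * (z - c).
Proof.
have [->|zc] := eqVneq z c; first by rewrite !subrr mulr0.
by rewrite slopeE // divfK // subr_eq0.
Qed.

Lemma slope_center f c : slope f c c = cder f c.
Proof. by rewrite /slope eqxx. Qed.

Lemma slope_continuous f c : differentiable f c -> {for c, continuous (slope f c)}.
Proof.
move=> df; apply/cont_rnP => e e0.
have [d d0 hd] := diffC_rnP df (divr_gt0 e0 (ltr0Sn _ 1)).
exists d => // y yd; rewrite slope_center.
have [->|yc] := eqVneq y c; first by rewrite slope_center subrr rn0.
have y0 : y - c != 0 by rewrite subr_eq0.
have := hd y yd; rewrite -/(cder f c) slopeM -mulrBl rnM.
by rewrite ler_pM2r ?rn_gt0 // => h; apply: le_lt_trans h _; lra.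
Qed.

Lemma slope_differentiable f c z : z != c -> differentiable f z ->
  differentiable (slope f c) z.
Proof.
move=> zc df; have z0 : 0 < rn (z - c) by rewrite rn_gt0 subr_eq0.
have h : differentiable (fun z => (f z - f c) / (z - c)) z.
  apply: dfM; first exact: (dfB df (df_cst _ _)).
  by apply: dfV; [rewrite subr_eq0 | exact: (dfB (df_id _) (df_cst _ _))].
have [] // := @diff_near R C C (fun z => (f z - f c) / (z - c)) (slope f c) z _ z0 _ h.
move=> y hy; rewrite slopeE //; apply: contraTneq hy => ->.
by rewrite rnBC ltxx.
Qed.

Lemma slope_mean f c r : 0 < r -> (forall z, rn (z - c) <= r -> differentiable f z) ->
  cmean (slope f c) c r = cder f c.
Proof.
move=> r0 df; rewrite mean_value // ?slope_center //.
- by apply/slope_continuous/df; rewrite subrr rn0 ltW.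
- by move=> z zc zr; apply: slope_differentiable => //; apply: df.
Qed.

Lemma circle_neq0 r t : 0 < r -> r%:C * ce t != 0.
Proof. by move=> r0; rewrite -rn_gt0 rn_circle // ltW. Qed.

Lemma inv_circle_cont r : 0 < r -> cont01 (fun t => (r%:C * ce t)^-1 : C).
Proof.
move=> r0 t _; refine (@contV R _ (fun t => r%:C * ce t) t (circle_neq0 t r0) _).
exact: (contMl _ (@ce_continuous R t)).
Qed.

(** Scaling the radius from 1 to 2 halves this mean, whereas [cmean_const] for [1 / z] says that it
    does not change. *)
Lemma mean_inv_circle r : 0 < r -> mean (fun t => (r%:C * ce t)^-1) = 0 :> C.
Proof.
move=> r0; pose m : C := mean (fun t => (ce t)^-1).
have mE s : 0 < s -> mean (fun t => (s%:C * ce t)^-1) = s%:C^-1 * m.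
  move=> s0; rewrite -meanZ; last first.
    by move=> t _; refine (@contV R _ ce t _ (@ce_continuous R t)); rewrite -rn_gt0 rn_ce.
  by apply: mean_eq => t _; rewrite invfM.
have := @cmean_const R (fun z => z^-1) 0 1 2 ltr01.
rewrite /cmean => /(_ _ _) h.
have : mean (fun t => (1%:C * ce t)^-1) = mean (fun t => (2%:C * ce t)^-1) :> C.
  have -> : mean (fun t => (1%:C * ce t)^-1) = mean (fun t => (0 + 1%:C * ce t)^-1) :> C.
    by apply: mean_eq => t _; rewrite add0r.
  rewrite h.
  - by apply: mean_eq => t _; rewrite add0r.
  - by rewrite ler1n.
  - move=> z /andP[z1 _]; apply: differentiable_Rinv.
    by rewrite -rn_gt0 -(subr0 z) (lt_le_trans ltr01).
rewrite !mE // rmorph1 invr1 mul1r rmorph_nat => /eqP.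
have -> : (m == 2^-1 * m) = (2^-1 * m == 0).
  by rewrite -[LHS]subr_eq0; congr (_ == _); field.
by rewrite mulf_eq0 invr_eq0 pnatr_eq0 /= => /eqP ->; rewrite mulr0.
Qed.

(** Cauchy's formula for the derivative: the mean value property of [slope f c], whose term in [f c]
    averages to 0 by [mean_inv_circle]. *)
Lemma cder_mean f c r : 0 < r -> (forall z, rn (z - c) <= r -> differentiable f z) ->
  cont01 (fun t => f (c + r%:C * ce t) * (r%:C * ce t)^-1) /\
  cder f c = mean (fun t => f (c + r%:C * ce t) * (r%:C * ce t)^-1).
Proof.
move=> r0 df.
have cf : cont01 (fun t => f (c + r%:C * ce t)).
  apply: cont_circle; first exact: ltW.
  by move=> z zr; apply: df_cont; apply: df; rewrite zr.
have ci := inv_circle_cont r0.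
have c1 : cont01 (fun t => f (c + r%:C * ce t) * (r%:C * ce t)^-1).
  by move=> t ht; exact: (contM (cf t ht) (ci t ht)).
have c2 : cont01 (fun t => - f c * (r%:C * ce t)^-1).
  by move=> t ht; exact: (contMl _ (ci t ht)).
split => //; rewrite -(slope_mean r0 df).
rewrite /cmean (@mean_eq _ _ (fun t => f (c + r%:C * ce t) * (r%:C * ce t)^-1 +
   (- f c * (r%:C * ce t)^-1))); last first.
  move=> t _; have E : c + r%:C * ce t - c = r%:C * ce t by rewrite addrC addKr.
  rewrite slopeE; last by rewrite -subr_eq0 E circle_neq0.
  by rewrite E mulNr -mulrBl.
by rewrite (meanD c1 c2) (meanZ _ ci) mean_inv_circle // mulr0 addr0.
Qed.

Lemma compact_cdisk c r : compact [set z : C | rn (z - c) <= r].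
Proof.
pose h (p : R * R) : C := c + Complex p.1 p.2.
have ch : continuous h.
  move=> [x y] A /nbhs_rnP [e e0 hA]; rewrite /nbhs /=.
  have e2 : 0 < e / 2 by rewrite divr_gt0.
  exists ([set a : R | `|a - x| < e / 2], [set b : R | `|b - y| < e / 2]) => /=.
    by split; apply/nbhsR_P; exists (e / 2).
  move=> [a b] /= [h1 h2]; apply: hA; rewrite /h /=.
  have -> : c + Complex a b - (c + Complex x y) = Complex (a - x) (b - y).
    by rewrite opprD addrACA subrr add0r.
  by apply: le_lt_trans (rn_le_ReIm _) _ => /=; lra.
have cK : compact (h @` ([set x : R | x \in `[- r, r]] `*` [set x : R | x \in `[- r, r]])).
  apply: continuous_compact; last by apply: compact_setX; exact: segment_compact.
  exact: continuous_subspaceT.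
apply: (subclosed_compact _ cK).
- rewrite -(setCK [set z : C | _]); apply: open_closedC.
  apply/open_rnP => z /= /negP; rewrite -ltNge => hz.
  exists (rn (z - c) - r); first by rewrite subr_gt0.
  move=> y hy; apply/negP; rewrite -ltNge.
  have := rnDB z y c; rewrite (rnBC z y); lra.
- move=> z /= hz; exists (complex.Re (z - c), complex.Im (z - c)); last first.
    have -> : h (complex.Re (z - c), complex.Im (z - c)) = c + (z - c).
      by rewrite /h /=; case: (z - c).
    by rewrite addrC subrK.
  split=> /=; rewrite in_itv /= -ler_norml; first exact: le_trans (Re_le_rn _) hz.
  exact: le_trans (Im_le_rn _) hz.
Qed.

(** The inequality [2 Re (conj q0 q1) <= |q0|^2 + |q1|^2] trades the square [|q1|^2] for an
    expression linear in [q1] and [w], whose mean over a circle is known. *)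
Lemma max_principle_aux (e s : R) (q0 q1 d w : C) : 0 <= e -> rn w = s ->
  rn q1 ^+ 2 + e * rn (d + w) ^+ 2 <= rn q0 ^+ 2 + e * rn d ^+ 2 ->
  complex.Re ((2 * q0^* ) * q1 + (2 * e%:C * d^* ) * w) <= 2 * rn q0 ^+ 2 - e * s ^+ 2.
Proof.
move=> e0 <-; rewrite !rn_sqr.
have -> : (2 : C) = 2%:C by rewrite rmorph_nat.
case: q0 q1 d w => [a1 a2] [b1 b2] [d1 d2] [w1 w2] /=.
have := sqr_ge0 (a1 - b1); have := sqr_ge0 (a2 - b2); nra.
Qed.

(** The perturbation [e * rn (y - c) ^ 2] rules out interior maxima of [|q|^2], and e tends to 0.
    One good radius per point is assumed, since the quotients to which this is applied are not known
    to be differentiable at [c]. *)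
Lemma max_principle q c r (B : R) : 0 <= B ->
  (forall z, rn (z - c) <= r -> {for z, continuous q}) ->
  (forall z, rn (z - c) < r -> exists2 s : R, 0 < s <= r - rn (z - c) & cmean q z s = q z) ->
  (forall z, rn (z - c) = r -> rn (q z) <= B) ->
  forall z, rn (z - c) <= r -> rn (q z) <= B.
Proof.
move=> B0 cq mq bq z zr.
have r0 : 0 <= r := le_trans (rn_ge0 _) zr.
suff H e : 0 < e -> rn (q z) ^+ 2 <= B ^+ 2 + e * r ^+ 2.
  rewrite -(ler_pXn2r (n:=2)) ?nnegrE ?rn_ge0 //; apply/ler_addgt0Pr => e e0.
  apply: le_trans (H (e / (r ^+ 2 + 1)) _) _.
    by rewrite divr_gt0 // ltr_wpDl // sqr_ge0.
  rewrite lerD2l mulrAC ler_pdivrMr ?ler_pM2l ?lerDl //.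
  by rewrite ltr_wpDl // sqr_ge0.
move=> e0.
pose u y : R := rn (q y) ^+ 2 + e * rn (y - c) ^+ 2.
pose A := [set y : C | rn (y - c) <= r].
have cu : {within A, continuous u}.
  apply: continuous_in_subspaceT => y /set_mem yA.
  have crn (U : normedModType C) (v : U) : {for v, continuous (fun w : U => rn w)}.
    apply/contCR_rnP => d d0; exists d => // w.
    apply: le_lt_trans; rewrite ler_norml rn_lbB andbT.
    by have := rn_lbB v w; rewrite (rnBC v w); lra.
  have c1 : {for y, continuous (fun y => rn (q y))}.
    exact: (@continuous_comp _ _ _ q (fun w : C => rn w) y (cq y yA) (crn _ _)).
  have c2 : {for y, continuous (fun y => rn (y - c))}.
    refine (@continuous_comp _ _ _ (fun y : C => y - c) (fun w : C => rn w) y _ (crn _ _)).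
    exact: (contB (@cvg_id _ _) (cont_cst _ _)).
  have cM (f g : C -> R) : {for y, continuous f} -> {for y, continuous g} ->
      {for y, continuous (fun v => f v * g v)}.
    by move=> h1 h2; exact: (@continuousM R C f g y h1 h2).
  have cD (f g : C -> R) : {for y, continuous f} -> {for y, continuous g} ->
      {for y, continuous (fun v => f v + g v)}.
    by move=> h1 h2; exact: (@continuousD R R^o C f g y h1 h2).
  rewrite /u; apply: (cD _ _ (cM _ _ c1 c1)); apply: (cM _ _ _ (cM _ _ c2 c2)).
  exact: cst_continuous.
have [|y /set_mem yA hy] := compact_EVT_max _ (@compact_cdisk c r) cu.
  by exists c; rewrite /= subrr rn0.
have [yr|yr] := ltP (rn (y - c)) r; last first.
  have yE : rn (y - c) = r by apply/eqP; rewrite eq_le yr andbT.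
  have := hy z (mem_set zr); rewrite /u yE => h.
  have : rn (q y) ^+ 2 <= B ^+ 2 by rewrite ler_pXn2r ?nnegrE ?rn_ge0 // bq.
  have : 0 <= e * rn (z - c) ^+ 2 by rewrite mulr_ge0 ?sqr_ge0 // ltW.
  lra.
have [s /andP[s0 sr] ms] := mq _ yr.
have inA t : A (y + s%:C * ce t).
  rewrite /A /= addrAC; apply: le_trans (rnD _ _) _; rewrite (rn_circle _ (ltW s0)); lra.
(* At an interior maximum y the mean of [psi] equals [2 * rn (q y) ^ 2], yet every value has real
   part at most this minus [e * s ^ 2]. *)
pose psi t : C := (2 * (q y)^*) * q (y + s%:C * ce t) + (2 * e%:C * (y - c)^*) * (s%:C * ce t).
have cA : cont01 (fun t => q (y + s%:C * ce t)).
  by move=> t _; apply: circle_continuousC; apply: cq; exact: inA.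
have cB : cont01 (fun t : R => s%:C * ce t : C).
  by move=> t _; exact: (contMl _ (@ce_continuous R t)).
have cpsi : cont01 psi.
  by move=> t ht; exact: (contD (contMl _ (cA t ht)) (contMl _ (cB t ht))).
have m0 : mean (fun t => s%:C * ce t) = 0 :> C.
  have := @mean_value R id 0 s s0; rewrite /cmean /= => h.
  rewrite -[RHS]h; first by apply: mean_eq => t _; rewrite add0r.
  - exact: cvg_id.
  - by move=> *; exact: df_id.
have Epsi : mean psi = (2 * rn (q y) ^+ 2)%:C.
  have c1 t (ht : 0 <= t <= 1) := contMl (2 * (q y)^*) (cA t ht).
  have c2 t (ht : 0 <= t <= 1) := contMl (2 * e%:C * (y - c)^*) (cB t ht).
  rewrite /psi (meanD c1 c2) (meanZ _ cA) (meanZ _ cB) m0 mulr0 addr0.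
  rewrite -/(cmean q y s) ms -mulrA [_^* * _]mulrC mulJ.
  by rewrite [in RHS]rmorphM rmorph_nat.
have : complex.Re (mean psi) <= 2 * rn (q y) ^+ 2 - e * s ^+ 2.
  apply: mean_Re_le => // t _.
  have := hy _ (mem_set (inA t)); rewrite /u.
  have E1 : (y + s%:C * ce t - c) = (y - c) + s%:C * ce t by rewrite addrAC.
  rewrite E1.
  apply: max_principle_aux; rewrite ?rn_circle // ltW //.
rewrite Epsi /=.
have : 0 < e * s ^+ 2 by rewrite mulr_gt0 // exprn_gt0.
lra.
Qed.

(** The maximum principle for [slope f c]: at [c] the mean value property is [slope_mean], and
    elsewhere it holds on a circle too small to reach [c]. *)
Lemma schwarz_disk f c r (M : R) : 0 < r -> 0 <= M ->
  (forall z, rn (z - c) <= r -> differentiable f z) ->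
  f c = 0 -> (forall z, rn (z - c) = r -> rn (f z) <= M) ->
  forall z, rn (z - c) <= r -> rn (f z) <= M / r * rn (z - c).
Proof.
move=> r0 M0 df fc bf z zr.
have := slopeM f c z; rewrite fc subr0 => ->; rewrite rnM ler_wpM2r ?rn_ge0 //.
have cq y : rn (y - c) <= r -> {for y, continuous (slope f c)}.
  move=> yr; have [->|yc] := eqVneq y c.
    by apply/slope_continuous/df; rewrite subrr rn0 ltW.
  by apply/df_cont/slope_differentiable/df.
apply: (@max_principle _ c r) => //; first by rewrite divr_ge0 // ltW.
- move=> y yr; have [->|yc] := eqVneq y c.
    exists r; first by rewrite subrr rn0 subr0 r0 lexx.
    by rewrite slope_mean // slope_center.
  have yc0 : 0 < rn (y - c) by rewrite rn_gt0 subr_eq0.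
  have [s [s0 s1 s2]] : exists s, [/\ 0 < s, s <= r - rn (y - c) & s < rn (y - c)].
    exists (Num.min (r - rn (y - c)) (rn (y - c) / 2)).
    rewrite lt_min subr_gt0 yr divr_gt0 // ge_min lexx /=; split => //.
    by rewrite gt_min; apply/orP; right; lra.
  exists s; first by rewrite s0 s1.
  have dq w : rn (w - y) <= s -> differentiable (slope f c) w.
    move=> wy; apply: slope_differentiable.
      by apply: contraTneq wy => ->; rewrite -ltNge rnBC.
    by apply: df; have := rnDB w y c; lra.
  apply: mean_value => //; last by move=> w _; exact: dq.
  by apply/df_cont/dq; rewrite subrr rn0 ltW.
- move=> y yr; have yc : y != c by rewrite -subr_eq0 -rn_gt0 yr.
  rewrite slopeE // fc subr0 rnf yr ler_pM2r ?invr_gt0 //; exact: bf.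
Qed.

Lemma lipschitz_disk f c r (M : R) : 0 < r ->
  (forall z, rn (z - c) <= r -> differentiable f z) ->
  (forall z, rn (z - c) <= r -> rn (f z) <= M) ->
  forall z, rn (z - c) <= r -> rn (f z - f c) <= 2 * M / r * rn (z - c).
Proof.
move=> r0 df bf z zr.
have M0 : 0 <= M by apply: le_trans (rn_ge0 (f z)) (bf _ zr).
refine (@schwarz_disk (fun z => f z - f c) c r (2 * M) r0 (mulr_ge0 (ler0n _ 2) M0) _ _ _ z zr).
- by move=> y yr; exact: (dfB (df y yr) (df_cst _ _)).
- by rewrite subrr.
- move=> y yr; apply: le_trans (rnB _ _) _.
  have := bf y; rewrite yr lexx => /(_ isT).
  have := bf c; rewrite subrr rn0 (ltW r0) => /(_ isT); lra.
Qed.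

(** Bisection of [0, 1]: the estimate with [L + e] adds up over adjacent intervals, and on short
    intervals it is differentiability at a point. The derivative is never integrated, so its
    continuity is not assumed. *)
Lemma mean_value_ineq f (a v d : C) (L : R) :
  (forall t : R, 0 <= t <= 1 -> differentiable f (a + t%:C * v)) ->
  (forall t : R, 0 <= t <= 1 -> rn (cder f (a + t%:C * v) - d) <= L) ->
  rn (f (a + v) - f a - d * v) <= L * rn v.
Proof.
move=> df bf.
have L0 : 0 <= L by apply: le_trans (rn_ge0 _) (bf 0 _); rewrite lexx ler01.
suff H e : 0 < e -> rn (f (a + v) - f a - d * v) <= (L + e) * rn v.
  apply/ler_addgt0Pr => e e0.
  have v1 : 0 < rn v + 1 by rewrite ltr_wpDl ?rn_ge0.
  apply: le_trans (H _ (divr_gt0 e0 v1)) _.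
  by rewrite mulrDl lerD2l mulrAC ler_pdivrMr // ler_pM2l // lerDl.
move=> e0.
pose F (s t : R) := f (a + t%:C * v) - f (a + s%:C * v) - d * ((t - s)%:C * v).
pose Q (p : C) k := rn (F (complex.Re p) (complex.Re p + (2 ^+ k)^-1)) <= (L + e) * rn v / 2 ^+ k.
suff : Q 0 0%N.
  by rewrite /Q /F /= expr0 invr1 mulr1 add0r mul0r addr0 subr0 mul1r.
have half k : (2 ^+ k)^-1 = (2 ^+ k.+1)^-1 + (2 ^+ k.+1)^-1 :> R.
  by rewrite exprS; field; rewrite expf_neq0.
apply: (@rect_ind R 1 0 _ _ Q) => //.
- move=> p k hq; have q0 := hq false false; have q1 := hq true false.
  rewrite /Q /sub_corner cReD /= mul0r addr0 in q0.
  rewrite /Q /sub_corner cReD /= !mul1r in q1.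
  rewrite /Q (half k) addrA.
  set s := complex.Re p in q0 q1 *; set h := (2 ^+ k.+1)^-1 in q0 q1 *.
  have -> : F s (s + h + h) = F s (s + h) + F (s + h) (s + h + h).
    by rewrite /F !rmorphB !rmorphD /=; ring.
  apply: le_trans (rnD _ _) _.
  by rewrite mulrDr; exact: lerD.
- move=> z [z1 z2 _ _]; rewrite /= divr1 add0r in z1 z2.
  set t := complex.Re z in z1 z2 *.
  have t01 : 0 <= t <= 1 by rewrite z1.
  have [s s0 hs] := diffC_rnP (df t t01) e0.
  have v1 : 0 < rn v + 1 by rewrite ltr_wpDl ?rn_ge0.
  exists (s / (rn v + 1)); first by rewrite divr_gt0.
  move=> p k _ [p1 p2 _ _]; rewrite mul0r addr0 mul1r ltr_pdivlMr // => kd.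
  rewrite -/t mul1r in p1 p2; rewrite /Q; set x := complex.Re p in p1 p2 *.
  set h := (2 ^+ k)^-1 in p2 kd *.
  have h0 : 0 <= h by rewrite invr_ge0 exprn_ge0.
  have near y : x <= y -> y <= x + h ->
      rn (f (a + y%:C * v) - f (a + t%:C * v) - cder f (a + t%:C * v) * ((y - t)%:C * v))
      <= e * (`|y - t| * rn v).
    move=> y1 y2; have E : a + y%:C * v - (a + t%:C * v) = (y - t)%:C * v.
      by rewrite rmorphB /=; ring.
    have := hs (a + y%:C * v); rewrite E rnM rn_real; apply.
    apply: le_lt_trans kd; rewrite mulrDr mulr1.
    have yt : `|y - t| <= h by rewrite ler_norml; apply/andP; split; lra.
    by apply: le_trans (ler_wpM2r (rn_ge0 v) yt) _; rewrite lerDl.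
  have n1 := near x; have n2 := near (x + h).
  rewrite lexx lerDl h0 in n1; rewrite lexx lerDl h0 in n2.
  have {}n1 := n1 isT isT; have {}n2 := n2 isT isT.
  rewrite (ler0_norm (_ : x - t <= 0)) in n1; last by lra.
  rewrite (ger0_norm (_ : 0 <= x + h - t)) in n2; last by lra.
  have hk : (L + e) * rn v / 2 ^+ k = (L + e) * (rn v * h) by rewrite /h; ring.
  rewrite hk.
  set D := cder f _ in n1 n2.
  have -> : F x (x + h) = (D - d) * (h%:C * v)
     + (f (a + (x + h)%:C * v) - f (a + t%:C * v) - D * ((x + h - t)%:C * v))
     - (f (a + x%:C * v) - f (a + t%:C * v) - D * ((x - t)%:C * v)).
    by rewrite /F !rmorphB !rmorphD /=; ring.
  apply: le_trans (rnB _ _) _; apply: le_trans (lerD (rnD _ _) (lexx _)) _.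
  have b1 : rn ((D - d) * (h%:C * v)) <= L * (rn v * h).
    rewrite !rnM rn_real ger0_norm // [h * _]mulrC ler_wpM2r ?mulr_ge0 ?rn_ge0 //.
    exact: bf.
  have : e * (rn v * h) = e * ((x + h - t) * rn v) + e * (- (x - t) * rn v) by ring.
  lra.
Qed.

(** Cauchy's formula on circles of radius [r / 2] about z and c, where [f] is [4 * M / r]-Lipschitz,
    makes the derivative Lipschitz at [c] with constant [8 * M / r ^ 2]; the mean value inequality
    concludes. *)
Lemma quadratic_remainder f c r (M : R) : 0 < r ->
  (forall z, rn (z - c) <= r -> differentiable f z) ->
  (forall z, rn (z - c) <= r -> rn (f z) <= M) ->
  forall z, rn (z - c) <= r / 2 ->
  rn (f z - f c - cder f c * (z - c)) <= 8 * M / r ^+ 2 * rn (z - c) ^+ 2.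
Proof.
move=> r0 df bf.
have M0 : 0 <= M by apply: le_trans (rn_ge0 (f c)) (bf _ _); rewrite subrr rn0 ltW.
have r2 : 0 < r / 2 by rewrite divr_gt0.
have lip w z : rn w = r / 2 -> rn (z - c) <= r / 2 ->
    rn (f (z + w) - f (c + w)) <= 4 * M / r * rn (z - c).
  move=> wr zr.
  have inD y : rn (y - (c + w)) <= r / 2 -> rn (y - c) <= r.
    move=> yr; have := rnDB y (c + w) c; rewrite (addrC c w) addrK wr.
    by move: yr; rewrite (addrC c w); lra.
  have E : z + w - (c + w) = z - c by rewrite opprD addrACA subrr addr0.
  have := @lipschitz_disk f (c + w) (r / 2) M r2 _ _ (z + w).
  rewrite E => h.
  have -> : 4 * M / r = 2 * M / (r / 2) by field; rewrite gt_eqF.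
  apply: h => //.
  - by move=> y /inD; exact: df.
  - by move=> y /inD; exact: bf.
have dlip z : rn (z - c) <= r / 2 -> rn (cder f z - cder f c) <= 8 * M / r ^+ 2 * rn (z - c).
  move=> zr.
  have [cz ez] : cont01 (fun t => f (z + (r / 2)%:C * ce t) * ((r / 2)%:C * ce t)^-1) /\
     cder f z = mean (fun t => f (z + (r / 2)%:C * ce t) * ((r / 2)%:C * ce t)^-1).
    apply: cder_mean => // y yr; apply: df.
    by have := rnDB y z c; lra.
  have [cc ec] : cont01 (fun t => f (c + (r / 2)%:C * ce t) * ((r / 2)%:C * ce t)^-1) /\
     cder f c = mean (fun t => f (c + (r / 2)%:C * ce t) * ((r / 2)%:C * ce t)^-1).
    apply: cder_mean => // y yr; apply: df; lra.
  have ccN : cont01 (fun t => -1 * (f (c + (r / 2)%:C * ce t) * ((r / 2)%:C * ce t)^-1)).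
    by move=> t ht; exact: (contMl _ (cc t ht)).
  have -> : cder f z - cder f c = mean (fun t =>
      f (z + (r / 2)%:C * ce t) * ((r / 2)%:C * ce t)^-1 +
      -1 * (f (c + (r / 2)%:C * ce t) * ((r / 2)%:C * ce t)^-1)).
    by rewrite (meanD cz ccN) (meanZ _ cc) -ez -ec mulN1r.
  apply: mean_rn_le => [t ht|t _]; first exact: (contD (cz t ht) (ccN t ht)).
  rewrite mulN1r -mulrBl rnM rnV (rn_circle _ (ltW r2)).
  have -> : 8 * M / r ^+ 2 * rn (z - c) = 4 * M / r * rn (z - c) * (r / 2)^-1.
    by field; rewrite gt_eqF.
  by rewrite ler_pM2r ?invr_gt0 // lip // rn_circle // ltW.
move=> z zr.
have Et t : c + t%:C * (z - c) - c = t%:C * (z - c) by rewrite addrC addKr.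
have ht t : 0 <= t <= 1 -> rn (c + t%:C * (z - c) - c) <= rn (z - c).
  move=> /andP[t0 t1]; rewrite Et rnM rn_real ger0_norm //.
  by rewrite ler_piMl // rn_ge0.
have := @mean_value_ineq f c (z - c) (cder f c) (8 * M / r ^+ 2 * rn (z - c)).
rewrite (addrC c) subrK [rn _ ^+ 2]expr2 mulrA; apply.
- move=> t /ht h; apply: df; apply: le_trans h _; lra.
- move=> t /ht h; apply: le_trans (dlip _ _) _; first by lra.
  by rewrite ler_wpM2l // divr_ge0 ?mulr_ge0 // ltW.
Qed.

End OneVariable.

(** * Holomorphic functions of several variables *)

Section SeveralVariables.
Context {R : realType}.
Local Notation C := R[i].

Lemma diff_of_linear (U V : normedModType C) (f : U -> V) (x : U) (L : U -> V) (M : R) :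
  linear L -> (forall h, rn (L h) <= M * rn h) ->
  (forall e : R, 0 < e -> exists2 d : R, 0 < d &
    forall h, rn h < d -> rn (f (x + h) - f x - L h) <= e * rn h) ->
  differentiable f x /\ 'd f x = L :> (U -> V).
Proof.
move=> linL; pose Lm := GRing.isLinear.Build C U V *:%R L linL.
pose L' : {linear U -> V} := HB.pack L Lm.
exact: (@diff_of_rn R U V f x L' M).
Qed.

Lemma diff_bounded (U V : normedModType C) (f : U -> V) (x : U) :
  differentiable f x -> exists2 K : R, 0 < K & forall h, rn ('d f x h) <= K * rn h.
Proof.
move=> df; have [k k0 hk] := linear_lipschitz (diff_continuous df).
have kR : k = (complex.Re k)%:C by rewrite RRe_real // gtr0_real.
exists (complex.Re k); first by move: k0; rewrite kR ltcR.
by move=> h; have := hk h; rewrite kR !rnE -rmorphM lecR.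
Qed.

Lemma diff_lipschitz (U V : normedModType C) (f : U -> V) (x : U) :
  differentiable f x -> exists K d : R, [/\ 0 < K, 0 < d &
    forall y, rn (y - x) < d -> rn (f y - f x) <= K * rn (y - x)].
Proof.
move=> df; have [K K0 hK] := diff_bounded df.
have [d d0 hd] := diff_rnP df ltr01.
exists (K + 1), d; split=> //; first by rewrite addr_gt0.
move=> y yd; have := hd _ yd; rewrite (addrC x) subrK.
have := hK (y - x); have := rnD (f y - f x - 'd f x (y - x)) ('d f x (y - x)).
rewrite subrK; lra.
Qed.

Variable U : normedModType C.
Implicit Types (f g : U -> C) (x v : U).

Lemma line_diff f x v (z : C) : differentiable f (x + z *: v) ->
  differentiable (fun z : C => f (x + z *: v)) z /\
  cder (fun z : C => f (x + z *: v)) z = 'd f (x + z *: v) v.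
Proof.
move=> df; apply: diff_of_mul => e e0.
have v1 : 0 < rn v + 1 by rewrite ltr_wpDl ?rn_ge0.
have [d d0 hd] := diff_rnP df (divr_gt0 e0 v1).
exists (d / (rn v + 1)); first by rewrite divr_gt0.
move=> h; rewrite ltr_pdivlMr // => hh.
have := hd (h *: v); rewrite rnZ linearZ /= => hv.
have -> : 'd f (x + z *: v) v * h = h *: 'd f (x + z *: v) v by exact: mulrC.
rewrite scalerDl addrA; apply: le_trans (hv _) _.
  apply: le_lt_trans hh; rewrite ler_wpM2l ?rn_ge0 // lerDl //.
rewrite mulrCA [e * _]mulrC ler_wpM2l ?rn_ge0 //.
by rewrite mulrAC ler_pdivrMr // ler_pM2l // lerDl.
Qed.

Section Bounded.
Variables (f : U -> C) (x : U) (r M : R).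
Hypotheses (r0 : 0 < r).
Hypothesis df : forall y, rn (y - x) < r -> differentiable f y.
Hypothesis bf : forall y, rn (y - x) < r -> rn (f y) <= M.

Lemma line_in (h : U) (z : C) : h != 0 -> rn (z - 0) <= r / (2 * rn h) ->
  rn (x + z *: h - x) < r.
Proof.
move=> h0; rewrite subr0 addrC addKr rnZ => hz.
have h1 : 0 < rn h by rewrite rn_gt0.
apply: le_lt_trans (ler_wpM2r (ltW h1) hz) _.
have -> : r / (2 * rn h) * rn h = r / 2 by field; rewrite gt_eqF.
by rewrite ltr_pdivrMr // ltr_pMr // ltr1n.
Qed.

Let M0 : 0 <= M.
Proof. by apply: le_trans (rn_ge0 (f x)) (bf _); rewrite subrr rn0. Qed.

Lemma line_bounded (h : U) : h != 0 -> let g := fun z : C => f (x + z *: h) in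
  (forall z, rn (z - 0) <= r / (2 * rn h) -> differentiable g z) /\
  (forall z, rn (z - 0) <= r / (2 * rn h) -> rn (g z) <= M).
Proof.
move=> h0 g; split=> z /(line_in h0) hz; last exact: bf.
by have [] := line_diff (df hz).
Qed.

Lemma radius_gt0 (h : U) : h != 0 -> 0 < r / (2 * rn h).
Proof. by move=> h0; rewrite divr_gt0 // mulr_gt0 // rn_gt0. Qed.

(** [quadratic_remainder] at z = 1 on the disk of radius [r / (2 * rn h)] in the line along [h]. The
    bound depends on [f] only through [M], so that it holds uniformly under a mean. *)
Lemma remainder_bound (h : U) : rn h <= r / 4 ->
  rn (f (x + h) - f x - 'd f x h) <= 32 * M / r ^+ 2 * rn h ^+ 2.
Proof.
have r1 := r0; move=> hr; have [->|h0] := eqVneq h 0.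
  by rewrite addr0 linear0 subr0 subrr !rn0 expr0n /= mulr0.
have [dg bg] := line_bounded h0.
have h1 : 0 < rn h by rewrite rn_gt0.
have := quadratic_remainder (radius_gt0 h0) dg bg (z := 1).
rewrite !subr0 rn1 scale1r scale0r addr0 expr1n !mulr1.
have dx : differentiable f (x + 0 *: h) by apply: df; rewrite scale0r addr0 subrr rn0.
have [_ ->] := line_diff dx; rewrite scale0r addr0 => q.
apply: le_trans (q _) _.
  rewrite ler_pdivlMr // ler_pdivlMr ?mulr_gt0 //; lra.
rewrite le_eqVlt; apply/orP; left; apply/eqP; field.
by rewrite !gt_eqF.
Qed.

Lemma lipschitz_bound (h : U) : rn h <= r / 2 ->
  rn (f (x + h) - f x) <= 4 * M / r * rn h.
Proof.
have r1 := r0; move=> hr; have [->|h0] := eqVneq h 0.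
  by rewrite addr0 subrr !rn0 mulr0.
have [dg bg] := line_bounded h0.
have h1 : 0 < rn h by rewrite rn_gt0.
have := lipschitz_disk (radius_gt0 h0) dg bg (z := 1).
rewrite !subr0 rn1 scale1r scale0r addr0 !mulr1 => q.
apply: le_trans (q _) _.
  rewrite ler_pdivlMr ?mulr_gt0 //; lra.
rewrite le_eqVlt; apply/orP; left; apply/eqP; field.
by rewrite !gt_eqF.
Qed.

Lemma derivative_bound (h : U) : rn ('d f x h) <= 2 * M / r * rn h.
Proof.
have [->|h0] := eqVneq h 0.
  by rewrite linear0 !rn0 mulr0.
have [dg bg] := line_bounded h0.
have h1 : 0 < rn h by rewrite rn_gt0.
have rho := radius_gt0 h0.
have dx : differentiable f (x + 0 *: h) by apply: df; rewrite scale0r addr0 subrr rn0.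
have [_ E] := line_diff dx; rewrite -[X in 'd f X](addr0 x) -(scale0r h) -E.
have [cm ->] := cder_mean rho dg.
apply: mean_rn_le => // t _; rewrite rnM rnV (rn_circle _ (ltW rho)).
have -> : 2 * M / r * rn h = M * (r / (2 * rn h))^-1.
  by field; rewrite !gt_eqF.
rewrite ler_pM2r ?invr_gt0 //; apply: bg.
by rewrite add0r subr0 (rn_circle _ (ltW rho)).
Qed.

End Bounded.

Lemma unif_continuous_limit (phi : R -> C) :
  (forall e : R, 0 < e -> exists psi : R -> C, (forall t, {for t, continuous psi}) /\
     forall t, rn (phi t - psi t) <= e) ->
  forall t, {for t, continuous phi}.
Proof.
move=> h t; apply/contR_rnP => e e0; have e4 : 0 < e / 4 by rewrite divr_gt0.
have [psi [cpsi hpsi]] := h _ e4.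
have [d d0 hd] := (contR_rnP _ _).1 (cpsi t) _ e4.
exists d => // y /hd h1; have h2 := hpsi y; have h3 := hpsi t.
have := rnDB (phi y) (psi y) (phi t); have := rnDB (psi y) (psi t) (phi t).
rewrite (rnBC (psi t)); lra.
Qed.

(* Phi is required to be continuous in the parameter on the whole line since
   cont01 asks for two-sided continuity at the end points. *)
Lemma mean_differentiable (Phi : U -> R -> C) x (r M : R) : 0 < r ->
  (forall y t, rn (y - x) < r -> differentiable (fun y => Phi y t) y) ->
  (forall y t, rn (y - x) < r -> rn (Phi y t) <= M) ->
  (forall y t, rn (y - x) < r -> {for t, continuous (Phi y)}) ->
  differentiable (fun y => mean (Phi y)) x.
Proof.
move=> r0 dP bP cP.
have xx : rn (x - x) < r by rewrite subrr rn0.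
have M0 : 0 <= M by apply: le_trans (rn_ge0 (Phi x 0)) (bP _ _ xx).
pose d t h : C := 'd (fun y => Phi y t) x h.
pose K := 32 * M / r ^+ 2.
have K0 : 0 <= K by rewrite divr_ge0 ?mulr_ge0 // ltW.
have rem t h : rn h <= r / 4 -> rn (Phi (x + h) t - Phi x t - d t h) <= K * rn h ^+ 2.
  move=> hr; exact: (remainder_bound r0 (fun y => dP y t) (fun y => bP y t) hr).
(* The derivative along [h] is a limit of difference quotients, uniformly in t by [rem], and so
   inherits their continuity in t. *)
have cd h t : {for t, continuous (fun t => d t h)}.
  apply: unif_continuous_limit => e e0.
  pose A := K * rn h ^+ 2.
  have A0 : 0 <= A by rewrite mulr_ge0 // sqr_ge0.
  have [s [s0 s1 s2]] : exists s, [/\ 0 < s, s * rn h <= r / 4 & s * A <= e].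
    have h1 : 0 < rn h + 1 by rewrite ltr_wpDl ?rn_ge0.
    have A1 : 0 < A + 1 by rewrite ltr_wpDl.
    pose a := r / 4 / (rn h + 1); pose b := e / (A + 1).
    have a0 : 0 < a by rewrite !divr_gt0.
    have b0 : 0 < b by rewrite divr_gt0.
    exists (Num.min a b); split; first by rewrite lt_min a0.
      apply: (@le_trans _ _ (a * rn h)); first by rewrite ler_wpM2r ?rn_ge0 // ge_min lexx.
      by rewrite /a mulrAC ler_pdivrMr // ler_pM2l ?lerDl // divr_gt0.
    apply: (@le_trans _ _ (b * A)); first by rewrite ler_wpM2r // ge_min lexx orbT.
    by rewrite /b mulrAC ler_pdivrMr // ler_pM2l ?lerDl.
  have sC : s%:C != 0 :> C by rewrite -rn_gt0 rn_real gtr0_norm.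
  have rsh : rn (s%:C *: h) = s * rn h by rewrite rnZ rn_real gtr0_norm.
  exists (fun t => s%:C^-1 * (Phi (x + s%:C *: h) t - Phi x t)); split.
    move=> u; apply: contMl; refine (contB (cP _ u _) (cP x u xx)).
    by rewrite addrC addKr rsh; lra.
  move=> u; have := rem u (s%:C *: h); rewrite rsh => /(_ s1).
  rewrite /d linearZ /=.
  set D := 'd _ _ _; set w := _ - Phi x u => hr.
  have -> : D - s%:C^-1 * w = - (s%:C^-1 * (w - s%:C * D)) by field.
  rewrite rnN rnM rnV rn_real gtr0_norm // mulrC ler_pdivrMr //.
  apply: le_trans hr _; rewrite exprMn.
  have -> : K * (s ^+ 2 * rn h ^+ 2) = (s * A) * s by rewrite /A; ring.
  by rewrite ler_wpM2r // ltW.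
have cd01 h : cont01 (fun t => d t h) by move=> t _; exact: cd.
have cP01 y : rn (y - x) < r -> cont01 (Phi y) by move=> yr t _; exact: cP.
suff [] : differentiable (fun y => mean (Phi y)) x /\
    'd (fun y => mean (Phi y)) x = (fun h => mean (fun t => d t h)) :> (U -> C) by [].
apply: (@diff_of_linear _ _ _ _ _ (2 * M / r)).
- move=> a h k.
  have ca : cont01 (fun t => a * d t h) by move=> t ht; exact: (contMl _ (cd01 h t ht)).
  transitivity (a * mean (fun t => d t h) + mean (fun t => d t k)); last by [].
  rewrite -(meanZ a (cd01 h)) -(meanD ca (cd01 k)).
  by apply: mean_eq => t _; rewrite /d linearP.
- move=> h; apply: mean_rn_le => // t _.
  exact: (derivative_bound r0 (fun y => dP y t) (fun y => bP y t)).
- move=> e e0; have K1 : 0 < K + 1 by rewrite ltr_wpDl.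
  exists (Num.min (r / 4) (e / (K + 1))); first by rewrite lt_min !divr_gt0.
  move=> h; rewrite lt_min => /andP[h1 h2].
  have xh : rn (x + h - x) < r by rewrite addrC addKr; lra.
  have cN : cont01 (fun t => -1 * Phi x t) by move=> t ht; exact: (contMl _ (cP01 x xx t ht)).
  have cN2 : cont01 (fun t => -1 * d t h) by move=> t ht; exact: (contMl _ (cd01 h t ht)).
  have cS : cont01 (fun t => Phi (x + h) t + -1 * Phi x t).
    by move=> t ht; exact: (contD (cP01 _ xh t ht) (cN t ht)).
  have -> : mean (Phi (x + h)) - mean (Phi x) - mean (fun t => d t h) =
      mean (fun t => (Phi (x + h) t + -1 * Phi x t) + -1 * d t h).
    rewrite (meanD cS cN2) (meanD (cP01 _ xh) cN) (meanZ _ (cP01 x xx)) (meanZ _ (cd01 h)).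
    by rewrite !mulN1r.
  apply: mean_rn_le => [t ht|t _]; first exact: (contD (cS t ht) (cN2 t ht)).
  rewrite !mulN1r; apply: le_trans (rem t h (ltW h1)) _.
  rewrite expr2 mulrA ler_wpM2r ?rn_ge0 //.
  move: h2; rewrite ltr_pdivlMr // => h2; have := rn_ge0 h.
  by rewrite mulrC; lra.
Qed.

Lemma locally_bounded f x : {for x, continuous f} ->
  exists2 d : R, 0 < d & forall y, rn (y - x) < d -> rn (f y) <= rn (f x) + 1.
Proof.
move=> /cont_rnP /(_ 1 ltr01) [d d0 hd]; exists d => // y /hd.
by have := rn_lbB (f y) (f x); lra.
Qed.

(** By Cauchy's formula on lines along [v], the directional derivative is a circle mean of
    translates of [f], and a mean may be differentiated in its parameter. Hence derivatives of
    holomorphic functions are again holomorphic. *)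
Lemma dir_differentiable f x v (r : R) : 0 < r ->
  (forall y, rn (y - x) < r -> differentiable f y) ->
  differentiable (fun y => 'd f y v) x.
Proof.
move=> r0 df.
have [d d0 bd] : exists2 d : R, 0 < d & forall y, rn (y - x) < d -> rn (f y) <= rn (f x) + 1.
  by apply/locally_bounded/df_cont/df; rewrite subrr rn0.
pose s := Num.min r d.
have s0 : 0 < s by rewrite lt_min r0.
have dfs y : rn (y - x) < s -> differentiable f y.
  by rewrite lt_min => /andP[? _]; exact: df.
have bfs y : rn (y - x) < s -> rn (f y) <= rn (f x) + 1.
  by rewrite lt_min => /andP[_]; exact: bd.
move: s s0 dfs bfs => s s0 dfs bfs {df bd d0 d r r0}.
pose rho := s / 2 / (rn v + 1).
have v1 : 0 < rn v + 1 by rewrite ltr_wpDl ?rn_ge0.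
have rho0 : 0 < rho by rewrite !divr_gt0.
have rv : rho * rn v <= s / 2.
  by rewrite /rho mulrAC ler_pdivrMr // ler_pM2l ?lerDl // divr_gt0.
have s2 : 0 < s / 2 by rewrite divr_gt0.
pose Phi y t : C := f (y + (rho%:C * ce t) *: v) * (rho%:C * ce t)^-1.
have inS (y : U) (z : C) : rn (y - x) < s / 2 -> rn z <= rho -> rn (y + z *: v - x) < s.
  move=> ys zr; rewrite addrAC; apply: le_lt_trans (rnD _ _) _; rewrite rnZ.
  by have := ler_wpM2r (rn_ge0 v) zr; lra.
have rc t : rn (rho%:C * ce t : C) <= rho by rewrite rn_circle // ltW.
have dPhi : differentiable (fun y => mean (Phi y)) x.
  apply: (@mean_differentiable Phi x (s / 2) ((rn (f x) + 1) / rho)) => //.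
  - move=> y t ys; refine (dfM _ (df_cst _ _)).
    refine (@df_comp _ _ _ _ (fun y => y + (rho%:C * ce t) *: v) f y _ (dfs _ (inS _ _ ys (rc t)))).
    exact: (dfD (df_id _) (df_cst _ _)).
  - move=> y t ys; rewrite rnM rnV (rn_circle _ (ltW rho0)) ler_pM2r ?invr_gt0 //.
    exact/bfs/inS.
  - move=> y t ys; refine (@contM _ _ _ (fun t => (rho%:C * ce t)^-1) _ _ _).
      by apply: circle_continuous; apply/df_cont/dfs/inS.
    exact: (@contV R _ (fun t => rho%:C * ce t) t (circle_neq0 t rho0) (contMl _ (@ce_continuous R t))).
have [] // := @diff_near R U C _ (fun y => 'd f y v) x _ s2 _ dPhi.
move=> y ys.
have dl (z : C) : rn (z - 0) <= rho -> differentiable (fun z : C => f (y + z *: v)) z.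
  by rewrite subr0 => hz; have [] := line_diff (dfs _ (inS _ _ ys hz)).
have dy : differentiable f (y + 0 *: v).
  by apply/dfs/inS => //; rewrite rn0 ltW.
have [_ E] := line_diff dy; rewrite -[X in 'd f X](addr0 y) -(scale0r v) -E.
have [_ ->] := cder_mean rho0 dl.
by apply: mean_eq => t _; rewrite /Phi add0r.
Qed.

End SeveralVariables.

Section Power.
Context {R : realType}.

Lemma dfX (U : normedModType R[i]) (f : U -> R[i]) n x :
  differentiable f x -> differentiable (fun y => f y ^+ n) x.
Proof.
move=> df; elim: n => [|n IH]; first exact: (df_cst (1 : R[i]) x).
have -> : (fun y => f y ^+ n.+1) = (fun y => f y * f y ^+ n).
  by apply/funext => y; rewrite exprS.
exact: dfM df IH.
Qed.

End Power.
Arguments dfX {R U f} n {x}.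

(** * Zeros of holomorphic functions of one variable *)

Section Zeros.
Context {R : realType}.
Local Notation C := R[i].
Implicit Types (f g : C -> C) (c z : C) (r : R).

Lemma rn_continuous (U : normedModType C) (v : U) : {for v, continuous (fun w : U => rn w)}.
Proof.
apply/contCR_rnP => d d0; exists d => // w.
apply: le_lt_trans; rewrite ler_norml rn_lbB andbT.
by have := rn_lbB v w; rewrite (rnBC v w); lra.
Qed.

Lemma bounded_cdisk f c r : 0 <= r -> (forall z, rn (z - c) <= r -> {for z, continuous f}) ->
  exists2 M : R, 0 <= M & forall z, rn (z - c) <= r -> rn (f z) <= M.
Proof.
move=> r0 cf; pose A := [set z : C | rn (z - c) <= r].
have cu : {within A, continuous (fun z => rn (f z))}.
  apply: continuous_in_subspaceT => y /set_mem yA.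
  exact: (@continuous_comp _ _ _ f (fun w : C => rn w) y (cf y yA) (@rn_continuous _ _)).
have [|y _ hy] := compact_EVT_max _ (@compact_cdisk R c r) cu.
  by exists c; rewrite /= subrr rn0.
by exists (rn (f y)); [exact: rn_ge0 | move=> z zr; apply: hy; exact: mem_set].
Qed.

Lemma geometric_le0 (a M x : R) : 0 <= x < 1 -> (forall k, a <= M * x ^+ k) -> a <= 0.
Proof.
move=> /andP[x0 x1] h; rewrite leNgt; apply/negP => a0.
have M0 : 0 < M by have := h 0%N; rewrite expr0 mulr1; exact: lt_le_trans.
have /cvgrPdist_lt /(_ (a / M) (divr_gt0 a0 M0)) [N _ /(_ N (leqnn _))] :
  (fun k => x ^+ k) @ \oo --> (0 : R) by apply: cvg_expr; rewrite ger0_norm.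
rewrite sub0r normrN ger0_norm ?exprn_ge0 // ltr_pdivlMr // => hN.
by have := h N; rewrite mulrC leNgt hN.
Qed.

(** The maximum principle for [f y / (y - c) ^ k] gives [rn (f z) <= M * (rn (z - c) / r) ^ k] for
    every k, and the ratio is below 1. No power series is involved. *)
Lemma vanish_of_flat f c r : 0 < r ->
  (forall z, rn (z - c) <= r -> differentiable f z) ->
  (forall k, exists K d : R, 0 < d /\ forall z, rn (z - c) < d -> rn (f z) <= K * rn (z - c) ^+ k) ->
  forall z, rn (z - c) < r -> f z = 0.
Proof.
move=> r0 df flat z zr.
have [M M0 hM] : exists2 M : R, 0 <= M & forall z, rn (z - c) <= r -> rn (f z) <= M.
  by apply: bounded_cdisk; [exact: ltW | move=> y yr; exact/df_cont/df].
have fc : f c = 0.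
  have [K [d [d0 hd]]] := flat 1%N; have := hd c.
  rewrite subrr rn0 expr0n /= mulr0 => /(_ d0) h.
  by apply/eqP; rewrite -rn_eq0 eq_le h rn_ge0.
have [->//|zc] := eqVneq z c.
have zc0 : 0 < rn (z - c) by rewrite rn_gt0 subr_eq0.
apply/eqP; rewrite -rn_eq0 eq_le rn_ge0 andbT.
apply: (@geometric_le0 _ M (rn (z - c) / r)).
  by rewrite divr_ge0 ?rn_ge0 ?(ltW r0) //= ltr_pdivrMr // mul1r.
case=> [|k]; first by rewrite expr0 mulr1 hM // ltW.
pose q y : C := f y * ((y - c) ^+ k.+1)^-1.
have qc : q c = 0 by rewrite /q fc mul0r.
have dq y : rn (y - c) <= r -> y != c -> differentiable q y.
  move=> yr yc; refine (dfM (df _ yr) _).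
  refine (@dfV _ _ (fun y => (y - c) ^+ k.+1) y _ _).
    by rewrite expf_neq0 // subr_eq0.
  exact: (dfX k.+1 (dfB (df_id _) (df_cst _ _))).
have cq y : rn (y - c) <= r -> {for y, continuous q}.
  move=> yr; have [->|yc] := eqVneq y c; last by apply/df_cont/dq.
  (* One order more than the exponent of the denominator makes the quotient tend to its value 0 at
     [c]. *)
  have [K [d [d0 hd]]] := flat k.+2.
  apply/cont_rnP => e e0; have K1 : 0 < `|K| + 1 by rewrite ltr_wpDl.
  exists (Num.min d (e / (`|K| + 1))); first by rewrite lt_min d0 divr_gt0.
  move=> w; rewrite lt_min => /andP[w1 w2]; rewrite qc subr0.
  have [->|wc] := eqVneq w c; first by rewrite qc rn0.
  have wc0 : 0 < rn (w - c) by rewrite rn_gt0 subr_eq0.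
  rewrite /q rnM rnV rnX ltr_pdivrMr ?exprn_gt0 //.
  apply: le_lt_trans (hd _ w1) _; rewrite exprSr mulrA mulrAC ltr_pM2r ?exprn_gt0 //.
  move: w2; rewrite ltr_pdivlMr // mulrC; apply: le_lt_trans.
  by rewrite ler_wpM2r ?rn_ge0 // (le_trans (ler_norm _)) // lerDl.
have : rn (q z) <= M / r ^+ k.+1.
  apply: (@max_principle _ q c r) => //; last exact: ltW.
  - by rewrite divr_ge0 // exprn_ge0 // ltW.
  - move=> y yr; have [->|yc] := eqVneq y c.
      exists r; first by rewrite subrr rn0 subr0 r0 lexx.
      apply: mean_value => //; first by apply: cq; rewrite subrr rn0 ltW.
      by move=> w wc wr; exact: dq.
    have yc0 : 0 < rn (y - c) by rewrite rn_gt0 subr_eq0.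
    have [s [s0 s1 s2]] : exists s, [/\ 0 < s, s <= r - rn (y - c) & s < rn (y - c)].
      exists (Num.min (r - rn (y - c)) (rn (y - c) / 2)).
      rewrite lt_min subr_gt0 yr divr_gt0 // ge_min lexx /=; split => //.
      by rewrite gt_min; apply/orP; right; lra.
    exists s; first by rewrite s0 s1.
    apply: mean_value => //; first by apply: cq; exact: ltW.
    move=> w _ wy; apply: dq.
      by have := rnDB w y c; lra.
    by apply: contraTneq wy => ->; rewrite -ltNge rnBC.
  - move=> y yr; rewrite /q rnM rnV rnX yr ler_pM2r ?invr_gt0 ?exprn_gt0 //.
    by apply: hM; rewrite yr.
rewrite /q rnM rnV rnX ler_pdivrMr ?exprn_gt0 // => h; apply: le_trans h _.
by rewrite expr_div_n mulrAC -!mulrA.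
Qed.

Lemma identity_disk f c r (d : R) : 0 < r -> 0 < d ->
  (forall z, rn (z - c) <= r -> differentiable f z) ->
  (forall z, rn (z - c) < d -> f z = 0) ->
  forall z, rn (z - c) < r -> f z = 0.
Proof.
move=> r0 d0 df f0; apply: vanish_of_flat => // k; exists 0, d; split => // z /f0 ->.
by rewrite rn0 mul0r.
Qed.

Lemma cder_differentiable f c r : 0 < r ->
  (forall z, rn (z - c) < r -> differentiable f z) -> differentiable (cder f) c.
Proof. by move=> r0 df; exact: (@dir_differentiable R C f c 1 r). Qed.

Lemma iter_cder_differentiable f c r k :
  (forall z, rn (z - c) < r -> differentiable f z) ->
  forall z, rn (z - c) < r -> differentiable (iter k cder f) z.
Proof.
move=> df; elim: k => [//|k IH] z zr /=.
apply: (@cder_differentiable _ _ (r - rn (z - c))); first by rewrite subr_gt0.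
by move=> y yz; apply: IH; have := rnDB y z c; lra.
Qed.

(** By induction on k, if the derivative is of order k at [c], then the mean value inequality makes
    [f] of order k + 1; so [f] is flat at [c]. *)
Lemma vanish_of_derivatives f c r : 0 < r ->
  (forall z, rn (z - c) < r -> differentiable f z) ->
  (forall k, iter k cder f c = 0) ->
  forall z, rn (z - c) < r -> f z = 0.
Proof.
move=> r0 df f0 z zr.
have [s /andP[s1 s2]] : exists s, rn (z - c) < s < r.
  by exists ((rn (z - c) + r) / 2); have := rn_ge0 (z - c); lra.
have s0 : 0 < s := le_lt_trans (rn_ge0 _) s1.
apply: (@vanish_of_flat f c s) => // [y ys|k]; first by apply: df; exact: le_lt_trans s2.
elim: k f df f0 {z zr s s1 s2 s0} => [|k IH] f df f0.
  have [d d0 hd] : exists2 d : R, 0 < d & forall y, rn (y - c) < d -> rn (f y) <= rn (f c) + 1.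
    by apply/locally_bounded/df_cont/df; rewrite subrr rn0.
  by exists (rn (f c) + 1), d; split => // y /hd; rewrite expr0 mulr1.
have [|j|K [d [d0 hd]]] := IH (cder f).
- exact: (@iter_cder_differentiable f c r 1).
- by have := f0 j.+1; rewrite iterSr.
exists `|K|, (Num.min d r); split; first by rewrite lt_min d0.
move=> y; rewrite lt_min => /andP[yd yr].
have Et (t : R) : c + t%:C * (y - c) - c = t%:C * (y - c) by rewrite addrC addKr.
have ht (t : R) : 0 <= t <= 1 -> rn (c + t%:C * (y - c) - c) <= rn (y - c).
  move=> /andP[t0 t1]; rewrite Et rnM rn_real ger0_norm //.
  by rewrite ler_piMl // rn_ge0.
have := @mean_value_ineq R f c (y - c) 0 (`|K| * rn (y - c) ^+ k).
have fc : f c = 0 := f0 0%N.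
rewrite (addrC c) subrK fc subr0 mul0r subr0 exprSr mulrA; apply.
- by move=> t /ht h; apply: df; apply: le_lt_trans h _.
- move=> t /ht h; rewrite subr0; apply: le_trans (hd _ (le_lt_trans h yd)) _.
  have le1 : rn (c + t%:C * (y - c) - c) ^+ k <= rn (y - c) ^+ k.
    by apply: lerXn2r; rewrite ?nnegrE ?rn_ge0.
  apply: le_trans (ler_wpM2l (normr_ge0 K) le1).
  by rewrite ler_wpM2r ?exprn_ge0 ?rn_ge0 // ler_norm.
Qed.

Lemma circle_min f c r : 0 < r ->
  (forall z, rn (z - c) = r -> {for z, continuous f} /\ f z != 0) ->
  exists2 m : R, 0 < m & forall z, rn (z - c) = r -> m <= rn (f z).
Proof.
move=> r0 hf.
pose A := [set z : C | rn (z - c) <= r] `&` [set z | r <= rn (z - c)].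
have AE z : A z -> rn (z - c) = r.
  by move=> [/= h1 h2]; apply/eqP; rewrite eq_le h1.
have cA : compact A.
  apply: compact_closedI; first exact: compact_cdisk.
  rewrite -(setCK [set z : C | _]); apply: open_closedC.
  apply/open_rnP => z /= /negP; rewrite -ltNge => hz.
  exists (r - rn (z - c)); first by rewrite subr_gt0.
  move=> y hy; apply/negP; rewrite -ltNge.
  have := rnDB y z c; lra.
have cu : {within A, continuous (fun z => rn (f z))}.
  apply: continuous_in_subspaceT => y /set_mem /AE /hf [cy _].
  exact: (@continuous_comp _ _ _ f (fun w : C => rn w) y cy (@rn_continuous _ _)).
have [|y /set_mem /AE yA hy] := compact_EVT_min _ cA cu.
  exists (c + r%:C); rewrite /A /= addrC addKr rn_real gtr0_norm //.
exists (rn (f y)); first by rewrite rn_gt0; have [] := hf _ yA.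
by move=> z zr; apply/hy/mem_set; split; rewrite /= zr.
Qed.

(** Without a zero, [1 / f] would be larger at the center than its bound on the circle, against the
    maximum principle. This does the work of Rouché's theorem. *)
Lemma zero_in_disk f c r (m : R) : 0 < r ->
  (forall z, rn (z - c) <= r -> differentiable f z) ->
  (forall z, rn (z - c) = r -> m <= rn (f z)) -> rn (f c) < m ->
  exists2 z, rn (z - c) < r & f z = 0.
Proof.
move=> r0 df fm fcm; apply: contrapT => nz.
have m0 : 0 < m := le_lt_trans (rn_ge0 _) fcm.
have nz1 z : rn (z - c) <= r -> f z != 0.
  rewrite le_eqVlt => /orP[/eqP/fm h|zr]; first by rewrite -rn_gt0 (lt_le_trans m0 h).
  by apply/eqP => fz; apply: nz; exists z.
have cc : rn (c - c) <= r by rewrite subrr rn0 ltW.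
have fc0 : 0 < rn (f c) by rewrite rn_gt0; exact: nz1.
have dg z : rn (z - c) <= r -> differentiable (fun z => (f z)^-1) z.
  by move=> zr; exact: (dfV (nz1 _ zr) (df _ zr)).
have : rn (f c)^-1 <= m^-1.
  apply: (@max_principle R (fun z => (f z)^-1) c r) => //.
  - by rewrite invr_ge0 ltW.
  - by move=> z /dg/df_cont.
  - move=> z zr; exists (r - rn (z - c)); first by rewrite subr_gt0 zr lexx.
    have dz y : rn (y - z) <= r - rn (z - c) -> differentiable (fun z => (f z)^-1) y.
      by move=> yz; apply: dg; have := rnDB y z c; lra.
    apply: mean_value; first by rewrite subr_gt0.
      by apply/df_cont/dg/ltW.
    by move=> y _; exact: dz.
  - by move=> z /fm h; rewrite rnV lef_pV2 ?posrE // (lt_le_trans m0).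
by rewrite rnV lef_pV2 ?posrE // leNgt fcm.
Qed.

End Zeros.

(** * The implicit function theorem for one scalar equation *)

Section Implicit.
Context {R : realType}.
Local Notation C := R[i].
Variable U : normedModType C.

(** On each line along [v] near [p], [g] is close to a linear function of slope [c]: [zero_in_disk]
    provides a zero and the lower bound on increments makes it unique. Letting [psi] depend on all
    of [U], and not on a complement of [v], avoids a choice of coordinates. *)
Lemma implicit_function (g : U -> C) (p v : U) (r e : R) : 0 < r -> 0 < e ->
  (forall y, rn (y - p) < r -> differentiable g y) ->
  g p = 0 -> 'd g p v != 0 ->
  exists (rho s : R) (psi : U -> C),
   [/\ 0 < rho < e, 0 < s < e,
      forall z, rn (z - p) < rho ->
        [/\ rn (psi z) < s, g (z + psi z *: v) = 0 & differentiable psi z] &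
      forall z (zeta : C), rn (z - p) < rho -> rn zeta < s -> g (z + zeta *: v) = 0 -> zeta = psi z].
Proof.
move=> r0 e0 dg gp dp; set c := 'd g p v in dp.
have c0 : 0 < rn c by rewrite rn_gt0.
have v0 : v != 0 by apply: contra_neq dp => v0; rewrite /c v0 linear0.
have vn : 0 < rn v by rewrite rn_gt0.
have [eta [eta0 eta_r heta]] : exists eta : R, [/\ 0 < eta, eta < r &
    forall y, rn (y - p) < eta -> rn ('d g y v - c) <= rn c / 2].
  have /df_cont/cont_rnP h := dir_differentiable v r0 dg.
  have [d d0 hd] := h _ (divr_gt0 c0 (ltr0Sn _ 1)).
  exists (Num.min d (r / 2)); split.
  - by rewrite lt_min d0 divr_gt0.
  - by rewrite gt_min; apply/orP; right; lra.
  - by move=> y; rewrite lt_min => /andP[/hd /ltW].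
have [s [s0 se sv]] : exists s, [/\ 0 < s, s < e & s * rn v < eta / 2].
  exists (Num.min (e / 2) (eta / 4 / rn v)); split.
  - by rewrite lt_min !divr_gt0.
  - by rewrite gt_min; apply/orP; left; lra.
  - apply: (@le_lt_trans _ _ (eta / 4 / rn v * rn v)).
      by rewrite ler_wpM2r ?rn_ge0 // ge_min lexx orbT.
    by rewrite divfK ?gt_eqF //; lra.
have inB z (zeta : C) : rn (z - p) < eta / 2 -> rn zeta <= s -> rn (z + zeta *: v - p) < eta.
  move=> zp zs; rewrite addrAC; apply: le_lt_trans (rnD _ _) _; rewrite rnZ.
  by have := ler_wpM2r (rn_ge0 v) zs; lra.
have dgB z (zeta : C) : rn (z - p) < eta / 2 -> rn zeta <= s -> differentiable g (z + zeta *: v).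
  by move=> h1 h2; apply: dg; apply: lt_trans (inB _ _ h1 h2) _.
have key z (z1 z2 : C) : rn (z - p) < eta / 2 -> rn z1 <= s -> rn z2 <= s ->
    rn (g (z + z2 *: v) - g (z + z1 *: v) - c * (z2 - z1)) <= rn c / 2 * rn (z2 - z1).
  move=> zp h1 h2.
  have seg (t : R) : 0 <= t <= 1 -> rn (z1 + t%:C * (z2 - z1)) <= s.
    move=> /andP[t0 t1].
    have -> : z1 + t%:C * (z2 - z1) = (1 - t)%:C * z1 + t%:C * z2.
      by rewrite rmorphB rmorph1; ring.
    apply: le_trans (rnD _ _) _; rewrite !rnM !rn_real (ger0_norm t0) ger0_norm ?subr_ge0 //.
    have := ler_wpM2l t0 h2.
    have : 0 <= 1 - t by rewrite subr_ge0.
    by move=> /ler_wpM2l /(_ _ _ h1); lra.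
  have := @mean_value_ineq R (fun w => g (z + w *: v)) z1 (z2 - z1) c (rn c / 2).
  rewrite (addrC z1) subrK; apply => t /seg ht.
    by have [] := line_diff (dgB _ _ zp ht).
  have [_ ->] := line_diff (dgB _ _ zp ht).
  by apply: heta; apply: inB.
(* This expansion bound in the direction [v] yields the existence of the zero, its uniqueness and
   the Lipschitz estimate for [psi]. *)
have lower z (z1 z2 : C) : rn (z - p) < eta / 2 -> rn z1 <= s -> rn z2 <= s ->
    rn c / 2 * rn (z2 - z1) <= rn (g (z + z2 *: v) - g (z + z1 *: v)).
  move=> zp h1 h2; have := key z z1 z2 zp h1 h2.
  rewrite rnBC => h; have := le_trans (rn_lbB _ _) h; rewrite rnM; lra.
have pp : rn (p - p) < r by rewrite subrr rn0.
have m0 : 0 < rn c / 4 * s by rewrite mulr_gt0 // divr_gt0.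
have [d d0 hd] := (cont_rnP _ _).1 (df_cont (dg p pp)) _ m0.
pose rho := Num.min (Num.min d (eta / 2)) (e / 2).
have rho_d : rho <= d by rewrite !ge_min lexx.
have rho_eta : rho <= eta / 2 by rewrite !ge_min lexx orbT.
have rho_e : rho <= e / 2 by rewrite !ge_min lexx orbT.
have rho0 : 0 < rho by rewrite !lt_min d0 !divr_gt0.
move: rho rho_d rho_eta rho_e rho0 => rho rho_d rho_eta rho_e rho0.
have s00 : rn (0 : C) <= s by rewrite rn0 ltW.
have exz z : exists zeta : C, rn (z - p) < rho -> rn zeta < s /\ g (z + zeta *: v) = 0.
  have [zr|] := ltP (rn (z - p)) rho; last by exists 0.
  have zp : rn (z - p) < eta / 2 := lt_le_trans zr rho_eta.
  have gz : rn (g z) < rn c / 4 * s.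
    by have := hd z (lt_le_trans zr rho_d); rewrite gp subr0.
  have hA (w : C) : rn (w - 0) <= s -> differentiable (fun w : C => g (z + w *: v)) w.
    by rewrite subr0 => ws; have [] := line_diff (dgB z w zp ws).
  have hB (w : C) : rn (w - 0) = s -> rn c / 4 * s <= rn (g (z + w *: v)).
    rewrite subr0 => ws; have ws' : rn w <= s by rewrite ws.
    have := lower z 0 w zp s00 ws'; rewrite scale0r addr0 subr0 ws => h.
    have := le_trans h (rnB _ _); lra.
  have hC : rn (g (z + 0 *: v)) < rn c / 4 * s by rewrite scale0r addr0.
  have [zeta] := zero_in_disk s0 hA hB hC.
  by rewrite subr0 => h1 h2; exists zeta.
have [psi hpsi] := choice exz.
have uniq z (zeta : C) : rn (z - p) < rho -> rn zeta < s -> g (z + zeta *: v) = 0 -> zeta = psi z.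
  move=> zr zs gz; have [ps pg] := hpsi z zr.
  have := lower z (psi z) zeta (lt_le_trans zr rho_eta) (ltW ps) (ltW zs).
  rewrite gz pg subrr rn0 => h; apply/eqP; rewrite -subr_eq0 -rn_eq0 eq_le rn_ge0 andbT.
  by move: h; rewrite pmulr_rle0 // divr_gt0.
exists rho, s, psi; split => //.
- by rewrite rho0; lra.
- by rewrite s0.
move=> z1 z1r; have [ps1 pg1] := hpsi z1 z1r; split => //.
have z1p : rn (z1 - p) < eta / 2 := lt_le_trans z1r rho_eta.
pose y1 := z1 + psi z1 *: v.
have dy1 : differentiable g y1 := dgB _ _ z1p (ltW ps1).
pose D := 'd g y1 v.
have D0 : D != 0.
  have := heta _ (inB _ _ z1p (ltW ps1)); rewrite -/y1 -/D => h.
  rewrite -rn_gt0; have := rn_lbB c D; rewrite (rnBC c); lra.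
have [K [d1 [K0 d10 hK]]] := diff_lipschitz dy1.
have [B B0 hB] := diff_bounded dy1.
have lip h : rn h < d1 -> rn (z1 + h - p) < rho -> rn (psi (z1 + h) - psi z1) <= 2 * K / rn c * rn h.
  move=> hd1 hr; have [ps pg] := hpsi _ hr.
  have := lower (z1 + h) (psi z1) (psi (z1 + h)) (lt_le_trans hr rho_eta) (ltW ps1) (ltW ps).
  rewrite pg sub0r rnN.
  have E : z1 + h + psi z1 *: v - y1 = h by rewrite /y1 opprD addrACA subrr addr0 addrC addKr.
  have := hK (z1 + h + psi z1 *: v); rewrite E /y1 pg1 subr0 => /(_ hd1) h1 h2.
  have -> : 2 * K / rn c * rn h = K * rn h / (rn c / 2) by field; rewrite gt_eqF.
  by rewrite ler_pdivlMr ?divr_gt0 // mulrC (le_trans h2).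
(* The formula comes from differentiating [g (z + psi z *: v) = 0]. *)
suff [] : differentiable psi z1 /\ 'd psi z1 = (fun h => - (D^-1 * 'd g y1 h)) :> (U -> C) by [].
apply: (@diff_of_linear R U C psi z1 _ (rn D^-1 * B)).
- move=> a h k; rewrite linearP /= mulrDr opprD.
  by congr (_ + _); rewrite -[a *: 'd g y1 h]/(a * 'd g y1 h) mulrCA -mulrN.
- by move=> h; rewrite rnN rnM -mulrA ler_wpM2l ?rn_ge0.
- move=> e1 e10.
  pose K' := 1 + 2 * K / rn c * rn v.
  have K'0 : 0 < K'.
    by rewrite ltr_pwDl // mulr_ge0 ?rn_ge0 // divr_ge0 ?rn_ge0 // mulr_ge0 // ltW.
  have Dn : 0 < rn D by rewrite rn_gt0.
  pose e2 := e1 * rn D / K'.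
  have e20 : 0 < e2 by rewrite divr_gt0 // mulr_gt0.
  have [d2 d20 hd2] := diff_rnP dy1 e20.
  have [s3 [s30 s31 s32 s33]] : exists s3, [/\ 0 < s3, s3 <= d1, s3 <= rho - rn (z1 - p) & s3 <= d2 / K'].
    exists (Num.min (Num.min d1 (rho - rn (z1 - p))) (d2 / K')); split.
    - by rewrite !lt_min d10 subr_gt0 z1r divr_gt0.
    - by rewrite !ge_min lexx.
    - by rewrite !ge_min lexx orbT.
    - by rewrite !ge_min lexx orbT.
  exists s3 => // h hs.
  have hr : rn (z1 + h - p) < rho.
    by rewrite addrAC; have := rnD (z1 - p) h; lra.
  have [ps pg] := hpsi _ hr.
  have hl := lip h (lt_le_trans hs s31) hr.
  pose dlt := psi (z1 + h) - psi z1.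
  have hw : rn (h + dlt *: v) <= K' * rn h.
    apply: le_trans (rnD _ _) _; rewrite rnZ /K' mulrDl mul1r lerD2l.
    by rewrite mulrAC ler_wpM2r ?rn_ge0.
  have hw2 : rn (h + dlt *: v) < d2.
    apply: le_lt_trans hw _; move: (lt_le_trans hs s33).
    by rewrite ltr_pdivlMr // mulrC.
  have := hd2 _ hw2.
  have -> : y1 + (h + dlt *: v) = z1 + h + psi (z1 + h) *: v.
    by rewrite /y1 addrACA -scalerDl (addrC (psi z1)) subrK.
  rewrite pg /y1 pg1 subrr sub0r rnN linearD linearZ /= -/y1 -/D => hq.
  have -> : psi (z1 + h) - psi z1 - - (D^-1 * 'd g y1 h) = D^-1 * ('d g y1 h + dlt * D).
    by rewrite opprK -/dlt; field.
  rewrite rnM rnV mulrC ler_pdivrMr //; apply: le_trans hq _.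
  apply: le_trans (ler_wpM2l (ltW e20) hw) _.
  by rewrite /e2 mulrA divfK ?gt_eqF // mulrAC.
Qed.

End Implicit.

(** * Differential calculus with row vectors *)

Section RowVectors.
Context {R : realType}.
Local Notation C := R[i].

Lemma rn_coord n (x : 'rV[C]_n) j : rn (x 0 j) <= rn x.
Proof.
rewrite -lecR -!rnE [X in _ <= X]/Num.norm /= mx_normE -[leLHS]nngE num_le.
by have := @le_bigmax _ _ _ (0%:nng : {nonneg C})
  (fun i : 'I_1 * 'I_n => `|x i.1 i.2|%:nng) (0, j).
Qed.

Lemma rn_rV_le n (x : 'rV[C]_n) (B : R) : 0 <= B -> (forall j, rn (x 0 j) <= B) -> rn x <= B.
Proof.
move=> B0 hB; have [/eqP|nz] := eqVneq (mx_norm x) 0.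
  by move=> /eqP /mx_norm_eq0 ->; rewrite rn0.
have [[i j] /= E] := mx_norm_neq0 nz.
have -> : rn x = rn (x i j) by rewrite /rn -E.
by rewrite (ord1 i).
Qed.

Lemma mulmx_bounded n m (A : 'M[C]_(n, m)) :
  exists2 K : R, 0 <= K & forall x : 'rV[C]_n, rn (x *m A) <= K * rn x.
Proof.
exists (\sum_j \sum_i rn (A i j)).
  by apply: sumr_ge0 => j _; apply: sumr_ge0 => i _; exact: rn_ge0.
move=> x; apply: rn_rV_le => [|j].
  rewrite mulr_ge0 ?rn_ge0 //.
  by apply: sumr_ge0 => j _; apply: sumr_ge0 => i _; exact: rn_ge0.
have sum_le (F : 'I_n -> C) : rn (\sum_i F i) <= \sum_i rn (F i).
  elim/big_ind2: _ => [|a b c d h1 h2|//]; first by rewrite rn0.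
  exact: le_trans (rnD _ _) (lerD h1 h2).
rewrite mxE; apply: le_trans (sum_le _) _.
apply: (@le_trans _ _ ((\sum_i rn (A i j)) * rn x)).
  rewrite mulr_suml; apply: ler_sum => i _.
  by rewrite rnM mulrC ler_wpM2l ?rn_ge0 ?rn_coord.
rewrite ler_wpM2r ?rn_ge0 // (bigD1 j) //= lerDl.
by apply: sumr_ge0 => k _; apply: sumr_ge0 => i _; exact: rn_ge0.
Qed.

Lemma mulmx_diff n m (A : 'M[C]_(n, m)) (x : 'rV[C]_n) :
  differentiable (fun y : 'rV[C]_n => y *m A) x /\
  'd (fun y : 'rV[C]_n => y *m A) x = (fun y => y *m A) :> (_ -> _).
Proof.
have [K K0 hK] := mulmx_bounded A.
apply: (@diff_of_linear R _ _ _ x (fun y => y *m A) K) => //.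
- by move=> a u v; rewrite mulmxDl scalemxAl.
- move=> e e0; exists 1 => // h _.
  by rewrite mulmxDl (addrC (x *m A)) addrK subrr rn0 mulr_ge0 ?rn_ge0 // ltW.
Qed.

Lemma coord_diff (U : normedModType C) n (F : U -> 'rV[C]_n) x j : differentiable F x ->
  differentiable (fun y => F y 0 j) x /\
  forall v, 'd (fun y => F y 0 j) x v = ('d F x v) 0 j.
Proof.
move=> dF; have [K K0 hK] := diff_bounded dF.
suff [h1 h2] : differentiable (fun y => F y 0 j) x /\
    'd (fun y => F y 0 j) x = (fun v => ('d F x v) 0 j) :> (U -> C).
  by split => // v; rewrite h2.
apply: (@diff_of_linear R U C _ x _ K).
- by move=> a u v; rewrite linearP !mxE.
- by move=> h; apply: le_trans (rn_coord _ _) (hK h).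
- move=> e e0; have [d d0 hd] := diff_rnP dF e0; exists d => // h hh.
  apply: le_trans (hd h hh).
  by have := rn_coord (F (x + h) - F x - 'd F x h) j; rewrite !mxE.
Qed.

Lemma diff_of_coord (U : normedModType C) n (F : U -> 'rV[C]_n) x :
  (forall j, differentiable (fun y => F y 0 j) x) -> differentiable F x.
Proof.
move=> dF.
pose L (v : U) : 'rV[C]_n := \row_j 'd (fun y => F y 0 j) x v.
have [K K0 hK] : exists2 K : R, 0 <= K & forall h, rn (L h) <= K * rn h.
  have /choice [k hk] : forall j, exists k : R, 0 < k /\
      forall h, rn ('d (fun y => F y 0 j) x h) <= k * rn h.
    by move=> j; have [k k0 hk] := diff_bounded (dF j); exists k.
  exists (\sum_j k j); first by apply: sumr_ge0 => j _; have [/ltW] := hk j.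
  move=> h; apply: rn_rV_le => [|j].
    by rewrite mulr_ge0 ?rn_ge0 //; apply: sumr_ge0 => j _; have [/ltW] := hk j.
  rewrite mxE; apply: le_trans ((hk j).2 h) _; rewrite ler_wpM2r ?rn_ge0 //.
  by rewrite (bigD1 j) //= lerDl; apply: sumr_ge0 => i _; have [/ltW] := hk i.
suff [] : differentiable F x /\ 'd F x = L :> (_ -> _) by [].
apply: (@diff_of_linear R U _ F x L K) => //.
- by move=> a u v; apply/rowP => j; rewrite !mxE linearP.
- move=> e e0.
  have /choice [d hd] : forall j, exists d : R, 0 < d /\ forall h, rn h < d ->
      rn (F (x + h) 0 j - F x 0 j - 'd (fun y => F y 0 j) x h) <= e * rn h.
    by move=> j; have [d d0 hd] := diff_rnP (dF j) e0; exists d.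
  exists (\big[Num.min/1]_j d j).
    by apply: lt_bigmin => // j _; have [] := hd j.
  move=> h hh; apply: rn_rV_le => [|j]; first by rewrite mulr_ge0 ?rn_ge0 // ltW.
  rewrite !mxE; apply: (hd j).2; apply: lt_le_trans hh _.
  exact: bigmin_le_cond.
Qed.

Lemma chain_rule (U V W : normedModType C) (f : U -> V) (g : V -> W) x :
  differentiable f x -> differentiable g (f x) ->
  forall v, 'd (fun y => g (f y)) x v = 'd g (f x) ('d f x v).
Proof. by move=> df dg v; have /(congr1 (fun h => h v)) := diff_comp df dg. Qed.

Lemma constant_on_ball (U : normedModType C) n (F : U -> 'rV[C]_n) x (r : R) :
  (forall y, rn (y - x) < r -> differentiable F y /\ forall v, 'd F y v = 0) ->
  forall y, rn (y - x) < r -> F y = F x.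
Proof.
move=> hF y yr; apply/rowP => j.
have seg (t : R) : 0 <= t <= 1 -> rn (x + t%:C *: (y - x) - x) < r.
  move=> /andP[t0 t1]; rewrite addrC addKr rnZ rn_real ger0_norm //.
  by apply: le_lt_trans yr; rewrite ler_piMl ?rn_ge0.
have := @mean_value_ineq R (fun w : C => F (x + w *: (y - x)) 0 j) 0 1 0 0.
rewrite add0r !mul0r subr0 scale1r scale0r addr0 (addrC x) subrK => h.
apply/eqP; rewrite -subr_eq0 -rn_eq0 eq_le rn_ge0 andbT; apply: h => t t01.
all: rewrite add0r mulr1; have [dF F0] := hF _ (seg t t01).
all: have [dj jE] := coord_diff j dF; have [dl lE] := line_diff dj.
  exact: dl.
by rewrite lE jE F0 mxE subrr rn0.
Qed.

(** With [h = g (y + k) - g y], applying the left inverse [T] to the expansion of [f] gives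
    [h = T k] up to a small multiple of [rn h]; absorbing that multiple shows that [rn h] is of the
    order of [rn k]. *)
Lemma inverse_differentiable (U V : normedModType C) (f : U -> V) (g : V -> U) (y : V)
    (T : V -> U) (B : R) :
  differentiable f (g y) -> {for y, continuous g} -> linear T ->
  (forall k, rn (T k) <= B * rn k) -> (forall h, T ('d f (g y) h) = h) ->
  (exists2 d : R, 0 < d & forall z, rn (z - y) < d -> f (g z) = z) ->
  differentiable g y.
Proof.
move=> df cg lT hB TK [d0 d00 fg].
suff [] : differentiable g y /\ 'd g y = T :> (V -> U) by [].
apply: (@diff_of_linear R V U g y T B) => // e e0.
have yy : f (g y) = y by apply: fg; rewrite subrr rn0.
pose A := `|B| + 1; have A0 : 0 < A by rewrite ltr_wpDl.
have hA k : rn (T k) <= A * rn k.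
  apply: le_trans (hB k) _; rewrite ler_wpM2r ?rn_ge0 // /A.
  by rewrite (le_trans (ler_norm _)) // lerDl.
(* The first bound gives [A * e1 <= 1 / 2], which absorbs the error into [rn h]; the second turns
   [A * e1 * (2 * A)] into at most e. *)
pose e1 := Num.min (1 / (2 * A)) (e / (2 * A ^+ 2)).
have e10 : 0 < e1 by rewrite lt_min !divr_gt0 ?mulr_gt0 ?exprn_gt0.
have e1A : A * e1 <= 1 / 2.
  rewrite mulrC -ler_pdivlMr // /e1 ge_min; apply/orP; left.
  by rewrite le_eqVlt; apply/orP; left; apply/eqP; field; rewrite gt_eqF.
have e1e : 2 * A ^+ 2 * e1 <= e.
  by rewrite mulrC -ler_pdivlMr ?mulr_gt0 ?exprn_gt0 // /e1 ge_min lexx orbT.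
move: e1 e10 e1A e1e => e1 e10 e1A e1e.
have [d1 d10 hd1] := diff_rnP df e10.
have [d2 d20 hd2] := (cont_rnP _ _).1 cg _ d10.
exists (Num.min d0 d2); first by rewrite lt_min d00.
move=> k; rewrite lt_min => /andP[k0 k2].
have E : y + k - y = k by rewrite addrC addKr.
pose h := g (y + k) - g y.
have hh : rn h < d1 by apply: hd2; rewrite E.
have := hd1 h hh; rewrite /h (addrC (g y)) subrK yy fg ?E // -/h => hrem.
have Tk : h - T k = - T (k - 'd f (g y) h).
  have := lT (-1) ('d f (g y) h) k.
  rewrite TK !scaleN1r (addrC (- _) k) (addrC (- h)) => ->.
  by rewrite opprB.
have b1 : rn (h - T k) <= A * e1 * rn h.
  rewrite Tk rnN; apply: le_trans (hA _) _.
  by rewrite -mulrA ler_wpM2l // ltW.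
have b2 : rn h <= 2 * A * rn k.
  have := rn_lbB h (T k); have := hA k.
  have := ler_wpM2r (rn_ge0 h) e1A; lra.
apply: le_trans b1 _; apply: (@le_trans _ _ (A * e1 * (2 * A * rn k))).
  by rewrite ler_wpM2l // mulr_ge0 // ltW.
have -> : A * e1 * (2 * A * rn k) = 2 * A ^+ 2 * e1 * rn k by ring.
by rewrite ler_wpM2r ?rn_ge0.
Qed.

End RowVectors.

(** * Inverses of univalent maps *)

Section Univalent.
Context {R : realType}.
Local Notation C := R[i].
Implicit Types (f : C -> C) (c p z : C) (r : R).

Lemma small_multiple (a b K : R) : 0 < a -> 0 < b -> exists t : R, [/\ 0 < t, t <= a & K * t <= b].
Proof.
move=> a0 b0; have K1 : 0 < `|K| + 1 by rewrite ltr_wpDl.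
have t0 : 0 < Num.min a (b / (`|K| + 1)) by rewrite lt_min a0 divr_gt0.
exists (Num.min a (b / (`|K| + 1))); split=> //; first by rewrite ge_min lexx.
set t := Num.min _ _ in t0 *.
have tb : t <= b / (`|K| + 1) by rewrite ge_min lexx orbT.
rewrite ler_pdivlMr // mulrC in tb; apply: le_trans tb.
by rewrite ler_wpM2r ?(ltW t0) // (le_trans (ler_norm _)) // lerDl.
Qed.

Lemma common_lower_bound (a b : R) : 0 < a -> 0 < b -> exists t : R, [/\ 0 < t, t <= a & t <= b].
Proof.
by move=> a0 b0; have [t [t0 ta]] := @small_multiple a b 1 a0 b0; rewrite mul1r; exists t.
Qed.

(** Injectivity keeps [f - f c] at least some [m] in modulus on the circle; for y within [m / 2] of
    [f c], the function [f - y] is smaller at the center than on the circle, so it has a zero. *)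
Lemma local_open1 f c r : 0 < r ->
  (forall z, rn (z - c) <= r -> differentiable f z) ->
  (forall z w, rn (z - c) <= r -> rn (w - c) <= r -> f z = f w -> z = w) ->
  exists2 e : R, 0 < e & forall y, rn (y - f c) < e -> exists2 z, rn (z - c) < r & f z = y.
Proof.
move=> r0 df injf.
have cc : rn (c - c) <= r by rewrite subrr rn0 ltW.
have [m m0 hm] : exists2 m : R, 0 < m & forall z, rn (z - c) = r -> m <= rn (f z - f c).
  apply: (@circle_min R (fun z => f z - f c)) => // z zr.
  have zr' : rn (z - c) <= r by rewrite zr.
  split; first exact: (contB (df_cont (df z zr')) (cont_cst _ _)).
  rewrite subr_eq0; apply/eqP => /(injf _ _ zr' cc) zc.
  by move: zr; rewrite zc subrr rn0 => r00; rewrite -r00 ltxx in r0.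
exists (m / 2); first by rewrite divr_gt0.
move=> y hy.
have h1 z : rn (z - c) <= r -> differentiable (fun z => f z - y) z.
  by move=> /df dz; exact: (dfB dz (df_cst _ _)).
have h2 z : rn (z - c) = r -> m / 2 <= rn (f z - y).
  move=> /hm h; have := rnDB (f z) y (f c); lra.
have h3 : rn (f c - y) < m / 2 by rewrite rnBC.
have [z zr /eqP] := zero_in_disk r0 h1 h2 h3.
by rewrite subr_eq0 => /eqP fz; exists z.
Qed.

(** Were the derivative 0 at [p], the inverse g would still be Lipschitz at [f p], while f is
    quadratically close to [f p] near [p]. Then [f (g y) = y] gives [t <= K * t ^ 2] for small t,
    which is absurd. *)
Lemma no_isolated_critical_point f p r : 0 < r ->
  (forall z, rn (z - p) < r -> differentiable f z) ->
  (forall z w, rn (z - p) < r -> rn (w - p) < r -> f z = f w -> z = w) ->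
  (forall z, rn (z - p) < r -> z != p -> cder f z != 0) -> cder f p != 0.
Proof.
move=> r0 df injf nz; apply/eqP => fp0.
have pp (s : R) : 0 < s -> rn (p - p) < s by rewrite subrr rn0.
have pp' (s : R) : 0 < s -> rn (f p - f p) < s by rewrite subrr rn0.
have r4 : 0 < r / 4 by rewrite divr_gt0.
have opn x s : rn (x - p) < r / 2 -> 0 < s -> s <= r / 4 ->
    exists2 e : R, 0 < e & forall y, rn (y - f x) < e -> exists2 z, rn (z - x) < s & f z = y.
  move=> xr s0 sr.
  have inb z : rn (z - x) <= s -> rn (z - p) < r by have := rnDB z x p; lra.
  by apply: local_open1 => // [z /inb|z w /inb h1 /inb h2]; [exact: df | exact: injf].
have [e e0 he] := opn p (r / 4) (pp _ (divr_gt0 r0 (ltr0Sn _ 1))) r4 (lexx _).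
have exg y : exists z : C, rn (y - f p) < e -> rn (z - p) < r / 4 /\ f z = y.
  have [ye|] := ltP (rn (y - f p)) e; last by exists 0.
  by have [z h1 h2] := he y ye; exists z.
have [g hg] := choice exg.
have gr y : rn (y - f p) < e -> rn (g y - p) < r / 2 by move=> /hg [h _]; lra.
have gr' y : rn (y - f p) < e -> rn (g y - p) < r by move=> /hg [h _]; lra.
have cg y : rn (y - f p) < e -> {for y, continuous g}.
  move=> ye; apply/cont_rnP => d d0.
  have [s [s0 sd sr]] := common_lower_bound d0 r4.
  have [e1 e10 he1] := opn (g y) s (gr _ ye) s0 sr.
  have ye0 : 0 < e - rn (y - f p) by rewrite subr_gt0.
  have [e2 [e20 e21 e22]] := common_lower_bound e10 ye0.
  exists e2 => // w hw.
  have wp : rn (w - f p) < e by have := rnDB w y (f p); lra.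
  have [_ fy] := hg y ye; have [_ fw] := hg w wp.
  have [|z h1 h2] := he1 w; first by rewrite fy (lt_le_trans hw).
  suff -> : g w = z by exact: lt_le_trans h1 sd.
  apply: injf; [exact: gr' | | by rewrite fw h2].
  by have := gr _ ye; have := rnDB z (g y) p; lra.
have gfp : g (f p) = p.
  have [_ h] := hg (f p) (pp' e e0).
  by apply: injf => //; [apply: gr'; exact: pp' | exact: pp].
have dg y : rn (y - f p) < e -> y != f p -> differentiable g y.
  move=> ye yp; have [gy fy] := hg y ye.
  have gp : g y != p by apply: contra_neq yp => gp; rewrite -fy gp.
  have D0 := nz _ (gr' _ ye) gp.
  apply: (@inverse_differentiable R C C f g y (fun k => (cder f (g y))^-1 * k) (rn (cder f (g y))^-1)).
  - exact/df/gr'.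
  - exact: cg.
  - by move=> a u v; rewrite mulrDr; congr (_ + _); exact: mulrCA.
  - by move=> k; rewrite rnM.
  - by move=> h; rewrite diffCE -/(cder f (g y)) mulKf.
  - exists (e - rn (y - f p)); first by rewrite subr_gt0.
    by move=> z hz; have [] := hg z; first by have := rnDB z y (f p); lra.
(* The inverse is differentiable only off [f p]; the factor [y - f p] repairs this, and since [chi]
   has derivative 0 there, its quadratic remainder bounds [g y - p] linearly. *)
pose chi y := (y - f p) * (g y - p).
have chifp : chi (f p) = 0 by rewrite /chi subrr mul0r.
have [dchi0 cchi0] : differentiable chi (f p) /\ 'd chi (f p) 1 = 0.
  apply: diff_of_mul => e1 e10.
  have [d d0 hd] := (cont_rnP _ _).1 (cg (f p) (pp' e e0)) _ e10.
  exists d => // h hh; rewrite chifp mul0r !subr0 /chi (addrC (f p)) addrK rnM mulrC.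
  rewrite ler_wpM2r ?rn_ge0 //; apply: ltW.
  by have := hd (h + f p); rewrite addrK gfp => /(_ hh).
have e2 : 0 < e / 2 by rewrite divr_gt0.
have dchi y : rn (y - f p) <= e / 2 -> differentiable chi y.
  move=> ye; have [->//|yp] := eqVneq y (f p).
  apply: (dfM (dfB (df_id _) (df_cst _ _))); apply: (fun h => dfB h (df_cst _ _)).
  by apply: dg => //; lra.
have bchi y : rn (y - f p) <= e / 2 -> rn (chi y) <= e / 2 * (r / 4).
  move=> ye; rewrite rnM; apply: ler_pM; rewrite ?rn_ge0 //.
  by have [|/ltW] := hg y; first lra.
have q1 := quadratic_remainder e2 dchi bchi.
set K1 := 8 * _ / _ in q1.
have lipg y : y != f p -> rn (y - f p) <= e / 2 / 2 -> rn (g y - p) <= K1 * rn (y - f p).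
  move=> yp /q1; rewrite chifp /cder cchi0 mul0r !subr0 /chi rnM expr2 mulrCA mulrC.
  by rewrite mulrC ler_pM2l // rn_gt0 subr_eq0.
have r2 : 0 < r / 2 by rewrite divr_gt0.
have df2 z : rn (z - p) <= r / 2 -> differentiable f z by move=> zr; apply: df; lra.
have [M M0 hM] := bounded_cdisk (ltW r2) (fun z h => df_cont (df2 z h)).
have q2 := quadratic_remainder r2 df2 hM.
set K2 := 8 * _ / _ in q2.
have [t [t0 te tK]] := small_multiple (K2 * K1 ^+ 2) (divr_gt0 e2 (ltr0Sn _ 1)) (divr_gt0 ltr01 (ltr0Sn _ 1)).
pose y := f p + t%:C.
have yE : y - f p = t%:C by rewrite /y addrC addKr.
have yt : rn (y - f p) = t by rewrite yE rn_real gtr0_norm.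
have ye : rn (y - f p) < e by rewrite yt; lra.
have yp : y != f p by rewrite -subr_eq0 -rn_gt0 yt.
have [gy fy] := hg y ye.
have := lipg y yp; rewrite yt => /(_ te) l1.
have := q2 (g y); rewrite fy fp0 mul0r subr0 yt => l2.
have {}l2 : t <= K2 * rn (g y - p) ^+ 2 by apply: l2; lra.
have K20 : 0 <= K2 by rewrite divr_ge0 ?mulr_ge0 // ltW.
have l3 : K2 * rn (g y - p) ^+ 2 <= K2 * (K1 * t) ^+ 2.
  by rewrite ler_wpM2l // lerXn2r ?nnegrE ?rn_ge0 // (le_trans (rn_ge0 _) l1).
have l4 : K2 * (K1 * t) ^+ 2 = (K2 * K1 ^+ 2 * t) * t by ring.
have := ler_wpM2r (ltW t0) tK; lra.
Qed.

Lemma scalar_constant f p r : (forall z, rn (z - p) < r -> differentiable f z /\ cder f z = 0) ->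
  forall z, rn (z - p) < r -> f z = f p.
Proof.
move=> hf z zr.
have seg (t : R) : 0 <= t <= 1 -> rn (p + t%:C * (z - p) - p) < r.
  move=> /andP[t0 t1]; rewrite addrC addKr rnM rn_real ger0_norm //.
  by apply: le_lt_trans zr; rewrite ler_piMl ?rn_ge0.
have := @mean_value_ineq R f p (z - p) 0 0.
rewrite (addrC p) subrK !mul0r subr0 => h.
apply/eqP; rewrite -subr_eq0 -rn_eq0 eq_le rn_ge0 andbT; apply: h => t /seg/hf[d1 d2] //.
by rewrite d2 subrr rn0.
Qed.

(** Among all critical points, choose one where the order of vanishing of the derivative is least.
    The last vanishing iterated derivative is zero at every critical point but has a simple zero at
    this one, which is therefore isolated. If all orders were infinite, [f] would be constant. *)
Lemma univalent_derivative_neq0 f c r : 0 < r ->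
  (forall z, rn (z - c) < r -> differentiable f z) ->
  (forall z w, rn (z - c) < r -> rn (w - c) < r -> f z = f w -> z = w) ->
  cder f c != 0.
Proof.
move=> r0 df injf; apply/eqP => fc0.
have cc : rn (c - c) < r by rewrite subrr rn0.
have dcf z : rn (z - c) < r -> differentiable (cder f) z.
  exact: (@iter_cder_differentiable R f c r 1).
pose P k := exists p, [/\ rn (p - c) < r, cder f p = 0 & iter k cder (cder f) p != 0].
have exP : exists k, `[< P k >].
  apply: contrapT => nP.
  have z0 k : iter k cder (cder f) c = 0.
    by apply: contrapT => /eqP h; apply: nP; exists k; apply/asboolP; exists c.
  have f0 := vanish_of_derivatives r0 dcf z0.
  have r2 : rn (c + (r / 2)%:C - c) < r.
    by rewrite addrC addKr rn_real gtr0_norm ?divr_gt0 //; lra.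
  have E := scalar_constant (fun z h => conj (df z h) (f0 z h)) r2.
  have := injf _ _ r2 cc E; move/eqP; rewrite -subr_eq0 -rn_eq0.
  by rewrite addrC addKr rn_real normr_eq0 mulf_eq0 invr_eq0 pnatr_eq0 orbF gt_eqF.
case: (ex_minnP exP) => -[|k] /asboolP [p [pr fp0 hp]] hmin.
  by move: hp; rewrite /= fp0 eqxx.
pose G := iter k cder (cder f).
have Gz z : rn (z - c) < r -> cder f z = 0 -> G z = 0.
  move=> zr fz; apply: contrapT => /eqP h.
  have : (k < k)%N by apply: hmin; apply/asboolP; exists z.
  by rewrite ltnn.
have Gp : G p = 0 by exact: Gz.
have dG : differentiable G p := @iter_cder_differentiable R (cder f) c r k dcf p pr.
have DG : cder G p != 0 by exact: hp.
have DG0 : 0 < rn (cder G p) by rewrite rn_gt0.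
have [d d0 hd] := diffC_rnP dG (divr_gt0 DG0 (ltr0Sn _ 1)).
have pr0 : 0 < r - rn (p - c) by rewrite subr_gt0.
have [s [s0 sd sr]] := common_lower_bound d0 pr0.
have inb z : rn (z - p) < s -> rn (z - c) < r by have := rnDB z p c; lra.
have := @no_isolated_critical_point f p s s0.
rewrite fp0 eqxx => H; suff : false by [].
apply: H => [z /inb|z w /inb h1 /inb h2|z zs zp]; [exact: df | exact: injf |].
apply/eqP => fz; have := hd z (lt_le_trans zs sd).
rewrite Gp (Gz z (inb _ zs) fz) subrr sub0r rnN rnM -/(cder G p).
have z0 : 0 < rn (z - p) by rewrite rn_gt0 subr_eq0.
rewrite ler_pM2r //; lra.
Qed.

End Univalent.

(** * Injectivity of the differential: reduction of the dimension *)

Section Osgood.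
Context {R : realType}.
Local Notation C := R[i].

Lemma diff_addE (U V : normedModType C) (f g : U -> V) x : differentiable f x ->
  differentiable g x -> forall v, 'd (fun y => f y + g y) x v = 'd f x v + 'd g x v.
Proof. by move=> df dg v; have /(congr1 (fun h => h v)) := diffD df dg. Qed.

Lemma diff_scalelE (U V : normedModType C) (k : U -> C) (w : V) x : differentiable k x ->
  differentiable (fun y => k y *: w) x /\
  forall v, 'd (fun y => k y *: w) x v = 'd k x v *: w.
Proof.
move=> dk; split; first exact: differentiableZl.
by move=> v; have /(congr1 (fun h => h v)) := diffZl w dk.
Qed.

Lemma diff_cstE (U V : normedModType C) (c : V) (x v : U) : 'd (fun=> c) x v = 0.
Proof. by have /(congr1 (fun h => h v)) := @diff_cst C U V c x. Qed.

Lemma diff_subcE (U V : normedModType C) (f : U -> V) (c : V) x : differentiable f x ->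
  forall v, 'd (fun y => f y - c) x v = 'd f x v.
Proof.
move=> df v; transitivity ('d f x v + 'd (fun=> - c) x v).
  exact: (diff_addE df (df_cst (- c) x)).
by rewrite -[RHS]addr0; congr (_ + _); exact: (diff_cstE (- c) x v).
Qed.

Lemma diff_addcE (U V : normedModType C) (f : U -> V) (c : V) x : differentiable f x ->
  forall v, 'd (fun y => c + f y) x v = 'd f x v.
Proof.
move=> df v; transitivity ('d (fun=> c) x v + 'd f x v).
  exact: (diff_addE (df_cst c x) df).
by rewrite -[RHS]add0r; congr (_ + _); exact: (diff_cstE c x v).
Qed.

Lemma df_sum (U : normedModType C) (I : Type) (s : seq I) (P : pred I) (f : I -> U -> C) x :
  (forall i, differentiable (f i) x) -> differentiable (fun y => \sum_(i <- s | P i) f i y) x.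
Proof.
move=> df; elim: s => [|i s IH].
  have -> : (fun y => \sum_(i <- [::] | P i) f i y) = (fun=> 0).
    by apply/funext => y; rewrite big_nil.
  exact: df_cst.
case Pi : (P i); last first.
  have -> : (fun y => \sum_(i <- i :: s | P i) f i y) = (fun y => \sum_(i <- s | P i) f i y) => //.
  by apply/funext => y; rewrite big_cons Pi.
have -> : (fun y => \sum_(i <- i :: s | P i) f i y) =
    (fun y => f i y + \sum_(i <- s | P i) f i y).
  by apply/funext => y; rewrite big_cons Pi.
exact: dfD (df i) IH.
Qed.

Lemma df_prod (U : normedModType C) (I : Type) (s : seq I) (f : I -> U -> C) x :
  (forall i, differentiable (f i) x) -> differentiable (fun y => \prod_(i <- s) f i y) x.
Proof.
move=> df; elim: s => [|i s IH].
  have -> : (fun y => \prod_(i <- [::]) f i y) = (fun=> 1).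
    by apply/funext => y; rewrite big_nil.
  exact: df_cst.
have -> : (fun y => \prod_(i <- i :: s) f i y) = (fun y => f i y * \prod_(i <- s) f i y).
  by apply/funext => y; rewrite big_cons.
exact: dfM (df i) IH.
Qed.

Lemma df_det (U : normedModType C) n (A : U -> 'M[C]_n) x :
  (forall i j, differentiable (fun y => A y i j) x) -> differentiable (fun y => \det (A y)) x.
Proof.
move=> dA; rewrite /determinant; apply: df_sum => s.
by apply: (dfM (df_cst _ _)); apply: df_prod => i.
Qed.

Lemma linear_comb (U : normedModType C) (f : {linear U -> C}) (k : C) (u w : U) :
  f u = 0 -> f (u + k *: w) = k * f w.
Proof. by move=> fu; rewrite linearD linearZ /= fu add0r. Qed.

Definition univalent n (F : 'rV[C]_n -> 'rV[C]_n) (a : 'rV[C]_n) (r : R) :=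
  (forall y, rn (y - a) < r -> differentiable F y) /\
  (forall x y, rn (x - a) < r -> rn (y - a) < r -> F x = F y -> x = y).

Lemma univalent_sub n (F : 'rV[C]_n -> 'rV[C]_n) a b (r s : R) :
  (forall y, rn (y - b) < s -> rn (y - a) < r) -> univalent F a r -> univalent F b s.
Proof.
move=> h [h1 h2]; split => [y /h|x y /h k1 /h k2]; [exact: h1 | exact: h2].
Qed.

Section Embedding.
Variables (n : nat) (i : 'I_n.+1).

(** The identity matrix without row [i]: multiplication by it inserts a zero coordinate at [i], and
    by its transpose it deletes coordinate [i]. *)
Definition embed_mx : 'M[C]_(n, n.+1) := row' i 1%:M.

Lemma embed_lift (t : 'rV[C]_n) k : (t *m embed_mx) 0 (lift i k) = t 0 k.
Proof.
rewrite mxE (bigD1 k) //= !mxE eqxx mulr1 big1 ?addr0 // => l lk.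
by rewrite !mxE (inj_eq lift_inj) (negbTE lk) mulr0.
Qed.

Lemma embed_hole (t : 'rV[C]_n) : (t *m embed_mx) 0 i = 0.
Proof.
by rewrite mxE big1 // => l _; rewrite !mxE eq_sym (negbTE (neq_lift _ _)) mulr0.
Qed.

Lemma embed_inj (t u : 'rV[C]_n) : t *m embed_mx = u *m embed_mx -> t = u.
Proof. by move=> h; apply/rowP => k; rewrite -!embed_lift h. Qed.

Lemma embed_onto (u : 'rV[C]_n.+1) : u 0 i = 0 -> (\row_k u 0 (lift i k)) *m embed_mx = u.
Proof.
move=> ui; apply/rowP => k; case: (unliftP i k) => [l ->|->].
  by rewrite embed_lift mxE.
by rewrite embed_hole.
Qed.

Lemma forget_lift (u : 'rV[C]_n.+1) k : (u *m embed_mx^T) 0 k = u 0 (lift i k).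
Proof.
rewrite mxE (bigD1 (lift i k)) //= !mxE eqxx mulr1 big1 ?addr0 // => l lk.
by rewrite !mxE eq_sym (negbTE lk) mulr0.
Qed.

Lemma forget_inj (u v : 'rV[C]_n.+1) : u 0 i = v 0 i ->
  u *m embed_mx^T = v *m embed_mx^T -> u = v.
Proof.
move=> ui h; apply/rowP => k; case: (unliftP i k) => [l ->|->//].
by rewrite -!forget_lift h.
Qed.

End Embedding.

(* The level set of one component of F through a is a graph, and F restricts to
   a univalent map of one variable less on it. *)
Lemma univalent_slice n (IH : forall (F : 'rV[C]_n -> 'rV[C]_n) a r, 0 < r ->
    univalent F a r -> forall v, 'd F a v = 0 -> v = 0)
  (F : 'rV[C]_n.+1 -> 'rV[C]_n.+1) a r v0 : 0 < r -> univalent F a r ->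
  'd F a v0 != 0 -> forall v, 'd F a v = 0 -> v = 0.
Proof.
move=> r0 [dF injF] Fv0 v Fv.
have /rV0Pn [j dj] := Fv0.
have v00 : v0 != 0 by apply: contra_neq Fv0 => ->; rewrite linear0.
have /rV0Pn [i vi] := v00.
have aa (s : R) : 0 < s -> rn (a - a) < s by rewrite subrr rn0.
pose g (y : 'rV[C]_n.+1) : C := F y 0 j - F a 0 j.
have dg y : rn (y - a) < r -> differentiable g y /\ forall w, 'd g y w = ('d F y w) 0 j.
  move=> yr; have [h1 h2] := coord_diff j (dF y yr).
  split; first exact: (dfB h1 (df_cst _ _)).
  by move=> w; rewrite (diff_subcE _ h1) h2.
have ga : g a = 0 by rewrite /g subrr.
have [dga dgaE] := dg a (aa r r0).
have dgv : 'd g a v0 != 0 by rewrite dgaE.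
pose e := r / (1 + rn v0).
have v1 : 0 < 1 + rn v0 by rewrite ltr_pwDl ?rn_ge0.
have e0 : 0 < e by rewrite divr_gt0.
have er : e + e * rn v0 = r by rewrite -{1}[e]mulr1 -mulrDr divfK // gt_eqF.
have [rho [s [psi [/andP[rho0 rhoe] /andP[s0 se] hpsi upsi]]]] :=
  implicit_function r0 e0 (fun y h => (dg y h).1) ga dgv.
have psia : psi a = 0.
  by apply/esym/upsi; rewrite ?aa // ?rn0 // scale0r addr0.
(* As [v0] has a nonzero coordinate i, the hyperplane [a + t *m A] is transverse to [v0] and [G] is
   injective; B drops component j of F, which is constant along [G]. *)
pose A := embed_mx i; pose B := (embed_mx j)^T.
pose G (t : 'rV[C]_n) := a + t *m A + psi (a + t *m A) *: v0.
pose Phi (t : 'rV[C]_n) := G t *m (1%:M : 'M[C]_n.+1).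
have [K K0 hK] := mulmx_bounded A.
have K1 : 0 < K + 1 by rewrite ltr_wpDl.
pose tau := rho / (K + 1).
have tau0 : 0 < tau by rewrite divr_gt0.
have tA t : rn (t - 0) < tau -> rn (a + t *m A - a) < rho.
  rewrite subr0 addrC addKr ltr_pdivlMr // => h; apply: le_lt_trans (hK t) _.
  by rewrite mulrC in h; apply: le_lt_trans h; rewrite ler_wpM2r ?rn_ge0 // lerDl.
have Gr t : rn (t - 0) < tau -> rn (G t - a) < r.
  move=> /tA h; have [ps _ _] := hpsi _ h.
  rewrite /G addrAC; apply: le_lt_trans (rnD _ _) _; rewrite rnZ -er.
  apply: ltr_leD; first exact: lt_trans h rhoe.
  by rewrite ler_wpM2r ?rn_ge0 // ltW // (lt_trans ps).
have dinner t : differentiable (fun t : 'rV[C]_n => a + t *m A) t /\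
    forall u, 'd (fun t : 'rV[C]_n => a + t *m A) t u = u *m A.
  have [h1 h2] := mulmx_diff A t.
  split; first exact: (dfD (df_cst _ _) h1).
  by move=> u; rewrite (diff_addcE _ h1) h2.
have dG t : rn (t - 0) < tau -> differentiable G t /\
    forall u, 'd G t u = u *m A + 'd psi (a + t *m A) (u *m A) *: v0.
  move=> /tA h; have [_ _ dps] := hpsi _ h.
  have [i1 i2] := dinner t.
  have k1 := df_comp i1 dps; have k2 := chain_rule i1 dps.
  have [l1 l2] := diff_scalelE v0 k1.
  split; first exact: (dfD i1 l1).
  move=> u; etransitivity; first exact: (diff_addE i1 l1).
  have E1 := i2 u; have E2 := l2 u; have E3 := k2 u.
  by congr (_ + _); first exact: E1; rewrite E2 E3 E1.
pose Psi t := F (G t) *m B.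
have uPsi : univalent Psi 0 tau.
  split=> [t tt|t u tt uu hE].
    have [d1 _] := dG t tt.
    exact: (df_comp (df_comp d1 (dF _ (Gr _ tt))) (mulmx_diff B _).1).
  have [pt gt _] := hpsi _ (tA _ tt); have [pu gu _] := hpsi _ (tA _ uu).
  have Ft : F (G t) 0 j = F a 0 j by move/eqP: gt; rewrite /g subr_eq0 => /eqP.
  have Fu : F (G u) 0 j = F a 0 j by move/eqP: gu; rewrite /g subr_eq0 => /eqP.
  have EG : G t = G u.
    apply: (injF _ _ (Gr _ tt) (Gr _ uu)).
    by apply: (@forget_inj _ j); [rewrite Ft Fu | exact: hE].
  have Ep : psi (a + t *m A) = psi (a + u *m A).
    have crd w (p : C) : (a + w *m A + p *: v0) 0 i = a 0 i + p * v0 0 i.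
      by rewrite mxE [X in X + _]mxE embed_hole addr0 mxE.
    have := congr1 (fun m : 'rV[C]_n.+1 => m 0 i) EG.
    by rewrite /= /G !crd => /addrI /(mulIf vi).
  move: EG; rewrite /G Ep => /addIr /addrI; exact: embed_inj.
have E0 : rn ((0 : 'rV[C]_n) - 0) < tau by rewrite subrr rn0.
have [dG0 dG0E] := dG 0 E0.
rewrite mul0mx addr0 in dG0E.
have G0 : G 0 = a by rewrite /G mul0mx addr0 psia scale0r addr0.
pose c := v 0 i / v0 0 i.
pose t := \row_k (v - c *: v0) 0 (lift i k).
have tE : t *m A = v - c *: v0.
  by apply: embed_onto; rewrite !mxE divfK // subrr.
pose al := 'd psi a (t *m A).
have gG : forall t, rn (t - 0) < tau -> g (G t) = 0 by move=> t' /tA h; have [] := hpsi _ h.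
have dgG : 'd g a ('d G 0 t) = 0.
  have dg0 : differentiable g (G 0) by rewrite G0.
  have := chain_rule dG0 dg0 t; rewrite G0 => <-.
  have [_ ->] := @diff_near R _ _ (fun=> 0) (fun t => g (G t)) 0 tau tau0
    (fun y h => esym (gG y h)) (df_cst _ _).
  exact: diff_cstE.
have dgvv : 'd g a v = 0 by rewrite dgaE Fv mxE.
(* Both [v] and ['d G 0 t] are killed by ['d g a] and they differ by a multiple of [v0], which is
   not killed. *)
have alc : al = c.
  have Ev : 'd G 0 t = v + (al - c) *: v0.
    by rewrite (dG0E t) -/al tE scalerBl addrA addrAC.
  have := linear_comb (al - c) v0 dgvv; rewrite -Ev dgG => /esym/eqP.
  by rewrite mulf_eq0 (negbTE dgv) orbF subr_eq0 => /eqP.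
have dGv : 'd G 0 t = v by rewrite (dG0E t) -/al alc tE subrK.
have dPsi : 'd Psi 0 t = 0.
  have dF0 : differentiable F (G 0) by rewrite G0; apply/dF/aa.
  rewrite (chain_rule (df_comp dG0 dF0) (mulmx_diff B _).1).
  rewrite (mulmx_diff B _).2 (chain_rule dG0 dF0) dGv G0 Fv.
  by rewrite mul0mx.
have t0 := IH _ _ _ tau0 uPsi _ dPsi.
move: tE; rewrite t0 mul0mx => /esym/eqP; rewrite subr_eq0 => /eqP vE.
move: Fv; rewrite vE linearZ /= => /eqP; rewrite scaler_eq0 (negbTE Fv0) orbF => /eqP ->.
by rewrite scale0r.
Qed.

End Osgood.

(** * The zero set of the Jacobian determinant and Osgood's theorem *)

Section CriticalSet.
Context {R : realType}.
Local Notation C := R[i].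

Section DirectionalDerivatives.
Variables (U : normedModType C) (v : U).

Definition dird (f : U -> C) (y : U) : C := 'd f y v.

Lemma iter_dird_differentiable (f : U -> C) a (r : R) k :
  (forall y, rn (y - a) < r -> differentiable f y) ->
  forall y, rn (y - a) < r -> differentiable (iter k dird f) y.
Proof.
move=> df; elim: k => [//|k IH] y yr /=.
apply: (@dir_differentiable R U _ y v (r - rn (y - a))); first by rewrite subr_gt0.
by move=> z zy; apply: IH; have := rnDB z y a; lra.
Qed.

Lemma iter_cder_line (f : U -> C) a b (r s : R) k :
  (forall y, rn (y - a) < r -> differentiable f y) ->
  (forall z : C, rn (z - 0) < s -> rn (b + z *: v - a) < r) ->
  forall z : C, rn (z - 0) < s ->
  iter k cder (fun z => f (b + z *: v)) z = iter k dird f (b + z *: v).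
Proof.
move=> df inb; elim: k => [//|k IH] z zs.
have dk := iter_dird_differentiable k df (inb z zs).
have [d1 d2] := line_diff dk.
have s0 : 0 < s - rn (z - 0) by rewrite subr_gt0.
have [_ E] := @diff_near R C C (fun z => iter k dird f (b + z *: v))
  (iter k cder (fun z => f (b + z *: v))) z _ s0
  (fun y h => esym (IH y (ltac:(have := rnDB y z 0; lra)))) d1.
have := congr1 (fun h => h 1) E.
by rewrite iterS /cder => ->; exact: d2.
Qed.

End DirectionalDerivatives.

(** On the circle in the line through [p], [h] has modulus at least some [m]. Moving the line
    changes values by at most [m / 3], so [h] is at least [2 * m / 3] on the new circle and at most
    [m / 3] at its center. *)
Lemma zero_in_nearby_lines (U : normedModType C) (h : U -> C) p v (r s : R) :
  0 < r -> 0 < s -> (forall y, rn (y - p) < r -> differentiable h y) ->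
  (forall y, rn (y - p) < r -> rn (h y) <= 1) ->
  s * rn v < r / 2 -> h p = 0 -> (forall z : C, rn z = s -> h (p + z *: v) != 0) ->
  exists2 d : R, 0 < d & forall y, rn (y - p) < d ->
    exists2 z : C, rn z < s & h (y + z *: v) = 0.
Proof.
move=> r0 s0 dh bh sv hp nz.
have r2 : 0 < r / 2 by rewrite divr_gt0.
have lineP y (z : C) : rn z <= s -> rn (y - (p + z *: v)) < r / 2 -> rn (y - p) < r.
  move=> zs h1; have := rnDB y (p + z *: v) p; rewrite (addrC p (z *: v)) addrK rnZ.
  by rewrite (addrC p) in h1; have := ler_wpM2r (rn_ge0 v) zs; lra.
have lin0 (z : C) : rn z <= s -> rn (p + z *: v - p) < r.
  by move=> zs; apply: (lineP _ z zs); rewrite subrr rn0.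
have [m m0 hm] : exists2 m : R, 0 < m & forall z : C, rn (z - 0) = s -> m <= rn (h (p + z *: v)).
  apply: (@circle_min R (fun z => h (p + z *: v))) => // z; rewrite subr0 => zs; split.
    have [|d1 _] := @line_diff R U h p v z; first by apply/dh/lin0; rewrite zs.
    exact: df_cont.
  exact: nz.
have [d [d0 dr dK]] := @small_multiple R (r / 4) (m / 3) (8 / r)
   (divr_gt0 r0 (ltr0Sn _ 3)) (divr_gt0 m0 (ltr0Sn _ 2)).
exists d => // y yd.
have close (z : C) : rn z <= s -> rn (h (y + z *: v) - h (p + z *: v)) <= m / 3.
  move=> zs; have E : y + z *: v = p + z *: v + (y - p) by rewrite [RHS]addrC addrA subrK.
  rewrite E; apply: le_trans (@lipschitz_bound R U h (p + z *: v) (r / 2) 1 r2 _ _ (y - p) _) _.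
  - by move=> w /(lineP _ _ zs); exact: dh.
  - by move=> w /(lineP _ _ zs); exact: bh.
  - lra.
  - have -> : 4 * 1 / (r / 2) * rn (y - p) = 8 / r * rn (y - p) by field; rewrite gt_eqF.
    apply: le_trans dK; apply: ler_wpM2l; [by rewrite divr_ge0 // ltW | exact: ltW].
have rs : rn (0 : C) <= s by rewrite rn0 ltW.
have dl (z : C) : rn (z - 0) <= s -> differentiable (fun z : C => h (y + z *: v)) z.
  rewrite subr0 => zs; have [] // := @line_diff R U h y v z.
  apply: dh; apply: (lineP _ z zs).
  by rewrite opprD addrACA subrr addr0; lra.
have bl (z : C) : rn (z - 0) = s -> m * 2 / 3 <= rn (h (y + z *: v)).
  move=> zs; have := hm z zs; rewrite subr0 in zs; have := close z; rewrite zs => /(_ (lexx _)).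
  have := rnDB (h (p + z *: v)) (h (y + z *: v)) 0; rewrite !subr0.
  rewrite (rnBC (h (p + z *: v))); lra.
have cl : rn (h (y + 0 *: v)) < m * 2 / 3.
  by have := close 0 rs; rewrite !scale0r !addr0 hp subr0; lra.
have [z zs hz] := zero_in_disk s0 dl bl cl.
by exists z => //; rewrite subr0 in zs.
Qed.

(* If the zeros of h near p are the points where F' vanishes and some iterated
   derivative g of h vanishes on them to first order in the direction v, then they
   form a graph in the direction v, along which F is constant. *)
Lemma constant_on_critical_graph (U : normedModType C) n (F : U -> 'rV[C]_n)
    (h g : U -> C) (p v : U) (r : R) : 0 < r ->
  (forall y, rn (y - p) < r -> [/\ differentiable F y, differentiable h y & differentiable g y]) ->
  (forall y, rn (y - p) < r -> h y = 0 -> g y = 0 /\ forall w, 'd F y w = 0) ->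
  h p = 0 -> 'd g p v != 0 ->
  exists (d : R) (psi : U -> C), [/\ 0 < d, psi p = 0 &
    forall y, rn (y - p) < d -> rn (y + psi y *: v - p) < r /\ F (y + psi y *: v) = F p].
Proof.
move=> r0 dFhg hz hp dgp.
have pp (t : R) : 0 < t -> rn (p - p) < t by rewrite subrr rn0.
have [dFp dhp dgp'] := dFhg p (pp r r0).
have [gp _] := hz p (pp r r0) hp.
have [d1 d10 bd1] := locally_bounded (df_cont dhp); rewrite hp rn0 add0r in bd1.
have [r1 [r10 r1r r1d]] := common_lower_bound r0 d10.
have v1 : 0 < 1 + rn v by rewrite ltr_pwDl ?rn_ge0.
pose e := r1 / 2 / (1 + rn v).
have e0 : 0 < e by rewrite !divr_gt0.
have er : e + e * rn v = r1 / 2 by rewrite -{1}[e]mulr1 -mulrDr divfK // gt_eqF.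
have [rho [s [psi [/andP[rho0 rhoe] /andP[s0 se] hpsi upsi]]]] :=
  implicit_function r0 e0 (fun y k => let: And3 _ _ dg := dFhg y k in dg) gp dgp.
have psip : psi p = 0.
  by apply/esym/upsi; rewrite ?pp // ?rn0 // scale0r addr0.
have inr y (z : C) : rn (y - p) < rho -> rn z < s -> rn (y + z *: v - p) < r1 / 2.
  move=> yr zs; rewrite addrAC; apply: le_lt_trans (rnD _ _) _; rewrite rnZ -er.
  apply: ltr_leD; first exact: lt_trans yr rhoe.
  by rewrite ler_wpM2r ?rn_ge0 // ltW // (lt_trans zs).
have inr' y (z : C) : rn (y - p) < rho -> rn z < s -> rn (y + z *: v - p) < r.
  by move=> /inr k /k; lra.
have s2 : 0 < s / 2 by rewrite divr_gt0.
have sv : s / 2 * rn v < r1 / 2.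
  have : s / 2 * rn v <= e * rn v by rewrite ler_wpM2r ?rn_ge0 //; lra.
  lra.
(* The graph consists of zeros of [g], which need not be zeros of [h] beforehand. But every nearby
   line carries a zero of [h], which is also one of [g], hence by uniqueness is the point of the
   graph. *)
have [d2 d20 hd2] : exists2 d : R, 0 < d & forall y, rn (y - p) < d ->
    exists2 z : C, rn z < s / 2 & h (y + z *: v) = 0.
  apply: (@zero_in_nearby_lines U h p v r1) => //.
  - by move=> y yr; have [] := dFhg y (lt_le_trans yr r1r).
  - by move=> y yr; apply: bd1; exact: lt_le_trans r1d.
  - move=> z zs; apply/eqP => hz0.
    have zs' : rn z < s by rewrite zs; lra.
    have [gz _] := hz _ (inr' p z (pp _ rho0) zs') hz0.
    have := upsi p z (pp _ rho0) zs' gz; rewrite psip => z0.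
    by move: s2; rewrite -zs z0 rn0 ltxx.
have [d [dd0 drho dd2]] := common_lower_bound rho0 d20.
have zero y : rn (y - p) < d -> h (y + psi y *: v) = 0.
  move=> yd; have [z zs hz0] := hd2 y (lt_le_trans yd dd2).
  have yr := lt_le_trans yd drho.
  have zs' : rn z < s by lra.
  have [gz _] := hz _ (inr' y z yr zs') hz0.
  by rewrite -(upsi y z yr zs' gz).
exists d, psi; split => // y yd.
have yr := lt_le_trans yd drho; have [ps _ _] := hpsi y yr.
split; first exact: inr'.
have -> : F p = F (p + psi p *: v) by rewrite psip scale0r addr0.
apply: (@constant_on_ball R U n (fun y => F (y + psi y *: v)) p d) => // w wd.
have wr := lt_le_trans wd drho; have [pw _ dpw] := hpsi w wr.
have [k1 _] := diff_scalelE v dpw.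
have k2 : differentiable (fun w => w + psi w *: v) w := dfD (df_id w) k1.
have wr' := inr' w _ wr pw.
have [dFw _ _] := dFhg _ wr'.
split; first exact: (df_comp k2 dFw).
by move=> u; rewrite (chain_rule k2 dFw); have [_ ->] := hz _ wr' (zero w wd).
Qed.

Lemma other_index n (i : 'I_n.+1) : (exists k, k != i) \/ n = 0%N.
Proof.
case: n i => [|n] i; first by right.
left; have [->|i0] := eqVneq i 0; first by exists ord_max.
by exists 0; rewrite eq_sym.
Qed.

Theorem osgood n (F : 'rV[C]_n -> 'rV[C]_n) a (r : R) : 0 < r -> univalent F a r ->
  forall v, 'd F a v = 0 -> v = 0.
Proof.
elim: n F a r => [|n IH] F a r r0 uF; first by move=> v _; rewrite thinmx0.
have [dF injF] := uF.
have inner b : rn (b - a) < r -> 0 < r - rn (b - a) /\ univalent F b (r - rn (b - a)).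
  move=> br; rewrite subr_gt0; split => //; apply: univalent_sub uF => y yb.
  by have := rnDB y b a; lra.
have [Fa|[v0 hv0]] : (forall v, 'd F a v = 0) \/ exists v, 'd F a v != 0.
- by have [[v hv]|] := pselect (exists v, 'd F a v != 0); [right; exists v |
    left => v; apply: contrapT => /eqP hv; apply: b; exists v].
- exfalso.
  pose J y : 'M[C]_n.+1 := lin1_mx ('d F y).
  pose h y : C := \det (J y).
  have JE y v : v *m J y = 'd F y v := mul_rV_lin1 ('d F y) v.
  (* By [univalent_slice], a nonzero differential is injective; so wherever the determinant
     vanishes, the whole differential does. *)
  have hz y : rn (y - a) < r -> h y = 0 -> forall v, 'd F y v = 0.
    move=> yr hy; have [s0 us] := inner y yr.
    have /det0P [v v0] : \det (J y) == 0 by apply/eqP.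
    rewrite JE => Fv w; apply: contrapT => /eqP Fw.
    by move: v0; rewrite (univalent_slice IH s0 us Fw Fv) eqxx.
  have ha : h a = 0.
    apply/eqP/det0P; exists (const_mx 1); last by rewrite JE Fa.
    by apply/rV0Pn; exists 0; rewrite mxE oner_eq0.
  have dh y : rn (y - a) < r -> differentiable h y.
    move=> yr; apply: df_det => i j; have [s0 us] := inner y yr.
    have yb z : rn (z - y) < r - rn (y - a) -> rn (z - a) < r.
      by move=> zb; have := rnDB z y a; lra.
    have dd : differentiable (fun y => 'd (fun y => F y 0 j) y (delta_mx 0 i)) y.
      apply: (@dir_differentiable R _ _ y _ (r - rn (y - a))) => // z /yb/dF dFz.
      by have [] := coord_diff j dFz.
    have [] // := @diff_near R _ _ _ (fun y => J y i j) y _ s0 _ dd.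
    move=> z /yb/dF dFz; have [_ ->] := coord_diff j dFz.
    by rewrite /J mxE.
  clearbody h; clear J JE.
  have r8 : 0 < r / 8 by rewrite divr_gt0.
  (* If the determinant vanished near [a], F would be locally constant. The radius [r / 8] keeps the
     line from [a] through [q] inside the ball for parameters up to 2. *)
  have [[q qr hq]|hall] := pselect (exists2 q, rn (q - a) < r / 8 & h q != 0); last first.
    have h0 y : rn (y - a) < r / 8 -> differentiable F y /\ forall v, 'd F y v = 0.
      move=> yr; have yr' : rn (y - a) < r by lra.
      split; first exact: dF.
      apply: (hz y yr'); apply: contrapT => /eqP hy; apply: hall; by exists y.
    pose u : 'rV[C]_n.+1 := const_mx 1.
    have [t [t0 _ tu]] := @small_multiple R 1 (r / 16) (rn u) ltr01 (divr_gt0 r0 (ltr0Sn _ 15)).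
    have ur : rn (a + t%:C *: u - a) < r / 8.
      by rewrite addrC addKr rnZ rn_real gtr0_norm // mulrC; lra.
    have := constant_on_ball h0 ur => E.
    have aa : rn (a - a) < r by rewrite subrr rn0.
    have ur' : rn (a + t%:C *: u - a) < r by lra.
    have := injF _ _ ur' aa E; rewrite -[RHS]addr0 => /addrI /(congr1 (fun m : 'rV_n.+1 => m 0 0)).
    rewrite /= !mxE mulr1 => /(congr1 (@complex.Re R)) /= t00.
    by rewrite t00 ltxx in t0.
  pose v := q - a.
  have inl (z : C) : rn (z - 0) < 2 -> rn (a + z *: v - a) < r.
    rewrite subr0 addrC addKr rnZ => z2.
    by have := ler_wpM2r (rn_ge0 v) (ltW z2); rewrite /v in qr *; lra.
  (* A zero of least finite order along [v] among all zeros: the derivative of one order less then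
     vanishes on the whole zero set, yet to first order only at [p]. Since [h q != 0], the order is
     finite at [a]. *)
  pose P k := exists p, [/\ rn (p - a) < r, h p = 0 & iter k (dird v) h p != 0].
  have exP : exists k, `[< P k >].
    apply: contrapT => nP.
    have z0 k : iter k cder (fun z : C => h (a + z *: v)) 0 = 0.
      have z00 : rn ((0 : C) - 0) < 2 by rewrite subrr rn0.
      rewrite (iter_cder_line k dh inl z00) scale0r addr0.
      apply: contrapT => /eqP hk; apply: nP; exists k; apply/asboolP; exists a.
      by rewrite subrr rn0.
    have dl (z : C) : rn (z - 0) < 2 -> differentiable (fun z : C => h (a + z *: v)) z.
      by move=> /inl/dh dz; have [] := line_diff dz.
    have := vanish_of_derivatives (ltr0Sn _ 1) dl z0 (z := 1).
    rewrite subr0 rn1 scale1r /v (addrC a) subrK => h0.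
    by move: hq; rewrite h0 ?eqxx // ltr1n.
  case: (ex_minnP exP) => -[|k] /asboolP [p [pr hp hk]] hmin.
    by move: hk; rewrite /= hp eqxx.
  pose g := iter k (dird v) h.
  have gz y : rn (y - a) < r -> h y = 0 -> g y = 0.
    move=> yr hy; apply: contrapT => /eqP gy.
    have : (k < k)%N by apply: hmin; apply/asboolP; exists y.
    by rewrite ltnn.
  have [s0 [dFp injFp]] := inner p pr.
  set s := r - rn (p - a) in s0 dFp injFp.
  have pa y : rn (y - p) < s -> rn (y - a) < r by rewrite /s => yp; have := rnDB y p a; lra.
  have [|y yp hy|d [psi [d0 psip hpsi]]] := @constant_on_critical_graph _ _ F h g p v s s0 _ _ hp hk.
  + move=> y yp; split; [exact: dFp | exact/dh/pa |].
    exact: (@iter_dird_differentiable _ v h a r k dh _ (pa y yp)).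
  + by split; [apply: gz => //; exact: pa | apply: hz => //; exact: pa].
  have v0 : v != 0.
    by apply: contraNneq hq => v0; move/eqP: v0; rewrite /v subr_eq0 => /eqP ->; rewrite ha.
  clearbody v; have /rV0Pn [i vi] := v0.
  (* Moving along a coordinate other than [i] produces a second point of the graph: a step along
     [delta_mx 0 k'] cannot be undone by a multiple of [v], as [v 0 i != 0]. F takes the same value
     at both points. *)
  have [[k' k'i]|n0] := other_index i.
    pose w : 'rV[C]_n.+1 := delta_mx 0 k'.
    have [t [t0 _ tw]] := @small_multiple R 1 (d / 2) (rn w) ltr01 (divr_gt0 d0 (ltr0Sn _ 1)).
    have wd : rn (p + t%:C *: w - p) < d.
      by rewrite addrC addKr rnZ rn_real gtr0_norm // mulrC; lra.
    have [h1 h2] := hpsi _ wd.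
    have pp : rn (p - p) < s by rewrite subrr rn0.
    have := injFp _ _ h1 pp h2; set c := psi _.
    rewrite -addrA -[RHS]addr0 => /addrI E.
    have := congr1 (fun m : 'rV[C]_n.+1 => m 0 i) E.
    rewrite /= !mxE eqxx /= eq_sym (negbTE k'i) mulr0 add0r => /eqP.
    rewrite mulf_eq0 (negbTE vi) orbF => /eqP c0.
    have := congr1 (fun m : 'rV[C]_n.+1 => m 0 k') E.
    rewrite /= !mxE !eqxx /= c0 mul0r addr0 mulr1 => /(congr1 (@complex.Re R)) /= t00.
    by rewrite t00 ltxx in t0.
  (* In dimension one the graph is a single point, and the one-variable theorem takes over. *)
  exfalso; clear - R n0 r0 dF injF Fa.
  move: F a dF injF Fa; rewrite n0 => F a dF injF Fa.
  pose u : 'rV[C]_1 := const_mx 1.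
  have ru : rn u <= 1 by apply: rn_rV_le => // j; rewrite mxE rn1.
  have inb (z : C) : rn (z - 0) < r -> rn (a + z *: u - a) < r.
    rewrite subr0 addrC addKr rnZ; apply: le_lt_trans.
    by rewrite -[leRHS]mulr1 ler_wpM2l ?rn_ge0.
  have dl (z : C) : rn (z - 0) < r -> differentiable (fun z : C => F (a + z *: u) 0 0) z /\
      cder (fun z : C => F (a + z *: u) 0 0) z = ('d F (a + z *: u) u) 0 0.
    move=> /inb/dF dFz; have [c1 c2] := coord_diff 0 dFz.
    by have [l1 l2] := line_diff c1; rewrite l2 c2.
  have := @univalent_derivative_neq0 R (fun z : C => F (a + z *: u) 0 0) 0 r r0
    (fun z h => (dl z h).1).
  have z0 : rn ((0 : C) - 0) < r by rewrite subrr rn0.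
  have [_ ->] := dl 0 z0; rewrite scale0r addr0 Fa mxE eqxx => H; suff : false by [].
  apply: H => z w zr wr E.
  have E' : F (a + z *: u) = F (a + w *: u).
    by apply/rowP => j; rewrite (ord1 j).
  have := injF _ _ (inb z zr) (inb w wr) E' => /addrI /(congr1 (fun m : 'rV_1 => m 0 0)).
  by rewrite /= !mxE !mulr1.
- exact: (univalent_slice IH r0 uF hv0).
Qed.

End CriticalSet.

(** * Openness of univalent maps and holomorphy of the inverse *)

Section Inverse.
Context {R : realType}.
Local Notation C := R[i].

Lemma compact_rV_ball n (a : 'rV[C]_n) (r : R) : compact [set y : 'rV[C]_n | rn (y - a) <= r].
Proof.
have [r0|r0] := ltP r 0.
  suff -> : [set y : 'rV[C]_n | rn (y - a) <= r] = set0 by exact: compact0.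
  apply/seteqP; split => y //= yr; have := rn_ge0 (y - a); lra.
have := @rV_compact C n (fun i => [set z : C | rn (z - a 0 i) <= r])
  (fun i => @compact_cdisk R (a 0 i) r).
congr compact; apply/seteqP; split => y /= yr.
- apply: rn_rV_le => // j; by have := yr j; rewrite !mxE.
- by move=> i; apply: le_trans yr; have := rn_coord (y - a) i; rewrite !mxE.
Qed.

Lemma diff_onto n (F : 'rV[C]_n -> 'rV[C]_n) x : (forall v, 'd F x v = 0 -> v = 0) ->
  exists T : 'M[C]_n, forall v, 'd F x v *m T = v /\ 'd F x (v *m T) = v.
Proof.
move=> inj; pose J : 'M[C]_n := lin1_mx ('d F x).
have JE v : v *m J = 'd F x v := mul_rV_lin1 ('d F x) v.
have uJ : J \in unitmx.
  rewrite unitmxE unitfE; apply/negP => /det0P [v v0]; rewrite JE => /inj v00.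
  by rewrite v00 eqxx in v0.
by exists (invmx J) => v; rewrite -!JE mulmxK // mulmxKV.
Qed.

Lemma compact_min (U : normedModType C) (A : set U) (f : U -> R) : A !=set0 -> compact A ->
  (forall x, A x -> {for x, continuous f}) ->
  exists2 x, A x & forall y, A y -> f x <= f y.
Proof.
move=> A0 cA cf; have [|x /set_mem xA hx] := compact_EVT_min A0 cA (f := f).
  by apply: continuous_in_subspaceT => y /set_mem; exact: cf.
by exists x => // y /mem_set; exact: hx.
Qed.

(** Here [N] is the residual and [W] the length of a Newton step, damped by [t]. The step gains
    [t * N], and the error [E] costs at most half of that. *)
Lemma damped_step_lt (N W t E : R) : 0 < N -> 0 < t -> 0 <= W ->
  E <= N / 2 / (W + 1) * (t * W) -> (1 - t) * N + E < N.
Proof.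
move=> N0 t0 W0; have W1 : 0 < W + 1 by rewrite ltr_wpDl.
have : N / 2 / (W + 1) * (t * W) <= N / 2 * t.
  have -> : N / 2 / (W + 1) * (t * W) = (N / 2 * t) * (W / (W + 1)).
    by field; rewrite gt_eqF.
  rewrite ler_piMr ?mulr_ge0 ?divr_ge0 ?(ltW N0) ?(ltW t0) // ler_pdivrMr // mul1r; lra.
have : 0 < N * t by rewrite mulr_gt0.
lra.
Qed.

(** A minimum of [rn (F z - y)] over the closed ball is interior for y near [F x]; there the
    differential is invertible by [osgood], and a positive residual would be lowered by a damped
    Newton step. *)
Lemma local_open n (F : 'rV[C]_n -> 'rV[C]_n) x (r : R) : 0 < r ->
  (forall y, rn (y - x) <= r -> differentiable F y) ->
  (forall y z, rn (y - x) <= r -> rn (z - x) <= r -> F y = F z -> y = z) ->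
  exists2 e : R, 0 < e & forall y, rn (y - F x) < e -> exists2 z, rn (z - x) < r & F z = y.
Proof.
move=> r0 dF injF.
have xx : rn (x - x) <= r by rewrite subrr rn0 ltW.
have onto z : rn (z - x) < r -> exists T : 'M[C]_n, forall v, 'd F z v *m T = v /\ 'd F z (v *m T) = v.
  move=> zr; apply: diff_onto; apply: (@osgood R n F z (r - rn (z - x))); first by rewrite subr_gt0.
  have inb y : rn (y - z) < r - rn (z - x) -> rn (y - x) <= r.
    by move=> yz; have := rnDB y z x; lra.
  by split => [y /inb|y w /inb h1 /inb h2]; [exact: dF | exact: injF].
have cFy y z : rn (z - x) <= r -> {for z, continuous (fun z => rn (F z - y))}.
  move=> zr; refine (@continuous_comp _ _ _ (fun z => F z - y) (fun w : 'rV[C]_n => rn w) z _ (@rn_continuous _ _ _)).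
  exact: (contB (df_cont (dF z zr)) (cont_cst _ _)).
pose S := [set y : 'rV[C]_n | rn (y - x) <= r] `&` [set y | r <= rn (y - x)].
have cS : compact S.
  apply: compact_closedI; first exact: compact_rV_ball.
  rewrite -(setCK [set z : 'rV[C]_n | _]); apply: open_closedC.
  apply/open_rnP => z /= /negP; rewrite -ltNge => hz.
  exists (r - rn (z - x)); first by rewrite subr_gt0.
  move=> y hy; apply/negP; rewrite -ltNge.
  have := rnDB y z x; lra.
have [m m0 hm] : exists2 m : R, 0 < m & forall z, rn (z - x) = r -> m <= rn (F z - F x).
  have [S0|S0] := pselect (S !=set0); last first.
    by exists 1 => // z zr; exfalso; apply: S0; exists z; split; rewrite /= zr.
  have [z [zr1 zr2] hz] := compact_min S0 cS (fun z h => cFy (F x) z h.1).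
  exists (rn (F z - F x)).
    rewrite rn_gt0 subr_eq0; apply/eqP => /(injF _ _ zr1 xx) zx.
    by move: zr2; rewrite /= zx subrr rn0; lra.
  by move=> y yr; apply: hz; split; rewrite /= yr.
(* On the sphere the residual exceeds [2 * m / 3], while at the center it is below [m / 3]. *)
exists (m / 3); first by rewrite divr_gt0.
move=> y hy.
have B0 : [set y : 'rV[C]_n | rn (y - x) <= r] !=set0 by exists x.
have [z zr hz] := compact_min B0 (@compact_rV_ball n x r) (fun z h => cFy y z h).
have hzx := hz x xx.
have zr' : rn (z - x) < r.
  rewrite lt_neqAle zr andbT; apply/eqP => zE.
  have := hm z zE; have := rnDB (F z) y (F x).
  by rewrite (rnBC (F x)) in hzx; move: hzx hy {hm hz cFy}; lra.
exists z => //; apply/eqP; rewrite -subr_eq0; apply/eqP; apply: contrapT => /eqP nz.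
have N0 : 0 < rn (F z - y) by rewrite rn_gt0.
have [T hT] := onto z zr'.
pose w := - ((F z - y) *m T).
have dw : 'd F z w = - (F z - y) by rewrite /w linearN (hT _).2.
have w1 : 0 < rn w + 1 by rewrite ltr_wpDl ?rn_ge0.
have [d d0 hd] := diff_rnP (dF z zr) (divr_gt0 (divr_gt0 N0 (ltr0Sn _ 1)) w1).
have dr : 0 < Num.min (d / 2) (r - rn (z - x)).
  by rewrite lt_min divr_gt0 // subr_gt0.
have [t [t0 t1 tw]] := small_multiple (rn w) ltr01 dr.
rewrite le_min in tw; have /andP[tw1 tw2] := tw.
have rtw : rn (t%:C *: w) = t * rn w by rewrite rnZ rn_real gtr0_norm.
have inb : rn (z + t%:C *: w - x) <= r.
  by apply: le_trans (rnDB _ z _) _; rewrite [z + _ - z]addrAC subrr add0r rtw mulrC -lerBrDr.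
have := hz _ inb; apply/negP; rewrite -ltNge.
have twd : rn (t%:C *: w) < d by rewrite rtw mulrC (le_lt_trans tw1) // ltr_pdivrMr // ltr_pMr // ltr1n.
have := hd _ twd; rewrite linearZ /= dw rtw => hrem.
have -> : F (z + t%:C *: w) - y = (1 - t)%:C *: (F z - y)
    + (F (z + t%:C *: w) - F z - t%:C *: - (F z - y)).
  have alg (N W : 'rV[C]_n) (u : C) : W + N = (1 - u) *: N + (W - u *: - N).
    by rewrite scalerBl scale1r scalerN opprK addrACA addNr addr0 addrC.
  by rewrite -(subrKA (F z)) rmorphB rmorph1; exact: alg.
apply: le_lt_trans (rnD _ _) _; rewrite rnZ rn_real ger0_norm ?subr_ge0 //.
exact: damped_step_lt N0 t0 (rn_ge0 w) hrem.
Qed.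

(** Continuity of [g] comes from [local_open] applied to small balls about [g y], injectivity
    identifying the preimage found there with [g z]; [inverse_differentiable] does the rest. *)
Lemma inverse_holomorphic n (F g : 'rV[C]_n -> 'rV[C]_n) (X V : set 'rV[C]_n) :
  open X -> (forall x, X x -> differentiable F x) -> set_inj X F ->
  open V -> (forall y, V y -> X (g y) /\ F (g y) = y) ->
  forall y, V y -> differentiable g y.
Proof.
move=> oX dF injF oV gV y Vy; have [Xg Fg] := gV y Vy.
have [r r0 hr] := (open_rnP _).1 oX _ Xg.
have inj u v : rn (u - g y) < r -> rn (v - g y) < r -> F u = F v -> u = v.
  by move=> /hr Xu /hr Xv; apply: injF; rewrite inE.
have dFr u : rn (u - g y) < r -> differentiable F u by move=> /hr; exact: dF.
have [T hT] := diff_onto (osgood r0 (conj dFr inj)).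
have [B B0 hB] := mulmx_bounded T.
have [d d0 hd] := (open_rnP _).1 oV _ Vy.
apply: (@inverse_differentiable R _ _ F g y (fun k => k *m T) B) => //.
- exact: dF.
- apply/cont_rnP => e e0.
  have r2 : 0 < r / 2 by rewrite divr_gt0.
  have [s [s0 se sr]] := common_lower_bound e0 r2.
  have ins u : rn (u - g y) <= s -> rn (u - g y) < r by lra.
  have [e1 e10 he1] := @local_open n F (g y) s s0 (fun u h => dFr u (ins u h))
    (fun u v hu hv => inj u v (ins u hu) (ins v hv)).
  have [e2 [e20 e21 e22]] := common_lower_bound e10 d0.
  exists e2 => // z zy; have Vz := hd z (lt_le_trans zy e22).
  have [Xz Fz] := gV z Vz.
  have [|u us Fu] := he1 z; first by rewrite Fg; exact: lt_le_trans zy e21.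
  suff -> : g z = u by exact: lt_le_trans us se.
  apply: injF; rewrite ?inE //; last by rewrite Fz Fu.
  by apply: hr; apply: ins; exact: ltW.
- by move=> a u v; rewrite mulmxDl scalemxAl.
- by move=> h; have [] := hT h.
- by exists d => // z /hd /gV [].
Qed.

End Inverse.

(** * Bounded extension across two vanishing real parts *)

Section Extension.
Context {R : realType}.
Local Notation C := R[i].

Definition coord_imag n (i j : 'I_n) : set 'rV[C]_n :=
  [set z | complex.Re (z 0 i) = 0 /\ complex.Re (z 0 j) = 0].

Definition parabola n (i j : 'I_n) (sg : R) (z : C) : 'rV[C]_n :=
  z *: delta_mx 0 i + (sg%:C * (z * z)) *: delta_mx 0 j.

Lemma parabola_i n (i j : 'I_n) sg z : i != j -> parabola i j sg z 0 i = z.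
Proof. by move=> ij; rewrite !mxE !eqxx /= (negbTE ij) mulr1 mulr0 addr0. Qed.

Lemma parabola_j n (i j : 'I_n) sg z : i != j -> parabola i j sg z 0 j = sg%:C * (z * z).
Proof. by move=> ij; rewrite !mxE !eqxx /= eq_sym (negbTE ij) mulr0 mulr1 add0r. Qed.

Lemma rn_delta n (i : 'I_n) : rn (delta_mx 0 i : 'rV[C]_n) <= 1.
Proof.
by apply: rn_rV_le => // j; rewrite mxE eqxx /=; case: eqP => _; rewrite ?rn1 ?rn0.
Qed.

Lemma rn_parabola n (i j : 'I_n) sg z : `|sg| = 1 -> rn (parabola i j sg z) <= rn z + rn z ^+ 2.
Proof.
move=> sg1; apply: le_trans (rnD _ _) _; rewrite !rnZ ?rnM rn_real sg1 mul1r -expr2.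
have := ler_wpM2l (rn_ge0 z) (rn_delta i).
have := ler_wpM2l (exprn_ge0 2 (rn_ge0 z)) (rn_delta j).
lra.
Qed.

Lemma parabola_diff n (i j : 'I_n) sg (y : 'rV[C]_n) z :
  differentiable (fun z => y + parabola i j sg z) z.
Proof.
apply: (dfD (df_cst _ _)); apply: dfD; first by have [] := diff_scalelE (delta_mx 0 i : 'rV[C]_n) (df_id z).
have d2 : differentiable (fun z : C => sg%:C * (z * z)) z.
  exact: (dfM (df_cst _ _) (dfM (df_id _) (df_id _))).
by have [] := diff_scalelE (delta_mx 0 j : 'rV[C]_n) d2.
Qed.

Lemma parabola_coord_imag n (i j : 'I_n) sg (y : 'rV[C]_n) z : i != j ->
  coord_imag i j (y + parabola i j sg z) ->
  complex.Re z = - complex.Re (y 0 i) /\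
  sg * (complex.Re z ^+ 2 - complex.Im z ^+ 2) = - complex.Re (y 0 j).
Proof.
move=> ij; rewrite /coord_imag /= ![(y + _) 0 _]mxE parabola_i // parabola_j //.
by rewrite !cReD cReZ cReM => -[h1 h2]; split; lra.
Qed.

Definition disk_mean n (h : 'rV[C]_n -> C) (i j : 'I_n) sg (rho : R) (y : 'rV[C]_n) : C :=
  mean (fun t => h (y + parabola i j sg (rho%:C * ce t))).

(* The disk {y + parabola z : |z| <= rho} has its boundary off coord_imag for all y
   near w, and lies entirely off it when sg Re y_j < - (Re y_i)^2. *)
Lemma disk_mean_extends n (h : 'rV[C]_n -> C) (i j : 'I_n) sg w (r rho eta : R) :
  i != j -> sg = 1 \/ sg = -1 -> coord_imag i j w ->
  0 < rho -> rho + rho ^+ 2 <= r / 2 -> 0 < eta -> eta <= 1 -> eta <= r / 2 ->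
  3 * eta < rho ^+ 2 ->
  (forall y, rn (y - w) < r -> ~ coord_imag i j y -> differentiable h y /\ rn (h y) <= 1) ->
  forall y, rn (y - w) < eta -> differentiable (disk_mean h i j sg rho) y /\
    (sg * complex.Re (y 0 j) < - complex.Re (y 0 i) ^+ 2 -> disk_mean h i j sg rho y = h y).
Proof.
move=> ij sgE [wi wj] rho0 rhor eta0 eta1 etar eta_rho hh.
have sg1 : `|sg| = 1 by case: sgE => ->; rewrite ?normrN normr1.
have sg2 : sg ^+ 2 = 1 by case: sgE => ->; rewrite ?sqrrN expr1n.
have inr y z : rn (y - w) < eta -> rn z <= rho -> rn (y + parabola i j sg z - w) < r.
  move=> yw zr; rewrite addrAC; apply: le_lt_trans (rnD _ _) _.
  have := rn_parabola i j z sg1.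
  have : rn z ^+ 2 <= rho ^+ 2 by rewrite lerXn2r ?nnegrE ?rn_ge0 ?(ltW rho0).
  lra.
have re_small y (k : 'I_n) : rn (y - w) < eta -> complex.Re (w 0 k) = 0 ->
    - eta < complex.Re (y 0 k) < eta.
  move=> yw wk; rewrite -ltr_norml; apply: le_lt_trans yw.
  apply: le_trans (rn_coord (y - w) k); rewrite !mxE; apply: le_trans (Re_le_rn _).
  by rewrite cReB wk subr0.
(* On the boundary, membership forces [s ^ 2 <= eta] and [u ^ 2 < 2 * eta], against
   [s ^ 2 + u ^ 2 = rho ^ 2]; this is the origin of [3 * eta < rho ^ 2]. *)
have off y t : rn (y - w) < eta -> ~ coord_imag i j (y + parabola i j sg (rho%:C * ce t)).
  move=> yw /(parabola_coord_imag ij) [h1 h2].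
  have := rn_sqr (rho%:C * ce t); rewrite rn_circle ?(ltW rho0) //.
  set s := complex.Re _ in h1 h2 *; set u := complex.Im _ in h2 *.
  have /andP[a1 a2] := re_small y i yw wi; have /andP[b1 b2] := re_small y j yw wj.
  move: h1 h2 a1 a2 b1 b2; set xi := complex.Re _; set xj := complex.Re _.
  move=> h1 h2 a1 a2 b1 b2 h3.
  have s2 : s ^+ 2 <= eta.
    rewrite h1 sqrrN; have : 0 <= (eta - xi) * (eta + xi) by apply: mulr_ge0; lra.
    nra.
  have : s ^+ 2 - u ^+ 2 = - (sg * xj).
    by rewrite -[LHS]mul1r -sg2 expr2 -mulrA h2 mulrN.
  have : sg * xj < eta by case: sgE => ->; lra.
  lra.
move=> y yw; split.
  apply: (@mean_differentiable R _ (fun y t => h (y + parabola i j sg (rho%:C * ce t))) y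
     (eta - rn (y - w)) 1).
  - by rewrite subr_gt0.
  - move=> z t zy; have zw : rn (z - w) < eta by have := rnDB z y w; lra.
    have rc : rn (rho%:C * ce t : C) <= rho by rewrite rn_circle // ltW.
    have [d1 _] := hh _ (inr _ _ zw rc) (off z t zw).
    exact: (@df_comp _ _ _ _ (fun z => z + parabola i j sg (rho%:C * ce t)) h z
       (dfD (df_id _) (df_cst _ _)) d1).
  - move=> z t zy; have zw : rn (z - w) < eta by have := rnDB z y w; lra.
    have rc : rn (rho%:C * ce t : C) <= rho by rewrite rn_circle // ltW.
    by have [] := hh _ (inr _ _ zw rc) (off z t zw).
  - move=> z t zy; have zw : rn (z - w) < eta by have := rnDB z y w; lra.
    have rc : rn (rho%:C * ce t : C) <= rho by rewrite rn_circle // ltW.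
    have [d1 _] := hh _ (inr _ _ zw rc) (off z t zw).
    refine (@continuous_comp _ _ _ (fun t => rho%:C * ce t)
      (fun u => h (z + parabola i j sg u)) t _ _).
      exact: (contMl _ (@ce_continuous R t)).
    exact: (df_cont (df_comp (parabola_diff i j sg z _) d1)).
move=> hlt.
have dl (z : C) : rn (z - 0) <= rho -> differentiable (fun z => h (y + parabola i j sg z)) z.
  rewrite subr0 => zr; have [|d1 _] := hh _ (inr _ _ yw zr).
    move=> /(parabola_coord_imag ij) [h1 h2].
    move: h1 h2 hlt; set s := complex.Re z; set u := complex.Im z.
    set xi := complex.Re _; set xj := complex.Re _ => h1 h2 hlt.
    have : s ^+ 2 - u ^+ 2 = - (sg * xj).
      by rewrite -[LHS]mul1r -sg2 expr2 -mulrA h2 mulrN.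
    have -> : s ^+ 2 = xi ^+ 2 by rewrite h1 sqrrN.
    have := sqr_ge0 u; lra.
  exact: (df_comp (parabola_diff i j sg y _) d1).
have z0 : rn ((0 : C) - 0) <= rho by rewrite subrr rn0 ltW.
have := mean_value rho0 (df_cont (dl 0 z0)) (fun z _ h => dl z h).
have -> : parabola i j sg 0 = 0 by rewrite /parabola mul0r mulr0 !scale0r addr0.
rewrite addr0 => <-; apply: mean_eq => t _.
by rewrite add0r.
Qed.

Lemma identity_ball (U : normedModType C) (f : U -> C) w q (eta d : R) : 0 < d ->
  (forall y, rn (y - w) < eta -> differentiable f y) -> rn (q - w) < eta / 4 ->
  (forall y, rn (y - q) < d -> f y = 0) ->
  forall y, rn (y - w) < eta / 4 -> f y = 0.
Proof.
move=> d0 df qw fq y yw.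
pose v := y - q.
have vn : rn v < eta / 2 by rewrite /v; have := rnDB y w q; rewrite (rnBC w q); lra.
have v1 : 0 < rn v + 1 by rewrite ltr_wpDl ?rn_ge0.
(* Any radius above 1 reaches y from q; this one stays in the ball, as
   [eta / 4 + 6 / 5 * (eta / 2) < eta]. *)
have r0 : 0 < 6 / 5 :> R by rewrite divr_gt0.
have dl (z : C) : rn (z - 0) <= 6 / 5 -> differentiable (fun z : C => f (q + z *: v)) z.
  rewrite subr0 => zr; have [] // := @line_diff R U f q v z; apply: df.
  rewrite addrAC; apply: le_lt_trans (rnD _ _) _; rewrite rnZ.
  by have := rn_ge0 (q - w); have := ler_wpM2r (rn_ge0 v) zr; lra.
have := identity_disk r0 (divr_gt0 d0 v1) dl _ (z := 1).
rewrite subr0 rn1 scale1r /v (addrC q) subrK; apply; last by lra.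
move=> z; rewrite subr0 ltr_pdivlMr // => zd; apply: fq; rewrite addrC addKr rnZ.
by apply: le_lt_trans zd; rewrite ler_wpM2l ?rn_ge0 // lerDl.
Qed.

(** With d = [eta / 16], near the point q with real parts [- tau * d] and [- sg * d] in coordinates
    [i] and [j], both disks avoid the set because [d ^ 2 < d], so both means equal [h]. The identity
    theorem spreads this to the ball. *)
Lemma disk_means_agree n (h : 'rV[C]_n -> C) (i j : 'I_n) sg tau w (r rho eta : R) :
  i != j -> sg = 1 \/ sg = -1 -> tau = 1 \/ tau = -1 -> coord_imag i j w ->
  0 < rho -> rho + rho ^+ 2 <= r / 2 -> 0 < eta -> eta <= 1 -> eta <= r / 2 ->
  3 * eta < rho ^+ 2 ->
  (forall y, rn (y - w) < r -> ~ coord_imag i j y -> differentiable h y /\ rn (h y) <= 1) ->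
  forall y, rn (y - w) < eta / 4 -> disk_mean h i j sg rho y = disk_mean h j i tau rho y.
Proof.
move=> ij sgE tauE [wi wj] rho0 rhor eta0 eta1 etar eta_rho hh.
have hh' y : rn (y - w) < r -> ~ coord_imag j i y -> differentiable h y /\ rn (h y) <= 1.
  by move=> yr yE; apply: hh => // -[e1 e2]; apply: yE.
have ji : j != i by rewrite eq_sym.
have H1 := disk_mean_extends ij sgE (conj wi wj) rho0 rhor eta0 eta1 etar eta_rho hh.
have H2 := disk_mean_extends ji tauE (conj wj wi) rho0 rhor eta0 eta1 etar eta_rho hh'.
pose d := eta / 16.
have d0 : 0 < d by rewrite divr_gt0.
pose q := w + ((- tau * d)%:C *: delta_mx 0 i + (- sg * d)%:C *: delta_mx 0 j).
have tau1 : `|tau| = 1 by case: tauE => ->; rewrite ?normrN normr1.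
have sg1 : `|sg| = 1 by case: sgE => ->; rewrite ?normrN normr1.
have qi : q 0 i = w 0 i + (- tau * d)%:C.
  by rewrite !mxE !eqxx /= (negbTE ij) mulr1 mulr0 addr0.
have qj : q 0 j = w 0 j + (- sg * d)%:C.
  by rewrite !mxE !eqxx /= eq_sym (negbTE ij) mulr0 mulr1 add0r.
have qw : rn (q - w) <= 2 * d.
  rewrite /q addrC addKr; apply: le_trans (rnD _ _) _; rewrite !rnZ !rn_real.
  have nd (c : R) : `|c| = 1 -> `|- c * d| = d.
    by move=> c1; rewrite normrM normrN c1 mul1r gtr0_norm.
  rewrite (nd _ tau1) (nd _ sg1).
  have := ler_wpM2l (ltW d0) (rn_delta i); have := ler_wpM2l (ltW d0) (rn_delta j); lra.
have d4 : 0 < d / 4 by rewrite divr_gt0.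
have eq0 := @identity_ball _ (fun y => disk_mean h i j sg rho y - disk_mean h j i tau rho y)
  w q eta (d / 4) d4.
move=> y yw; apply/eqP; rewrite -subr_eq0; apply/eqP; apply: eq0 yw.
- by move=> z zw; exact: (dfB (H1 z zw).1 (H2 z zw).1).
- by apply: le_lt_trans qw _; rewrite /d; lra.
- move=> z zq.
  have zw : rn (z - w) < eta by have := rnDB z q w; rewrite /d in d0 zq qw *; lra.
  have zi : `|complex.Re (z 0 i) + tau * d| < d / 4.
    apply: le_lt_trans zq; apply: le_trans (rn_coord (z - q) i).
    rewrite [(z - q) 0 i]mxE [(- q) 0 i]mxE qi; apply: le_trans (Re_le_rn _).
    by rewrite cReB cReD wi add0r /= mulNr opprK.
  have zj : `|complex.Re (z 0 j) + sg * d| < d / 4.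
    apply: le_lt_trans zq; apply: le_trans (rn_coord (z - q) j).
    rewrite [(z - q) 0 j]mxE [(- q) 0 j]mxE qj; apply: le_trans (Re_le_rn _).
    by rewrite cReB cReD wj add0r /= mulNr opprK.
  have d16 : d <= 1 / 16 by rewrite /d; lra.
  move: zi zj; rewrite !ltr_norml => /andP[i1 i2] /andP[j1 j2].
  rewrite (H1 z zw).2 ?(H2 z zw).2 ?subrr //.
    by case: tauE sgE i1 i2 j1 j2 => -> [] -> i1 i2 j1 j2; nra.
  by case: tauE sgE i1 i2 j1 j2 => -> [] -> i1 i2 j1 j2; nra.
Qed.

(** Four disk means coincide, and at a point off the set one of them returns [h]. With x and u the
    two real parts, either u > x^2, or u < -x^2, or x is nonzero and u^2 <= x^4 < |x|, which is the
    condition of a disk with [i] and [j] exchanged. *)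
Lemma local_extension n (h : 'rV[C]_n -> C) (i j : 'I_n) w (r : R) :
  i != j -> coord_imag i j w -> 0 < r ->
  (forall y, rn (y - w) < r -> ~ coord_imag i j y -> differentiable h y /\ rn (h y) <= 1) ->
  exists (eta : R) (H : 'rV[C]_n -> C), 0 < eta /\
    forall y, rn (y - w) < eta -> differentiable H y /\ (~ coord_imag i j y -> H y = h y).
Proof.
move=> ij wE r0 hh.
have [rho [rho0 rho1 rhor]] := @small_multiple R 1 (r / 2) 2 ltr01 (divr_gt0 r0 (ltr0Sn _ 1)).
have rhoh : rho + rho ^+ 2 <= r / 2 by nra.
have rho2 : 0 < rho ^+ 2 / 4 by rewrite divr_gt0 // exprn_gt0.
have [eta [eta0 eta_rho eta_r]] := common_lower_bound rho2 (divr_gt0 r0 (ltr0Sn _ 1)).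
have eta3 : 3 * eta < rho ^+ 2 by lra.
have eta1 : eta <= 1 by nra.
have hh' y : rn (y - w) < r -> ~ coord_imag j i y -> differentiable h y /\ rn (h y) <= 1.
  by move=> yr yE; apply: hh => // -[e1 e2]; apply: yE.
have ji : j != i by rewrite eq_sym.
have wE' : coord_imag j i w by case: wE.
have s1 : (1 : R) = 1 \/ (1 : R) = -1 by left.
have sN : (-1 : R) = 1 \/ (-1 : R) = -1 by right.
have A sg sgE tau tauE := disk_means_agree (sg := sg) (tau := tau) ij sgE tauE wE rho0 rhoh eta0 eta1 eta_r eta3 hh.
have E1 sg sgE := disk_mean_extends (sg := sg) ij sgE wE rho0 rhoh eta0 eta1 eta_r eta3 hh.
have E2 sg sgE := disk_mean_extends (sg := sg) ji sgE wE' rho0 rhoh eta0 eta1 eta_r eta3 hh'.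
exists (eta / 4), (disk_mean h i j 1 rho); split; first by rewrite divr_gt0.
move=> y yw; have yw' : rn (y - w) < eta by lra.
split; first by have [] := E1 1 s1 y yw'.
move=> yE.
have A1 := A 1 s1 1 s1 y yw; have A2 := A 1 s1 (-1) sN y yw; have A3 := A (-1) sN 1 s1 y yw.
have small (k : 'I_n) : complex.Re (w 0 k) = 0 -> `|complex.Re (y 0 k)| < 1 / 4.
  move=> wk; apply: (@le_lt_trans _ _ (rn (y - w))); last by lra.
  apply: le_trans (rn_coord (y - w) k); rewrite !mxE; apply: le_trans (Re_le_rn _).
  by rewrite cReB wk subr0.
have := small i wE.1; have := small j wE.2; rewrite !ltr_norml => /andP[j1 j2] /andP[i1 i2].
have := (E1 1 s1 y yw').2; have := (E1 (-1) sN y yw').2.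
have := (E2 1 s1 y yw').2; have := (E2 (-1) sN y yw').2.
rewrite -A2 -A1 A3 -A1 {A1 A2 A3}.
move: yE i1 i2 j1 j2; rewrite /coord_imag /=.
set x := complex.Re (y 0 i); set u := complex.Re (y 0 j) => yE i1 i2 j1 j2.
move=> e1 e2 e3 e4.
have [u1|u1] := ltP (x ^+ 2) u; first by apply: e3; lra.
have [u2|u2] := ltP (x ^+ 2) (- u); first by apply: e4; lra.
have u4 : u ^+ 2 <= x ^+ 2 * x ^+ 2 by nra.
have [x0|x0|x0] := ltgtP x 0.
- apply: e2; have : x ^+ 2 * x ^+ 2 <= x ^+ 2 * (1 / 16) by rewrite ler_wpM2l ?sqr_ge0 //; nra.
  nra.
- apply: e1; have : x ^+ 2 * x ^+ 2 <= x ^+ 2 * (1 / 16) by rewrite ler_wpM2l ?sqr_ge0 //; nra.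
  nra.
- by exfalso; apply: yE; split => //; move: u1 u2; rewrite x0 expr0n /=; lra.
Qed.

Lemma off_imag_dense n (i j : 'I_n) (z : 'rV[C]_n) (d : R) : 0 < d ->
  exists2 y, rn (y - z) < d & ~ coord_imag i j y.
Proof.
move=> d0; have [zi|zi] := eqVneq (complex.Re (z 0 i)) 0; last first.
  by exists z; [rewrite subrr rn0 | move=> [/eqP]; rewrite (negbTE zi)].
exists (z + (d / 2)%:C *: delta_mx 0 i).
  rewrite addrC addKr rnZ rn_real gtr0_norm ?divr_gt0 //.
  have d2 : 0 <= d / 2 by rewrite divr_ge0 // ltW.
  by have := ler_wpM2l d2 (rn_delta i); lra.
move=> [+ _]; rewrite !mxE !eqxx /= cReD zi add0r cReM /= mul0r subr0 mulr1.
by lra.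
Qed.

(** Taking [H] as the pointwise limit of [h] along the complement of [coord_imag], which is dense,
    makes the local extensions glue without any comparison on overlaps. Where there is no limit [H]
    is 0. *)
Theorem bounded_extension n (h : 'rV[C]_n -> C) (i j : 'I_n) (V K : set 'rV[C]_n) :
  i != j -> open V -> closed K -> K `<=` coord_imag i j ->
  (forall z, V z -> ~ K z -> differentiable h z /\ rn (h z) <= 1) ->
  exists H : 'rV[C]_n -> C, forall z, V z -> differentiable H z /\ (~ K z -> H z = h z).
Proof.
move=> ij oV cK KE hh.
have oVK : open (V `\` K) by rewrite setDE; apply: openI => //; exact: closed_openC.
pose is_lim z (c : C) := forall e : R, 0 < e -> exists2 d : R, 0 < d &
  forall y, rn (y - z) < d -> ~ coord_imag i j y -> rn (h y - c) < e.
have lim_uniq z c c' : is_lim z c -> is_lim z c' -> c = c'.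
  move=> h1 h2; apply/eqP; rewrite -subr_eq0; apply/eqP; apply: contrapT => /eqP cc.
  have e0 : 0 < rn (c - c') / 2 by rewrite divr_gt0 // rn_gt0.
  have [d1 d10 k1] := h1 _ e0; have [d2 d20 k2] := h2 _ e0.
  have [d [d0 dd1 dd2]] := common_lower_bound d10 d20.
  have [y yz yE] := off_imag_dense i j z d0.
  have := k1 y (lt_le_trans yz dd1) yE; have := k2 y (lt_le_trans yz dd2) yE.
  have := rnDB c (h y) c'; rewrite (rnBC c (h y)); lra.
pose H z := xget 0 (is_lim z).
have HE z c : is_lim z c -> H z = c.
  by move=> zc; apply: (lim_uniq z _ _ _ zc); apply: xgetPex; exists c.
have H_of_cont (G : 'rV[C]_n -> C) z (d : R) : 0 < d -> {for z, continuous G} ->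
    (forall y, rn (y - z) < d -> ~ coord_imag i j y -> G y = h y) -> H z = G z.
  move=> d0 /cont_rnP cG Gh; apply: HE => e e0; have [d1 d10 hd1] := cG e e0.
  have [d2 [d20 dd1 dd2]] := common_lower_bound d10 d0.
  exists d2 => // y yz yE; rewrite -Gh //; last exact: lt_le_trans dd2.
  by apply: hd1; exact: lt_le_trans dd1.
exists H => z Vz.
have Hh y : V y -> ~ K y -> H y = h y.
  move=> Vy nKy; apply: (H_of_cont h y 1) => //.
  by apply: df_cont; have [] := hh y Vy nKy.
split; last exact: Hh.
have [Kz|nKz] := pselect (K z); last first.
  have [d d0 hd] := (open_rnP _).1 oVK z (conj Vz nKz).
  have [dh _] := hh z Vz nKz.
  have [] // := @diff_near R _ _ h H z d d0 _ dh.
  by move=> y /hd [Vy nKy]; rewrite Hh.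
have [r r0 hr] := (open_rnP _).1 oV z Vz.
have [eta [G [eta0 hG]]] := @local_extension n h i j z r ij (KE z Kz) r0
  (fun y yr yE => hh y (hr y yr) (fun Ky => yE (KE y Ky))).
have zz : rn (z - z) < eta by rewrite subrr rn0.
have [] // := @diff_near R _ _ G H z eta eta0 _ (hG z zz).1.
move=> y yz; apply/esym; apply: (H_of_cont G y (eta - rn (y - z))).
- by rewrite subr_gt0.
- exact: df_cont (hG y yz).1.
- by move=> u uy uE; apply: (hG u _).2 => //; have := rnDB u y z; lra.
Qed.

End Extension.

(** * Automorphisms of the ball and the Schwarz lemma *)

Section Euclidean.
Context {R : realType}.
Local Notation C := R[i].

Lemma conjcD (x y : C) : (x + y)^* = x^* + y^*. Proof. exact: rmorphD. Qed.
Lemma conjcM (x y : C) : (x * y)^* = x^* * y^*. Proof. exact: rmorphM. Qed.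
Lemma conjcN (x : C) : (- x)^* = - x^*. Proof. exact: rmorphN. Qed.
Lemma conjcB (x y : C) : (x - y)^* = x^* - y^*. Proof. exact: rmorphB. Qed.

Lemma conjcV (x : C) : (x^-1)^* = (x^* )^-1. Proof. exact: fmorphV. Qed.
Lemma conjcR (x : R) : (x%:C)^* = x%:C :> C. Proof. exact: conjc_real. Qed.

Definition ip n (z w : 'rV[C]_n) : C := \sum_j z 0 j * (w 0 j)^*.

Section Dim.
Variable n : nat.
Implicit Types (a z w : 'rV[C]_n).

Lemma ipDl z1 z2 w : ip (z1 + z2) w = ip z1 w + ip z2 w.
Proof. by rewrite /ip -big_split; apply: eq_bigr => j _; rewrite mxE mulrDl. Qed.

Lemma ipZl (k : C) z w : ip (k *: z) w = k * ip z w.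
Proof. by rewrite /ip mulr_sumr; apply: eq_bigr => j _; rewrite mxE mulrA. Qed.

Lemma ipC z w : ip w z = (ip z w)^*.
Proof.
rewrite /ip; have -> : (\sum_j z 0 j * (w 0 j)^*)^* = \sum_j (z 0 j * (w 0 j)^*)^*.
  exact: rmorph_sum.
by apply: eq_bigr => j _; rewrite conjcM mulrC conjCK.
Qed.

Lemma ipDr z w1 w2 : ip z (w1 + w2) = ip z w1 + ip z w2.
Proof. by rewrite ipC ipDl conjcD -!ipC. Qed.

Lemma ipZr (k : C) z w : ip z (k *: w) = k^* * ip z w.
Proof. by rewrite ipC ipZl conjcM -ipC. Qed.

Lemma ipBl z1 z2 w : ip (z1 - z2) w = ip z1 w - ip z2 w.
Proof. by rewrite -scaleN1r ipDl ipZl mulN1r. Qed.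

Lemma ipBr z w1 w2 : ip z (w1 - w2) = ip z w1 - ip z w2.
Proof. by rewrite ipC ipBl conjcB -!ipC. Qed.

Lemma enorm_ge0 z : 0 <= enorm z. Proof. exact: sqrtr_ge0. Qed.

Lemma enorm_sqr z : enorm z ^+ 2 = \sum_j rn (z 0 j) ^+ 2.
Proof. by rewrite /enorm sqr_sqrtr //; apply: sumr_ge0 => j _; exact: sqr_ge0. Qed.

Lemma ip_self z : ip z z = (enorm z ^+ 2)%:C.
Proof.
by rewrite enorm_sqr rmorph_sum; apply: eq_bigr => j _; rewrite mulJ.
Qed.

Lemma enorm_ip z : enorm z ^+ 2 = complex.Re (ip z z).
Proof. by rewrite ip_self. Qed.

Lemma enormZ (k : C) z : enorm (k *: z) = rn k * enorm z.
Proof.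
apply/eqP; rewrite -(@eqrXn2 _ 2) ?mulr_ge0 ?enorm_ge0 ?rn_ge0 // exprMn !enorm_sqr.
by rewrite mulr_sumr; apply/eqP/eq_bigr => j _; rewrite mxE rnM exprMn.
Qed.

Lemma enorm0 : enorm (0 : 'rV[C]_n) = 0.
Proof. by rewrite -(scale0r (0 : 'rV[C]_n)) enormZ rn0 mul0r. Qed.

Lemma rn_coord_enorm z j : rn (z 0 j) <= enorm z.
Proof.
rewrite -(ler_pXn2r (n:=2)) ?nnegrE ?rn_ge0 ?enorm_ge0 // enorm_sqr (bigD1 j) //=.
by rewrite lerDl; apply: sumr_ge0 => i _; exact: sqr_ge0.
Qed.

Lemma rn_le_enorm z : rn z <= enorm z.
Proof. by apply: rn_rV_le => [|j]; [exact: enorm_ge0 | exact: rn_coord_enorm]. Qed.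

Lemma enorm_le_rn z : enorm z <= n%:R * rn z.
Proof.
rewrite -(ler_pXn2r (n:=2)) ?nnegrE ?mulr_ge0 ?rn_ge0 ?enorm_ge0 // enorm_sqr exprMn.
apply: (@le_trans _ _ (\sum_(j < n) rn z ^+ 2)).
  by apply: ler_sum => j _; apply: lerXn2r; rewrite ?nnegrE ?rn_ge0 ?rn_coord.
rewrite sumr_const card_ord -[leLHS]mulr_natl; apply: ler_wpM2r; first exact: sqr_ge0.
by rewrite -natrX ler_nat -mulnn; case: (n) => // m; rewrite leq_pmulr.
Qed.

Lemma enorm_eq0 z : enorm z = 0 -> z = 0.
Proof.
move=> h; apply/eqP; rewrite -rn_eq0 eq_le rn_ge0 andbT -h; exact: rn_le_enorm.
Qed.

Lemma cauchy_schwarz z w : rn (ip z w) <= enorm z * enorm w.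
Proof.
have [w0|w0] := eqVneq (enorm w) 0.
  rewrite (enorm_eq0 w0) /ip big1 ?rn0 ?mulr_ge0 ?enorm_ge0 // => j _.
  by rewrite mxE conjC0 mulr0.
have wp : 0 < enorm w by rewrite lt_def w0 enorm_ge0.
have wC : (enorm w ^+ 2)%:C != 0 :> C by rewrite -rn_gt0 rn_real gtr0_norm ?exprn_gt0.
pose k : C := - (ip z w / (enorm w ^+ 2)%:C).
have E : ip (z + k *: w) (z + k *: w) =
    (enorm z ^+ 2)%:C - (rn (ip z w) ^+ 2)%:C / (enorm w ^+ 2)%:C.
  have kE : k^* = - ((ip z w)^* / (enorm w ^+ 2)%:C).
    by rewrite /k conjcN conjcM conjcV conjcR.
  rewrite ipDl !ipDr !ipZl !ipZr !ip_self (ipC z w) kE -mulJ /k.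
  by field; rewrite -rn_gt0 rn_real gtr0_norm.
have := sqr_ge0 (enorm (z + k *: w)); rewrite enorm_ip E.
rewrite -fmorphV -rmorphM -rmorphB /= => h.
rewrite -(ler_pXn2r (n:=2)) ?nnegrE ?mulr_ge0 ?rn_ge0 ?enorm_ge0 // exprMn.
by rewrite -ler_pdivrMr ?exprn_gt0 // -subr_ge0.
Qed.

Lemma enormD z w : enorm (z + w) <= enorm z + enorm w.
Proof.
rewrite -(ler_pXn2r (n:=2)) ?nnegrE ?addr_ge0 ?enorm_ge0 // enorm_ip.
rewrite ipDl !ipDr !cReD -!enorm_ip (ipC z w).
have -> : complex.Re (ip z w)^* = complex.Re (ip z w) by case: (ip z w).
have := le_trans (ler_norm _) (le_trans (Re_le_rn _) (cauchy_schwarz z w)).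
by rewrite sqrrD; lra.
Qed.

Lemma enormN z : enorm (- z) = enorm z.
Proof. by rewrite -scaleN1r enormZ rnN rn1 mul1r. Qed.

Lemma enorm_continuous z : {for z, continuous (fun z : 'rV[C]_n => enorm z)}.
Proof.
apply/contCR_rnP => e e0; have n1 : 0 < n%:R + 1 :> R by rewrite ltr_wpDl.
exists (e / (n%:R + 1)); first by rewrite divr_gt0.
move=> y; rewrite ltr_pdivlMr // => hy.
have h : enorm (y - z) < e.
  apply: le_lt_trans (enorm_le_rn _) _; apply: le_lt_trans hy.
  by rewrite mulrC ler_wpM2l ?rn_ge0 // lerDl.
have := enormD (y - z) z; rewrite subrK.
have h' : enorm (z - y) < e by rewrite -enormN opprB.
have := enormD (z - y) y; rewrite subrK.
rewrite ltr_norml => h1 h2; apply/andP; split; lra.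
Qed.

Lemma eballE (r : R) z : eball 0 r z = (enorm z < r).
Proof. by rewrite /eball /= subr0. Qed.

Lemma open_enorm_lt (f : 'rV[C]_n -> R) (A : set 'rV[C]_n) (r : R) :
  open A -> (forall z, A z -> {for z, continuous f}) -> open (A `&` [set z | f z < r]).
Proof.
move=> oA cf; apply/open_rnP => z [Az fz].
have [d1 d10 h1] := (open_rnP _).1 oA z Az.
have e0 : 0 < r - f z by rewrite subr_gt0.
have [d2 d20 h2] := (contCR_rnP _ _).1 (cf z Az) _ e0.
have [d [d0 dd1 dd2]] := common_lower_bound d10 d20.
exists d => // y yz; split; first exact/h1/(lt_le_trans yz).
by have := h2 y (lt_le_trans yz dd2); rewrite ltr_norml /= => /andP[_]; lra.
Qed.

Lemma open_unit_ball : open (@unit_ball R n).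
Proof.
have -> : @unit_ball R n = setT `&` [set z | enorm z < 1].
  by rewrite setTI; apply/seteqP; split => z; rewrite /unit_ball eballE.
by apply: open_enorm_lt => [|z _]; [exact: openT | exact: enorm_continuous].
Qed.

Definition phi_s a : R := Num.sqrt (1 - enorm a ^+ 2).

(** The involutive automorphism [(a - P z - s Q z) / (1 - ip z a)], P being the projection onto the
    line of [a] and Q its complement. As [(1 - s) / |a|^2 = 1 / (1 + s)], this form does not divide
    by [|a|] and covers [a = 0]. *)
Definition phi a z : 'rV[C]_n :=
  (1 - ip z a)^-1 *: ((1 - ip z a / (1 + phi_s a)%:C) *: a - (phi_s a)%:C *: z).

Section Auto.
Variable a : 'rV[C]_n.
Hypothesis a1 : enorm a < 1.
Let s := phi_s a.

Lemma phi_s_props : 0 < s /\ enorm a ^+ 2 = 1 - s ^+ 2.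
Proof.
have h : enorm a ^+ 2 < 1 by rewrite expr_lt1 // enorm_ge0.
split; first by rewrite sqrtr_gt0 subr_gt0.
by rewrite [s ^+ 2]sqr_sqrtr ?subr_ge0 ?(ltW h) // opprB addrC subrK.
Qed.

Lemma phi_den z : enorm z < 1 -> 1 - ip z a != 0.
Proof.
move=> z1; rewrite subr_eq0; apply/eqP => h.
have := cauchy_schwarz z a; rewrite -h rn1 leNgt => /negP; apply.
have := enorm_ge0 z; have := enorm_ge0 a; move: a1 z1; nra.
Qed.

Lemma sC : s%:C != 0 :> C /\ (1 + s)%:C != 0 :> C.
Proof.
have [s0 _] := phi_s_props.
by split; rewrite -rn_gt0 rn_real gtr0_norm // addr_gt0.
Qed.

Lemma ip_phi z : enorm z < 1 -> ip (phi a z) a = ((enorm a ^+ 2)%:C - ip z a) / (1 - ip z a).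
Proof.
move=> /phi_den d0; have [s0 aE] := phi_s_props; have [c1 c2] := sC.
rewrite /phi ipZl ipBl !ipZl ip_self aE -/s.
rewrite rmorphD rmorph1 in c2.
by field; rewrite c2 d0.
Qed.

Lemma phiK z : enorm z < 1 -> phi a (phi a z) = z.
Proof.
move=> z1; have d0 := phi_den z1; have [s0 aE] := phi_s_props; have [c1 c2] := sC.
have E := ip_phi z1; rewrite {1}/phi E aE -/s {E}.
set p := ip z a in d0 *.
have d1 : 1 - ((1 - s ^+ 2)%:C - p) / (1 - p) = s%:C ^+ 2 / (1 - p).
  by rewrite rmorphB rmorph1 rmorphXn; field.
rewrite d1 /phi -/p -/s; apply/rowP => j; rewrite !mxE.
rewrite rmorphB rmorphXn rmorphD !rmorph1 /=.
rewrite rmorphD rmorph1 in c2.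
by field; rewrite c1 c2 d0.
Qed.

(** After expansion this is a rational identity in [ip z a], its conjugate and [ip z z]; it is why
    the automorphism preserves the ball. *)
Lemma phi_norm z : enorm z < 1 ->
  (1 - enorm (phi a z) ^+ 2) * rn (1 - ip z a) ^+ 2 = (1 - enorm a ^+ 2) * (1 - enorm z ^+ 2).
Proof.
move=> z1; have d0 := phi_den z1; have [s0 aE] := phi_s_props; have [c1 c2] := sC.
suff E : (1 - ip (phi a z) (phi a z)) * ((1 - ip z a) * (1 - ip z a)^* ) =
    (1 - (enorm a ^+ 2)%:C) * (1 - ip z z).
  move: E; rewrite !ip_self mulJ => E; apply: complexI.
  by rewrite [LHS]rmorphM [RHS]rmorphM !rmorphB !rmorph1.
have k1 : (s%:C)^* = s%:C :> C by rewrite conjcR.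
have k2 : ((1 + s)%:C)^* = (1 + s)%:C :> C by rewrite conjcR.
rewrite {1 2}/phi ipZl ipZr !ipBl !ipBr !ipZl !ipZr (ipC z a) ip_self aE -/s.
rewrite !(conjcB, conjcM, conjcN, conjcV, conjC1) k1 k2.
set p := ip z a in d0 *; set q := p^*; set N := ip z z.
have e0 : 1 - q != 0 by rewrite /q -conjC1 -conjcB conjC_eq0.
rewrite rmorphD rmorph1 in c2.
by field; rewrite c2 d0 e0.
Qed.

Lemma phi_ball z : enorm z < 1 -> enorm (phi a z) < 1.
Proof.
move=> z1; have := phi_norm z1.
have d0 : 0 < rn (1 - ip z a) ^+ 2 by rewrite exprn_gt0 // rn_gt0 phi_den.
have h1 : 0 < 1 - enorm a ^+ 2 by rewrite subr_gt0 expr_lt1 // enorm_ge0.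
have h2 : 0 < 1 - enorm z ^+ 2 by rewrite subr_gt0 expr_lt1 // enorm_ge0.
move=> E; have : 0 < 1 - enorm (phi a z) ^+ 2.
  by rewrite -(pmulr_lgt0 _ d0) E mulr_gt0.
by rewrite subr_gt0 expr_lt1 // enorm_ge0.
Qed.

Lemma phi_center : phi a a = 0.
Proof.
have [s0 aE] := phi_s_props; have [c1 c2] := sC.
have h : 1 - ip a a / (1 + s)%:C = s%:C.
  rewrite ip_self aE rmorphB rmorphXn rmorphD !rmorph1 /=.
  by field; rewrite -(rmorph1 (real_complex R)) -rmorphD.
by rewrite /phi h subrr scaler0.
Qed.

Lemma phi_zero : phi a 0 = a.
Proof.
have ip0 : ip 0 a = 0 by rewrite -(scale0r a) ipZl mul0r.
by rewrite /phi ip0 mul0r subr0 invr1 !scale1r scaler0 subr0.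
Qed.

Lemma ip_diff (w z : 'rV[C]_n) : differentiable (fun z => ip z w) z.
Proof.
by apply: df_sum => j; exact: (dfM (differentiable_coord _ _ _) (df_cst _ _)).
Qed.

Lemma phi_diff z : enorm z < 1 -> differentiable (phi a) z.
Proof.
move=> z1; apply: diff_of_coord => j.
have -> : (fun z => phi a z 0 j) = (fun z => (1 - ip z a)^-1 *
    ((1 - ip z a * (1 + s)%:C^-1) * a 0 j - s%:C * z 0 j)).
  by apply/funext => y; rewrite /phi !mxE.
have d1 := dfB (df_cst (1 : C) z) (ip_diff a z).
apply: dfM.
  by refine (@dfV _ _ (fun z => 1 - ip z a) z _ d1); exact: phi_den.
apply: dfB.
  refine (dfM _ (df_cst _ _)); refine (dfB (df_cst _ _) _).
  exact: (dfM (ip_diff a z) (df_cst _ _)).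
exact: (dfM (df_cst _ _) (differentiable_coord _ _ _)).
Qed.

End Auto.
End Dim.
End Euclidean.

(** * The Schwarz lemma on the ball and the Carathéodory distance *)

Section Invariants.
Context {R : realType}.
Local Notation C := R[i].

Lemma ball_schwarz n (f : 'rV[C]_n -> C) :
  (forall x, enorm x < 1 -> differentiable f x /\ rn (f x) <= 1) -> f 0 = 0 ->
  forall x, enorm x < 1 -> rn (f x) <= enorm x.
Proof.
move=> hf f0 x x1; have [->|x0] := eqVneq x 0; first by rewrite f0 rn0 enorm_ge0.
set t := enorm x in x1 *.
have t0 : 0 < t by rewrite lt_def enorm_ge0 andbT; apply: contra_neq x0 => /enorm_eq0.
rewrite leNgt; apply/negP => tN; set N := rn (f x) in tN.
have N0 : 0 < N := lt_trans t0 tN.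
have tN1 : t / N < 1 by rewrite ltr_pdivrMr // mul1r.
(* On the line through x, the disk of radius rho < 1 gives [N <= t / rho]; taking rho above [t / N]
   contradicts this. *)
have [rho [rho1 rhot rhoN]] : exists rho, [/\ rho < 1, t < rho & t / N < rho].
  have [h|h] := leP t (t / N).
    by exists ((1 + t / N) / 2); split; lra.
  by exists ((1 + t) / 2); split; lra.
have rho0 : 0 < rho := lt_trans t0 rhot.
pose u := t^-1%:C *: x.
have u1 : enorm u = 1.
  by rewrite enormZ rn_real gtr0_norm ?invr_gt0 // -/t mulVf // gt_eqF.
have zu (z : C) : enorm (0 + z *: u) = rn z by rewrite add0r enormZ u1 mulr1.
have dl (z : C) : rn (z - 0) <= rho -> differentiable (fun z : C => f (0 + z *: u)) z.
  rewrite subr0 => zr; have [|d1 _] := hf (0 + z *: u); first by rewrite zu; lra.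
  by have [] := line_diff d1.
have bl (z : C) : rn (z - 0) = rho -> rn (f (0 + z *: u)) <= 1.
  rewrite subr0 => zr; have [|//] := hf (0 + z *: u); first by rewrite zu; lra.
have fl0 : f (0 + 0 *: u) = 0 by rewrite scale0r addr0.
have := schwarz_disk rho0 ler01 dl fl0 bl (z := t%:C).
rewrite subr0 rn_real gtr0_norm // => /(_ (ltW rhot)).
have -> : 0 + t%:C *: u = x.
  by rewrite add0r scalerA -rmorphM mulfV ?gt_eqF // scale1r.
rewrite mul1r mulrC ler_pdivlMr // -/N => h.
by move: rhoN; rewrite ltr_pdivrMr // mulrC => /lt_le_trans /(_ h); rewrite ltxx.
Qed.

Lemma phi_schwarz n (f : 'rV[C]_n -> C) a : enorm a < 1 ->
  (forall x, enorm x < 1 -> differentiable f x /\ rn (f x) <= 1) -> f a = 0 ->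
  forall x, enorm x < 1 -> rn (f x) <= enorm (phi a x).
Proof.
move=> a1 hf fa x x1.
have hp y : enorm y < 1 -> differentiable (fun y => f (phi a y)) y /\ rn (f (phi a y)) <= 1.
  move=> y1; have [d1 b1] := hf _ (phi_ball a1 y1); split; last exact: b1.
  exact: (df_comp (phi_diff a1 y1) d1).
have := @ball_schwarz n (fun y => f (phi a y)) hp _ (phi a x) (phi_ball a1 x1).
by rewrite phiK //; apply; rewrite phi_zero.
Qed.

(** For [v = 0] the inverse of 0 is 0 and the value is 0; hence only norm at most 1 is claimed. *)
Definition unit_vector n (v : 'rV[C]_n) := (enorm v)^-1%:C *: v.

Lemma enorm_unit_vector n (v : 'rV[C]_n) : enorm (unit_vector v) <= 1.
Proof.
rewrite enormZ rn_real ger0_norm ?invr_ge0 ?enorm_ge0 //.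
by have [->|h] := eqVneq (enorm v) 0; [rewrite mulr0 | rewrite mulVf].
Qed.

Lemma ip_unit_vector n (v : 'rV[C]_n) : ip v (unit_vector v) = (enorm v)%:C.
Proof.
rewrite ipZr conjcR ip_self -rmorphM; congr (_ %:C).
have [->|h] := eqVneq (enorm v) 0; first by rewrite expr0n mulr0.
by rewrite expr2 mulKf.
Qed.

(** The scalar lemma, applied to the component of [F] along its own value at x. *)
Lemma phi_schwarz_vec n m (F : 'rV[C]_n -> 'rV[C]_m) a : enorm a < 1 ->
  (forall x, enorm x < 1 -> differentiable F x /\ enorm (F x) <= 1) -> F a = 0 ->
  forall x, enorm x < 1 -> enorm (F x) <= enorm (phi a x).
Proof.
move=> a1 hF Fa x x1; pose u := unit_vector (F x).
have hf y : enorm y < 1 -> differentiable (fun y => ip (F y) u) y /\ rn (ip (F y) u) <= 1.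
  move=> y1; have [d1 b1] := hF y y1; split.
    exact: (@df_comp _ _ _ _ F (fun z => ip z u) y d1 (ip_diff _ _)).
  apply: le_trans (cauchy_schwarz _ _) _; rewrite -[leRHS]mulr1.
  by apply: ler_pM; rewrite ?enorm_ge0 ?enorm_unit_vector.
have := phi_schwarz a1 hf _ x1; rewrite ip_unit_vector rn_real ger0_norm ?enorm_ge0 //.
by apply; rewrite Fa -(scale0r (0 : 'rV[C]_m)) ipZl mul0r.
Qed.

Lemma tanh_artanh (x : R) : 0 <= x < 1 -> tanh (artanh x) = x.
Proof.
move=> /andP[x0 x1]; rewrite /tanh /artanh.
have y0 : 0 < (1 + x) / (1 - x) by rewrite divr_gt0; lra.
set y := _ / _ in y0 *; pose u := expR (ln y / 2).
have u0 : 0 < u := expR_gt0 _.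
have u2 : u ^+ 2 = y.
  by rewrite -expRM_natl mulrC divfK ?pnatr_eq0 // lnK.
rewrite expRN -/u.
have -> : (u - u^-1) / (u + u^-1) = (u ^+ 2 - 1) / (u ^+ 2 + 1).
  by field; rewrite !gt_eqF ?addr_gt0 ?exprn_gt0.
rewrite u2 /y; field; apply/andP; split; apply/eqP; lra.
Qed.

Lemma artanh_lt (x r : R) : 0 <= x < 1 -> x < tanh r -> artanh x < r.
Proof.
move=> /andP[x0 x1]; rewrite /tanh /artanh expRN.
set u := expR r; have u0 : 0 < u := expR_gt0 _.
have -> : (u - u^-1) / (u + u^-1) = (u ^+ 2 - 1) / (u ^+ 2 + 1).
  by field; rewrite !gt_eqF ?addr_gt0 ?exprn_gt0.
rewrite ltr_pdivlMr ?addr_gt0 ?exprn_gt0 // => h.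
have y0 : 0 < (1 + x) / (1 - x) by rewrite divr_gt0; lra.
rewrite ltr_pdivrMr // -ltr_expR lnK // [r * 2]mulrC expRM_natl -/u ltr_pdivrMr; lra.
Qed.

Lemma ler_artanh (x y : R) : 0 <= x -> x <= y -> y < 1 -> artanh x <= artanh y.
Proof.
move=> x0 xy y1; rewrite /artanh ler_pM2r ?invr_gt0 //.
rewrite ler_ln ?posrE; [|by rewrite divr_gt0; lra..].
rewrite ler_pdivlMr; last lra.
rewrite mulrAC ler_pdivrMr; last lra.
nra.
Qed.

Lemma artanh_gt0 (x : R) : 0 < x < 1 -> 0 < artanh x.
Proof.
move=> /andP[x0 x1]; rewrite /artanh divr_gt0 // ln_gt0 // ltr_pdivlMr; lra.
Qed.

(** The competitor is the component of [phi a] along its value at [w]. *)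
Lemma caratheodory_ge n (X : set 'rV[C]_n) a w : X `<=` unit_ball n -> enorm a < 1 -> X w ->
  ((artanh (enorm (phi a w)))%:E <= caratheodory X a w)%E.
Proof.
move=> XB a1 Xw; apply: ereal_sup_ubound.
pose u := unit_vector (phi a w).
exists (fun x => ip (phi a x) u).
  split; last by rewrite /= phi_center // -(scale0r (0 : 'rV[C]_n)) ipZl mul0r.
  move=> x /XB; rewrite /unit_ball eballE => x1; split.
    exact: (@df_comp _ _ _ _ (phi a) (fun z => ip z u) x (phi_diff a1 x1) (ip_diff _ _)).
  rewrite /unit_disk /= rnc; apply: le_lt_trans (cauchy_schwarz _ _) _.
  apply: le_lt_trans (phi_ball a1 x1); rewrite -[leRHS]mulr1.
  by rewrite ler_wpM2l ?enorm_ge0 ?enorm_unit_vector.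
by rewrite rnc ip_unit_vector rn_real ger0_norm ?enorm_ge0.
Qed.

Lemma caratheodory_le n (X : set 'rV[C]_n) a w : enorm a < 1 -> enorm w < 1 ->
  (forall f, holo X unit_disk f -> f a = 0 -> rn (f w) <= enorm (phi a w)) ->
  (caratheodory X a w <= (artanh (enorm (phi a w)))%:E)%E.
Proof.
move=> a1 w1 h; apply: ge_ereal_sup => _ [f [hf fa] <-].
rewrite lee_fin rnc; apply: ler_artanh; [exact: rn_ge0 | exact: h | exact: phi_ball].
Qed.

Lemma caratheodory_unit_ball n (a w : 'rV[C]_n) : enorm a < 1 -> enorm w < 1 ->
  caratheodory (unit_ball n) a w = (artanh (enorm (phi a w)))%:E.
Proof.
move=> a1 w1; apply/eqP; rewrite eq_le; apply/andP; split.
  apply: caratheodory_le => // f hf fa; apply: phi_schwarz => // x x1.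
  have [|d1 b1] := hf x; first by rewrite /unit_ball eballE.
  by split; [exact: d1 | exact: ltW].
by apply: caratheodory_ge => //; rewrite /unit_ball eballE.
Qed.

Lemma caratheodory_dist_min n (K : set 'rV[C]_n) a w : enorm a < 1 ->
  K `<=` unit_ball n -> K w -> (forall y, K y -> enorm (phi a w) <= enorm (phi a y)) ->
  caratheodory_dist K a = enorm (phi a w).
Proof.
move=> a1 KB Kw hw; rewrite /caratheodory_dist /min_of.
have E y : K y -> etanh (caratheodory (unit_ball n) a y) = enorm (phi a y).
  move=> /KB; rewrite /unit_ball eballE => y1.
  rewrite caratheodory_unit_ball //= tanh_artanh // enorm_ge0 /=; exact: phi_ball.
have mw : ([set etanh (caratheodory (unit_ball n) a y) | y in K] `&`
    lbound [set etanh (caratheodory (unit_ball n) a y) | y in K]) (enorm (phi a w)).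
  split; first by exists w => //; exact: E.
  by move=> _ [y Ky <-]; rewrite E //; exact: hw.
case: (xgetPex 0 (ex_intro _ _ mw)).
set m := xget _ _ => mA mL; apply/eqP; rewrite eq_le.
by rewrite (mL _ mw.1) (mw.2 _ mA).
Qed.

End Invariants.

(** * The complement of K in the ball *)

Section Complement.
Context {R : realType}.
Local Notation C := R[i].

Lemma closed_coord_imag n (i j : 'I_n) : closed (@coord_imag R n i j).
Proof.
rewrite -(setCK (coord_imag i j)); apply: open_closedC.
apply/open_rnP => z /= nz.
have step (k : 'I_n) : complex.Re (z 0 k) != 0 -> exists2 e : R, 0 < e &
    forall y, rn (y - z) < e -> complex.Re (y 0 k) <> 0.
  move=> zk; exists `|complex.Re (z 0 k)|; first by rewrite normr_gt0.
  move=> y yz yk; move: yz; apply/negP; rewrite -leNgt rnBC.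
  apply: le_trans (rn_coord (z - y) k); rewrite !mxE; apply: le_trans (Re_le_rn _).
  by rewrite cReB yk subr0.
have [zi|/step[e e0 he]] := eqVneq (complex.Re (z 0 i)) 0; last first.
  by exists e => // y /he yi [].
have [zj|/step[e e0 he]] := eqVneq (complex.Re (z 0 j)) 0; last first.
  by exists e => // y /he yi [].
by case: nz.
Qed.

(** Components are extended one by one, which loses the Euclidean bound; it returns by density of
    the complement of [coord_imag] and continuity. *)
Lemma extend_map n m (f : 'rV[C]_n -> 'rV[C]_m) (i j : 'I_n) (V K : set 'rV[C]_n) :
  i != j -> open V -> closed K -> K `<=` coord_imag i j ->
  (forall z, V z -> ~ K z -> differentiable f z /\ enorm (f z) <= 1) ->
  exists F : 'rV[C]_n -> 'rV[C]_m,
    (forall z, V z -> differentiable F z /\ enorm (F z) <= 1) /\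
    (forall z, V z -> ~ K z -> F z = f z).
Proof.
move=> ij oV cK KE hf.
have /choice [H hH] : forall k : 'I_m, exists H : 'rV[C]_n -> C,
    forall z, V z -> differentiable H z /\ (~ K z -> H z = f z 0 k).
  move=> k; apply: (bounded_extension ij oV cK KE) => z Vz nKz.
  have [d1 b1] := hf z Vz nKz; have [d2 _] := coord_diff k d1.
  split; first exact: d2.
  exact: le_trans (rn_coord_enorm _ _) b1.
pose F z : 'rV[C]_m := \row_k H k z.
have Ff z : V z -> ~ K z -> F z = f z.
  by move=> Vz nKz; apply/rowP => k; rewrite mxE; have [_ ->] := hH k z Vz.
have dF z : V z -> differentiable F z.
  move=> Vz; apply: diff_of_coord => k.
  have -> : (fun y => F y 0 k) = H k by apply/funext => y; rewrite mxE.
  by have [] := hH k z Vz.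
exists F; split=> [z Vz|]; last exact: Ff.
split; first exact: dF.
rewrite leNgt; apply/negP => b1.
have e0 : 0 < enorm (F z) - 1 by rewrite subr_gt0.
have cF : {for z, continuous (fun y => enorm (F y))}.
  exact: (@continuous_comp _ _ _ F (fun w => enorm w) z (df_cont (dF z Vz)) (@enorm_continuous _ _ _)).
have [d1 d10 h1] := (contCR_rnP _ _).1 cF _ e0.
have [d2 d20 h2] := (open_rnP _).1 oV z Vz.
have [d [d0 dd1 dd2]] := common_lower_bound d10 d20.
have [y yz yE] := off_imag_dense i j z d0.
have nKy : ~ K y by move=> /KE.
have Vy := h2 y (lt_le_trans yz dd2).
have := h1 y (lt_le_trans yz dd1); rewrite (Ff y Vy nKy).
have [_ fy] := hf y Vy nKy.
by rewrite ltr_norml => /andP[]; lra.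
Qed.

Lemma eq_of_approx (U : normedModType C) (x y : U) :
  (forall e : R, 0 < e -> rn (x - y) < e) -> x = y.
Proof.
move=> h; apply/eqP; rewrite -subr_eq0; apply: contrapT => /negP xy.
by have := h (rn (x - y)); rewrite rn_gt0 => /(_ xy); rewrite ltxx.
Qed.

(** The relation [f (G y) = y] passes to the limit at [w] through points off [coord_imag]. It serves
    once with an extended map and its inverse, once with an extended inverse. *)
Lemma extended_section n (f G : 'rV[C]_n -> 'rV[C]_n) (i j : 'I_n) (w : 'rV[C]_n) (d : R) :
  0 < d -> {for w, continuous G} -> {for G w, continuous f} ->
  (forall y, rn (y - w) < d -> ~ coord_imag i j y -> f (G y) = y) -> f (G w) = w.
Proof.
move=> d0 cG cf fG; apply: eq_of_approx => e e0.
have e2 : 0 < e / 2 by rewrite divr_gt0.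
have cfG : {for w, continuous (fun y => f (G y))}.
  exact: (@continuous_comp _ _ _ G f w cG cf).
have [d1 d10 h1] := (cont_rnP _ _).1 cfG _ e2.
have [d2 [d20 dd1 dd2]] := common_lower_bound d10 d0.
have [d3 [d30 d32 d3e]] := common_lower_bound d20 e2.
have [y yw yE] := off_imag_dense i j w d30.
have := h1 y (lt_le_trans yw (le_trans d32 dd1)).
rewrite fG //; last exact: lt_le_trans yw (le_trans d32 dd2).
rewrite rnBC; have := rnDB (f (G w)) y w; lra.
Qed.

(* The disk w + z (e_i + I e_j) meets the set coord_imag only at its center. *)
Lemma strict_bound n m (G : 'rV[C]_n -> 'rV[C]_m) (i j : 'I_n) (w : 'rV[C]_n) (d : R) :
  i != j -> coord_imag i j w -> 0 < d ->
  (forall y, rn (y - w) < d -> differentiable G y) ->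
  (forall y, rn (y - w) < d -> ~ coord_imag i j y -> enorm (G y) < 1) ->
  enorm (G w) < 1.
Proof.
move=> ij [wi wj] d0 dG bG.
pose I : C := Complex 0 1.
have rnI : rn I = 1 by rewrite /rn normc_def /= expr0n add0r expr1n sqrtr1.
pose v : 'rV[C]_n := delta_mx 0 i + I *: delta_mx 0 j.
have v2 : rn v <= 2.
  apply: le_trans (rnD _ _) _; rewrite rnZ rnI mul1r.
  by have := rn_delta (R := R) i; have := rn_delta (R := R) j; lra.
pose rho := d / 4; have rho0 : 0 < rho by rewrite divr_gt0.
have inb (z : C) : rn z <= rho -> rn (w + z *: v - w) < d.
  rewrite addrC addKr rnZ => zr.
  have := ler_pM (rn_ge0 z) (rn_ge0 v) zr v2; rewrite /rho; lra.
have offC (c : C) : rn c = rho -> ~ coord_imag i j (w + c *: v).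
  have ei : (w + c *: v) 0 i = w 0 i + c.
    by rewrite !mxE !eqxx /= (negbTE ij) mulr0 addr0 mulr1.
  have ej : (w + c *: v) 0 j = w 0 j + c * I.
    by rewrite !mxE !eqxx /= eq_sym (negbTE ij) add0r mulr1.
  move=> cr; rewrite /coord_imag /= ei ej !cReD wi wj !add0r cReM /= mulr0 mulr1 sub0r.
  move=> [r0 i0]; have := rn_sqr c; rewrite cr r0.
  have -> : complex.Im c = 0 by lra.
  by rewrite expr0n addr0 => /eqP; rewrite sqrf_eq0 gt_eqF.
have off t : ~ coord_imag i j (w + (rho%:C * ce t) *: v).
  by apply: offC; rewrite rn_circle // ltW.
have rc t : rn (rho%:C * ce t : C) <= rho by rewrite rn_circle // ltW.
pose q t := enorm (G (w + (rho%:C * ce t) *: v)).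
have cq t : {for t, continuous q}.
  refine (@continuous_comp _ _ _ (fun t : R => G (w + (rho%:C * ce t) *: v)) (fun w => enorm w) t _ (@enorm_continuous _ _ _)).
  refine (@continuous_comp _ _ _ (fun t : R => w + (rho%:C * ce t) *: v) G t _ (df_cont (dG _ (inb _ (rc t))))).
  apply: contD; first exact: cont_cst.
  by apply: contZ; [apply: contMl; exact: ce_continuous | exact: cont_cst].
have [t0 t01 ht0] := @EVT_max R q 0 1 ler01 (continuous_subspaceT cq).
have q1 : q t0 < 1 by apply: bG; [exact: inb | exact: off].
set M := q t0 in q1 ht0.
rewrite ltNge; apply/negP => Gw.
have Gw0 : 0 < enorm (G w) by lra.
(* The mean value property of [p] gives [enorm (G w) ^ 2 <= M * enorm (G w)] with [M < 1], [M] being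
   the maximum of the norm of [G] on the circle. *)
pose p (z : C) := ip (G (w + z *: v)) (G w).
have dp (z : C) : rn (z - 0) <= rho -> differentiable p z.
  rewrite subr0 => zr; have dGz := dG _ (inb z zr).
  refine (@df_comp _ _ _ _ (fun z : C => G (w + z *: v)) (fun y => ip y (G w)) z _ (ip_diff _ _)).
  have d1 : differentiable (fun z : C => w + z *: v) z.
    by refine (dfD (df_cst _ _) _); have [] := diff_scalelE v (df_id z).
  exact: (df_comp d1 dGz).
have p0 : rn ((0 : C) - 0) <= rho by rewrite subrr rn0 ltW.
have := mean_value rho0 (df_cont (dp 0 p0)) (fun z _ h => dp z h).
rewrite /p scale0r addr0 ip_self => E.
have : complex.Re (cmean p 0 rho) <= M * enorm (G w).
  apply: mean_Re_le => [|t t01'].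
    apply: cont_circle; first exact: ltW.
    by move=> z zr; apply/df_cont/dp; rewrite zr.
  apply: le_trans (ler_norm _) (le_trans (Re_le_rn _) _).
  apply: le_trans (cauchy_schwarz _ _) _; rewrite add0r ler_wpM2r ?enorm_ge0 //.
  by apply: ht0; rewrite in_itv.
rewrite E /=; nra.
Qed.

Section Domain.
Variables (n : nat) (i j : 'I_n) (K : set 'rV[C]_n) (a w0 : 'rV[C]_n).
Hypotheses (ij : i != j) (cK : closed K) (KE : K `<=` coord_imag i j).
Hypotheses (KB : K `<=` unit_ball n) (Kw0 : K w0).
Hypotheses (a1 : enorm a < 1) (nKa : ~ K a).
Hypothesis w0_min : forall y, K y -> enorm (phi a w0) <= enorm (phi a y).

Let D : set 'rV[C]_n := unit_ball n `\` K.
Let d := enorm (phi a w0).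

Lemma in_domain x : D x <-> enorm x < 1 /\ ~ K x.
Proof. by rewrite /D /= /unit_ball eballE. Qed.

Lemma w0_ball : enorm w0 < 1.
Proof. by have := KB Kw0; rewrite /unit_ball eballE. Qed.

Lemma d_bounds : 0 < d < 1.
Proof.
apply/andP; split; last by apply: phi_ball => //; exact: w0_ball.
rewrite lt_def enorm_ge0 andbT; apply/eqP => d0; apply: nKa.
by rewrite -(phi_zero a) -(enorm_eq0 d0) phiK //; exact: w0_ball.
Qed.

Lemma open_domain : open D.
Proof.
by rewrite /D setDE; apply: openI; [exact: open_unit_ball | exact: closed_openC].
Qed.

Lemma phi_off_K x : enorm x < d -> D (phi a x).
Proof.
move=> xd; have /andP[_ d1] := d_bounds; have x1 := lt_trans xd d1.
apply/in_domain; split; first exact: phi_ball.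
by move=> /w0_min; rewrite phiK // leNgt xd.
Qed.

(** Bounded functions extend over [K], so passing from the ball to [D] gains no competitors for the
    Carathéodory distance. *)
Lemma domain_schwarz f : holo D unit_disk f -> f a = 0 ->
  forall w, D w -> rn (f w) <= enorm (phi a w).
Proof.
move=> hf fa w Dw; have [w1 nKw] := (in_domain w).1 Dw.
(* A scalar function is viewed as a map to rows of length 1, so that the vector versions apply. *)
pose f1 (z : 'rV[C]_n) : 'rV[C]_1 := const_mx (f z).
have f1E z : enorm (f1 z) = rn (f z).
  apply/eqP; rewrite -(@eqrXn2 _ 2) ?enorm_ge0 ?rn_ge0 // enorm_sqr big_ord1 mxE.
  by [].
have hf1 z : unit_ball n z -> ~ K z -> differentiable f1 z /\ enorm (f1 z) <= 1.
  move=> Bz nKz; have [d1 b1] := hf z (conj Bz nKz); split; last by rewrite f1E ltW.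
  apply: diff_of_coord => k.
  have -> : (fun y => f1 y 0 k) = f by apply/funext => y; rewrite mxE.
  exact: d1.
have [F [hF Ff]] := extend_map ij (@open_unit_ball R n) cK KE hf1.
have hF' x : enorm x < 1 -> differentiable F x /\ enorm (F x) <= 1.
  by move=> x1; apply: hF; rewrite /unit_ball eballE.
rewrite -f1E -Ff //; last by rewrite /unit_ball eballE.
apply: phi_schwarz_vec => //; rewrite Ff //; last by rewrite /unit_ball eballE.
by apply/rowP => k; rewrite !mxE.
Qed.

Lemma squeezing_le (r : R) (f : 'rV[C]_n -> 'rV[C]_n) :
  holo D (unit_ball n) f -> set_inj D f -> f a = 0 -> eball 0 r `<=` f @` D -> r <= d.
Proof.
move=> hf injf fa rf; rewrite leNgt; apply/negP => dr.
have hf1 z : unit_ball n z -> ~ K z -> differentiable f z /\ enorm (f z) <= 1.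
  move=> Bz nKz; have [d1 b1] := hf z (conj Bz nKz); split; first exact: d1.
  by move: b1; rewrite /unit_ball eballE => /ltW.
have [F [hF Ff]] := extend_map ij (@open_unit_ball R n) cK KE hf1.
have hF' x : enorm x < 1 -> differentiable F x /\ enorm (F x) <= 1.
  by move=> x1; apply: hF; rewrite /unit_ball eballE.
have Fa : F a = 0 by rewrite Ff // /unit_ball eballE.
have Fw : enorm (F w0) < r := le_lt_trans (phi_schwarz_vec a1 hF' Fa w0_ball) dr.
have /choice [g hg] : forall y, exists x, enorm y < r -> D x /\ f x = y.
  move=> y; have [yr|] := ltP (enorm y) r; last by exists 0.
  by have [x Dx <-] := rf y (ltac:(by rewrite eballE)); exists x.
have oV : open [set y : 'rV[C]_n | enorm y < r].
  have -> : [set y : 'rV[C]_n | enorm y < r] = setT `&` [set y | enorm y < r] by rewrite setTI.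
  by apply: open_enorm_lt => [|z _]; [exact: openT | exact: enorm_continuous].
have dg := @inverse_holomorphic R n f g D _ open_domain (fun x Dx => (hf x Dx).1) injf oV hg.
have cF : {for w0, continuous F} := df_cont (hF' _ w0_ball).1.
have [e1 e10 h1] := (open_rnP _).1 oV _ Fw.
have [e2 e20 h2] := (cont_rnP _ _).1 cF _ e10.
have [e3 e30 h3] := (open_rnP _).1 (@open_unit_ball R n) _ (KB Kw0).
have [e [e0 ee2 ee3]] := common_lower_bound e20 e30.
(* The inverse [g] is holomorphic on the whole ball of radius r, hence continuous at [F w0]; but it
   takes values in [D], and w0 is in [K]. *)
have gF : g (F w0) = w0.
  refine (@extended_section n g F i j w0 e e0 cF (df_cont (dg _ Fw)) _).
  move=> y yw yE; have nKy : ~ K y by move=> /KE.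
  have By := h3 y (lt_le_trans yw ee3).
  have Fy : enorm (F y) < r by apply/h1/h2/(lt_le_trans yw).
  have [Dg fg] := hg _ Fy.
  apply: injf; [by rewrite inE | by rewrite inE; split | by rewrite fg Ff].
have [] := hg _ Fw; rewrite gF => /in_domain [_ nK] _.
exact: nK Kw0.
Qed.

Lemma fridman_le (r : R) (f : 'rV[C]_n -> 'rV[C]_n) :
  holo (unit_ball n) D f -> set_inj (unit_ball n) f ->
  caratheodory_ball D a r `<=` f @` unit_ball n -> tanh r <= d.
Proof.
move=> hf injf rf; rewrite leNgt; apply/negP => dr.
(* By [domain_schwarz], V minus [K] lies in the Carathéodory ball of radius r, so the inverse of [f]
   is defined there; [d < tanh r] puts w0 in V. *)
pose V := unit_ball n `&` [set y | enorm (phi a y) < tanh r].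
have oV : open V.
  apply: open_enorm_lt; first exact: open_unit_ball.
  move=> z; rewrite /unit_ball eballE => z1.
  exact: (@continuous_comp _ _ _ (phi a) (fun w => enorm w) z (df_cont (phi_diff a1 z1)) (@enorm_continuous _ _ _)).
have oVK : open (V `\` K) by rewrite setDE; apply: openI => //; exact: closed_openC.
have /choice [g hg] : forall y, exists x, (V `\` K) y -> unit_ball n x /\ f x = y.
  move=> y; have [[[By hy] nKy]|nV] := pselect ((V `\` K) y); last by exists 0.
  have y1 : enorm y < 1 by move: By; rewrite /unit_ball eballE.
  have Dy : D y by split.
  have [|x Bx <-] := rf y; last by exists x.
  split => //; apply: le_lt_trans (caratheodory_le a1 y1 _) _.
    by move=> h hh ha; exact: domain_schwarz.
  by rewrite lte_fin; apply: artanh_lt => //; rewrite enorm_ge0 /=; exact: phi_ball.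
have dg := @inverse_holomorphic R n f g _ _ (@open_unit_ball R n)
  (fun x Bx => (hf x Bx).1) injf oVK hg.
have hg1 z : V z -> ~ K z -> differentiable g z /\ enorm (g z) <= 1.
  move=> Vz nKz; split; first exact: dg.
  by have [] := hg z (conj Vz nKz); rewrite /unit_ball eballE => /ltW.
have [G [hG Gg]] := extend_map ij oV cK KE hg1.
have Vw : V w0 by split; [exact: KB | exact: dr].
have [e e0 he] := (open_rnP _).1 oV _ Vw.
(* Strictness matters: [f] is only controlled on the open ball. *)
have Gw : enorm (G w0) < 1.
  apply: (strict_bound ij (KE Kw0) e0) => [y /he Vy|y /he Vy yE].
    by have [] := hG y Vy.
  have nKy : ~ K y by move=> /KE.
  by rewrite Gg //; have [] := hg y (conj Vy nKy); rewrite /unit_ball eballE.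
have BG : unit_ball n (G w0) by rewrite /unit_ball eballE.
have [df Df] := hf _ BG.
have fG : f (G w0) = w0.
  refine (@extended_section n f G i j w0 e e0 (df_cont (hG _ Vw).1) (df_cont df) _).
  move=> y /he Vy yE; have nKy : ~ K y by move=> /KE.
    by rewrite Gg //; have [] := hg y (conj Vy nKy).
by move: Df; rewrite fG => /in_domain [_]; apply.
Qed.

Lemma squeezing_eq : squeezing D a = d%:E.
Proof.
have /andP[d0 d1] := d_bounds.
apply/eqP; rewrite eq_le; apply/andP; split.
  apply: ge_ereal_sup => _ [r [_ [f [h1 h2 h3 h4]]] <-].
  by rewrite lee_fin; apply: (squeezing_le h1 h2 h3 h4).
apply: ereal_sup_ubound; exists d => //; split => //; exists (phi a); split.
- move=> x /in_domain [x1 _]; split; first exact: phi_diff.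
  by rewrite /unit_ball eballE; exact: phi_ball.
- move=> x y /set_mem /in_domain [x1 _] /set_mem /in_domain [y1 _] E.
  by rewrite -(phiK a1 x1) E phiK.
- exact: phi_center.
- move=> y; rewrite eballE => yd; exists (phi a y); first exact: phi_off_K.
  by rewrite phiK // (lt_trans yd).
Qed.

Lemma fridman_eq : fridman D a = d%:E.
Proof.
have /andP[d0 d1] := d_bounds.
have dd : 0 <= d < 1 by rewrite ltW.
apply/eqP; rewrite eq_le; apply/andP; split.
  apply: ge_ereal_sup => _ [r [_ [f [h1 h2 h3]]] <-].
  by rewrite lee_fin; apply: (fridman_le h1 h2 h3).
apply: ereal_sup_ubound; exists (artanh d); last by rewrite tanh_artanh.
split; first by apply: artanh_gt0; rewrite d0.
have dC : d%:C != 0 :> C by rewrite -rn_gt0 rn_real gtr0_norm.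
have scaled (x : 'rV[C]_n) : enorm x < 1 -> enorm (d%:C *: x) < d.
  by move=> x1; rewrite enormZ rn_real gtr0_norm // gtr_pMr.
have Bx (x : 'rV[C]_n) : unit_ball n x -> enorm x < 1 by rewrite /unit_ball eballE.
exists (fun x => phi a (d%:C *: x)); split.
- move=> x /Bx x1; split; last exact/phi_off_K/scaled.
  have d2 : differentiable (fun x : 'rV[C]_n => d%:C *: x) x.
    by apply: differentiableZ; exact: df_id.
  by apply: (df_comp d2); apply: phi_diff => //; apply: lt_trans d1; exact: scaled.
- move=> x y /set_mem /Bx x1 /set_mem /Bx y1 E.
  have := congr1 (phi a) E; rewrite (phiK a1 (lt_trans (scaled x x1) d1)).
  by rewrite (phiK a1 (lt_trans (scaled y y1) d1)) => /(scalerI dC).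
- move=> w [Dw cw]; have [w1 nKw] := (in_domain w).1 Dw.
  have DB : D `<=` unit_ball n by move=> x [].
  (* Functions on the ball restricted to [D] show that the Carathéodory ball of radius [artanh d]
     lies in the set [enorm (phi a w) < d], the image of the scaled automorphism. *)
  have := le_lt_trans (caratheodory_ge DB a1 Dw) cw; rewrite lte_fin => lt_d.
  have wd : enorm (phi a w) < d.
    rewrite ltNge; apply/negP => h; move: lt_d; rewrite ltNge => /negP; apply.
    exact: (ler_artanh (ltW d0) h (phi_ball a1 w1)).
  exists (d^-1%:C *: phi a w).
    rewrite /unit_ball eballE enormZ rn_real gtr0_norm ?invr_gt0 //.
    by rewrite mulrC ltr_pdivrMr // mul1r.
  by rewrite scalerA -rmorphM mulfV ?gt_eqF // scale1r (phiK a1 w1).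
Qed.

End Domain.
End Complement.

Theorem theorem2p12 (R : realType) (n1 n2 : nat) (hn1 : (1 <= n1)%N) (hn2 : (2 <= n2)%N)
    (D1 : set 'rV[complex R]_n1) (hD1 : is_domain D1)
    (K : set 'rV[complex R]_(n1 + n2))
    (hK : K = closure (cprod D1 (imag_half_ball n2)))
    (hKcpt : compact K) (hKsub : K `<=` unit_ball (n1 + n2))
    (D : set 'rV[complex R]_(n1 + n2))
    (hD : D = unit_ball (n1 + n2) `\` K) (hDconn : connected D)
    (z : 'rV[complex R]_(n1 + n2)) (hz : D z) :
  squeezing D z = fridman D z /\ fridman D z = (caratheodory_dist K z)%:E.
Proof.
have n2_gt0 : (0 < n2)%N := ltnW hn2.
(* The first two coordinates of the second factor; this is where [2 <= n2] enters. *)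
pose i := rshift n1 (Ordinal n2_gt0); pose j := rshift n1 (Ordinal hn2).
have ij : i != j by rewrite /i /j (inj_eq (@rshift_inj _ _)).
have cK : closed K by rewrite hK; exact: closed_closure.
have KE : K `<=` coord_imag i j.
  rewrite hK (iffLR (closure_id _) (@closed_coord_imag R _ i j)); apply: closureS.
  move=> x [_ [x0 _]].
  by split; [have := x0 (Ordinal n2_gt0) | have := x0 (Ordinal hn2)]; rewrite !mxE.
(* A point of [D1] paired with 0 lies in the product, so the minimum over [K] is attained. *)
have K0 : K !=set0.
  have [[x D1x] _ _] := hD1; exists (row_mx x 0); rewrite hK; apply: subset_closure.
  split; first by rewrite row_mxKl.
  rewrite row_mxKr; split => [k|]; first by rewrite mxE.
  by rewrite eballE enorm0 invr_gt0.
move: hz; rewrite hD => -[zB nKz].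
have z1 : enorm z < 1 by move: zB; rewrite /unit_ball eballE.
have [w Kw hw] : exists2 w, K w & forall y, K y -> enorm (phi z w) <= enorm (phi z y).
  apply: (compact_min K0 hKcpt) => x /hKsub; rewrite /unit_ball eballE => x1.
  exact: (@continuous_comp _ _ _ (phi z) (fun w => enorm w) x (df_cont (phi_diff z1 x1))
    (@enorm_continuous _ _ _)).
rewrite (squeezing_eq ij cK KE hKsub Kw z1 nKz hw).
rewrite (fridman_eq ij cK KE hKsub Kw z1 nKz hw).
by rewrite (caratheodory_dist_min z1 hKsub Kw hw).
Qed.
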